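(* Let $d\ge 1$ and let $X=(X_i)_{i\in\mathbb{Z}^d}$ be a real-valued, mean zero, variance one, translation invariant random field with covariance $\mathbf{E}[X_iX_j]=K(i-j)$, where $(K(j))_{j\in\mathbb{Z}^d}\in\ell_1(\mathbb{Z}^d)$, and let $S(\theta)=\sum_{j\in\mathbb{Z}^d}e^{i\theta\cdot j}K(j)$, $\theta\in[-\pi,\pi]^d$, be its structure function. Suppose that $S$ is regular at the origin and bounded on $[-\pi,\pi]^d$. Then there is a constant $c>0$ such that, as $L\to\infty$, $$\operatorname{Var}(Q_{\mathcal{B}_L}(X))=\Theta\left(L^{2d}\int_{\|\xi\|\le c/L}S(\xi)\,d\xi+L^{d-1}\int_{\|\xi\|>c/L}\frac{S(\xi)}{\|\xi\|^{d+1}}\,d\xi\right),$$ where both integrals are over $\xi\in[-\pi,\pi]^d$.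
   Context: $\|\cdot\|$ is the Euclidean norm and $\mathcal{B}_L=\{x\in\mathbb{R}^d:\|x\|\le L\}$. For $\Lambda\subset\mathbb{R}^d$ bounded, $Q_\Lambda(X)=\sum_{i\in\Lambda\cap\mathbb{Z}^d}X_i$. A function $f:[-\pi,\pi]^d\to\mathbb{R}$ is called regular at the origin if there exist a function $A:[-\pi,\pi]^d\to\mathbb{R}$ (an enveloping function) and constants $c_1,c_2,\epsilon>0$ such that $c_1A(\xi)\le f(\xi)\le c_2A(\xi)$ for all $\|\xi\|\le\epsilon$, and the function $r\mapsto r^{-2}\int_{\mathbb{S}^{d-1}}A(r\omega)\,dV_{\mathbb{S}^{d-1}}(\omega)$ is monotone for $0<r\le\epsilon$, where $\mathbb{S}^{d-1}$ is the unit sphere in $\mathbb{R}^d$ and $dV_{\mathbb{S}^{d-1}}$ is its $(d-1)$-dimensional surface measure (counting measure on $\{-1,1\}$ if $d=1$). $f(L)=\Theta(g(L))$ as $L\to\infty$ means that there exist constants $c_1,c_2,L_0>0$ with $c_1g(L)\le f(L)\le c_2g(L)$ for all $L>L_0$. *)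

(* Defs.v *)
(* MathComp-Analysis: R is an arbitrary realType, R^d is 'rV[R]_d and Z^d is
   'rV[int]_d.  The norm that the library puts on 'rV[R]_d is the sup norm, so
   the Euclidean norm is defined below. *)
Set Warnings "-all".
From HB Require Import structures.
From mathcomp Require Import all_boot all_order all_algebra.
From mathcomp Require Import all_classical all_reals all_analysis.
From mathcomp Require Import measurable_realfun complex.
From mathcomp Require summability.

Set Implicit Arguments.
Unset Strict Implicit.
Unset Printing Implicit Defensive.

Import Order.TTheory GRing.Theory Num.Theory.
Import numFieldNormedType.Exports.

Local Open Scope classical_set_scope.
Local Open Scope ring_scope.

(* Product sigma-algebra on row vectors, generated by the coordinates (the
   library has it only for tuples). *)
Section measurable_row.
Context {d} {T : sigmaRingType d}.
Variable n : nat.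

Let coors : 'I_n -> 'rV[T]_n -> T := fun i x => x ord0 i.

Let row_set0 : g_sigma_preimage coors set0.
Proof. exact: sigma_algebra0. Qed.

Let row_setC A : g_sigma_preimage coors A -> g_sigma_preimage coors (~` A).
Proof. exact: sigma_algebraC. Qed.

Let row_bigcup (F : _^nat) : (forall i, g_sigma_preimage coors (F i)) ->
  g_sigma_preimage coors (\bigcup_i (F i)).
Proof. exact: sigma_algebra_bigcup. Qed.

HB.instance Definition _ := @isMeasurable.Build (measure_tuple_display d)
  ('rV[T]_n) (g_sigma_preimage coors) row_set0 row_setC row_bigcup.

End measurable_row.


Lemma measurable_coord d (T : sigmaRingType d) n (i : 'I_n) :
  measurable_fun [set: 'rV[T]_n] (fun x => x ord0 i).
Proof.
move=> _ Y mY; rewrite setTI; apply: sub_sigma_algebra => /=.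
rewrite -bigcup_seq/=; exists i => /=; first by rewrite mem_index_enum.
by exists Y => //; rewrite setTI.
Qed.

Lemma measurable_fun_rowP d1 d2 (T1 : measurableType d1)
    (T2 : measurableType d2) n (f : T1 -> 'rV[T2]_n) :
  measurable_fun [set: T1] f <->
  forall i, measurable_fun [set: T1] (fun t => f t ord0 i).
Proof.
split=> [mf i|mf].
  by apply: (@measurableT_comp _ _ _ _ _ _ (fun x : 'rV[T2]_n => x ord0 i));
    [exact: measurable_coord|exact: mf].
have sf : g_sigma_preimage (fun i => (fun x : 'rV[T2]_n => x ord0 i) \o f)
    `<=` measurable.
  apply: smallest_sub; first exact: sigma_algebra_measurable.
  case: n => [|n] in f mf *; first by rewrite big_ord0.
  rewrite -bigcup_mkord_ord; apply: bigcup_sub => i Ii.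
  by move=> A [B mB <-]; exact: mf.
move: sf; rewrite (g_sigma_preimage_comp (fun i (x : 'rV[T2]_n) => x ord0 i)).
by move=> sf _ A mA; apply: sf; exists A.
Qed.

Definition enorm {R : realType} {n} (x : 'rV[R]_n) : R :=
  Num.sqrt (\sum_(i < n) x ord0 i ^+ 2).

Definition dotp {R : realType} {n} (x y : 'rV[R]_n) : R :=
  \sum_(i < n) x ord0 i * y ord0 i.

Definition eball {R : realType} {n} (L : R) : set 'rV[R]_n :=
  [set x | enorm x <= L].

Definition usphere {R : realType} {n} : set 'rV[R]_n :=
  [set x | enorm x = 1].

(* [-pi, pi]^n *)
Definition cube {R : realType} {n} : set 'rV[R]_n :=
  [set x | forall i, - pi <= x ord0 i <= pi].

(* The library's sigma-finite instance on products is shadowed by the one for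
   finite measures. *)
Lemma product_sigma_finite d1 d2 (T1 : measurableType d1)
    (T2 : measurableType d2) (R : realType)
    (m1 : {sigma_finite_measure set T1 -> \bar R})
    (m2 : {sigma_finite_measure set T2 -> \bar R}) :
  sigma_finite setT (m1 \x m2)%E.
Proof.
have /sigma_finiteP[F [TF ndF Foo]] := sigma_finiteT m1.
have /sigma_finiteP[G [TG ndG Goo]] := sigma_finiteT m2.
exists (fun n => F n `*` G n).
  rewrite -setXTT TF TG predeqE => -[x y]; split.
    move=> [/= [n _ Fnx] [k _ Gky]]; exists (maxn n k) => //; split.
    - by move: x Fnx; exact/subsetPset/ndF/leq_maxl.
    - by move: y Gky; exact/subsetPset/ndG/leq_maxr.
  by move=> [n _ []/= ? ?]; split; exists n.
move=> k; have [? ?] := Foo k; have [? ?] := Goo k.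
split; first exact: measurableX.
by rewrite product_measure1E// lte_mul_pinfty// ge0_fin_numE.
Qed.

Section lebesgue_row.
Variable R : realType.

(* (a, (x_1, .., x_n)) |-> (a, x_1, .., x_n) *)
Definition row_cons n (p : measurableTypeR R * 'rV[R]_n) : 'rV[R]_n.+1 :=
  \row_i oapp (p.2 ord0) p.1 (unlift ord0 i).

Lemma measurable_row_cons n : measurable_fun setT (@row_cons n).
Proof.
apply/measurable_fun_rowP => i.
have [j ij|i0] := unliftP ord0 i.
- have -> : (fun t => @row_cons n t ord0 i) = (fun p => p.2 ord0 j).
    by apply/funext => p; rewrite mxE ij liftK.
  apply: (@measurableT_comp _ _ _ _ _ _ (fun x : 'rV[R]_n => x ord0 j)).
    exact: measurable_coord.
  exact: measurable_snd.
- have -> : (fun t => @row_cons n t ord0 i) = fst.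
    by apply/funext => p; rewrite mxE i0 unlift_none.
  move=> _ Y mY.
  exact: (@measurable_fst _ _ (measurableTypeR R) 'rV[R]_n measurableT Y mY).
Qed.

Definition row_uncons n (x : 'rV[R]_n.+1) : measurableTypeR R * 'rV[R]_n :=
  (x ord0 ord0, \row_j x ord0 (lift ord0 j)).

Lemma row_unconsK n : cancel (@row_uncons n) (@row_cons n).
Proof.
move=> x; apply/rowP => i; rewrite mxE.
by have [j ->|->] := unliftP ord0 i => /=; rewrite ?mxE.
Qed.

Lemma row_consK n : cancel (@row_cons n) (@row_uncons n).
Proof.
move=> [a x]; congr pair; first by rewrite mxE unlift_none.
by apply/rowP => j; rewrite !mxE liftK.
Qed.

Lemma measurable_row_uncons n : measurable_fun setT (@row_uncons n).
Proof.
apply/measurable_fun_pairP; split.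
  exact: (measurable_coord ord0).
apply/measurable_fun_rowP => i.
have -> : (fun t => (snd \o @row_uncons n) t ord0 i) =
    (fun x : 'rV[R]_n.+1 => x ord0 (lift ord0 i)).
  by apply/funext => x; rewrite /= mxE.
exact: measurable_coord.
Qed.

Section step.
Variables (n : nat) (mu : {sigma_finite_measure set 'rV[R]_n -> \bar R}).

Definition lebesgue_step : set 'rV[R]_n.+1 -> \bar R :=
  pushforward (lebesgue_measure \x mu)%E (@row_cons n).

Let mcons := @measurable_row_cons n.

Let step0 : lebesgue_step set0 = 0%E.
Proof. exact: measure0. Qed.

Let step_ge0 A : (0 <= lebesgue_step A)%E.
Proof. exact: measure_ge0. Qed.

Let step_sigma_additive : semi_sigma_additive lebesgue_step.
Proof. exact: measure_semi_sigma_additive. Qed.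

HB.instance Definition _ := isMeasure.Build _ _ _ lebesgue_step
  step0 step_ge0 step_sigma_additive.

Let step_sigma_finite : sigma_finite setT lebesgue_step.
Proof.
have [F FT Foo] := product_sigma_finite
  (@lebesgue_measure R : {sigma_finite_measure set _ -> \bar R}) mu.
exists (fun k => @row_uncons n @^-1` F k).
  by rewrite -preimage_bigcup -FT preimage_setT.
move=> k; have [mF Fk] := Foo k; split.
  by rewrite -[X in measurable X]setTI; exact: measurable_row_uncons.
rewrite /lebesgue_step /pushforward -comp_preimage.
by rewrite (_ : _ \o _ = id) ?preimage_id//; apply/funext/row_consK.
Qed.

HB.instance Definition _ := Measure_isSigmaFinite.Build _ _ _ lebesgue_step
  step_sigma_finite.

End step.

Fixpoint lebesgue_row n : {sigma_finite_measure set 'rV[R]_n -> \bar R} :=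
  if n is n'.+1 then lebesgue_step (lebesgue_row n') else \d_(0 : 'rV[R]_0).

Lemma lebesgue_row_box n (a b : 'rV[R]_n) :
  (forall i, a ord0 i <= b ord0 i) ->
  lebesgue_row n [set x | forall i, a ord0 i <= x ord0 i <= b ord0 i] =
  (\prod_i (b ord0 i - a ord0 i))%:E.
Proof.
elim: n => [|n IH] in a b *.
  move=> _; rewrite /= big_ord0 diracE mem_set//= => -[].
  done.
move=> ab; rewrite big_ord_recl EFinM /= /lebesgue_step /pushforward.
pose a' : 'rV[R]_n := \row_j a ord0 (lift ord0 j).
pose b' : 'rV[R]_n := \row_j b ord0 (lift ord0 j).
have -> : @row_cons n @^-1`
      [set x : 'rV[R]_n.+1 | forall i, a ord0 i <= x ord0 i <= b ord0 i] =
    (`[a ord0 ord0, b ord0 ord0]%classic : set (measurableTypeR R)) `*`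
    [set x : 'rV[R]_n | forall i, a' ord0 i <= x ord0 i <= b' ord0 i].
  apply/seteqP; split => -[r x] /= H.
    split; first by have := H ord0; rewrite mxE unlift_none/= in_itv.
    by move=> i; have := H (lift ord0 i); rewrite !mxE liftK.
  move: H => [+ H] i; rewrite in_itv/= => rab.
  have [j ->|->] := unliftP ord0 i; rewrite !mxE ?liftK ?unlift_none//=.
  by have := H j; rewrite !mxE.
rewrite product_measure1E//.
- rewrite IH => [|i]; last by rewrite !mxE.
  congr (_ * _)%E; last by congr EFin; apply: eq_bigr => i _; rewrite !mxE.
  have := lebesgue_measure_itv `[a ord0 ord0, b ord0 ord0].
  rewrite /= lte_fin => mab; apply: (eq_trans mab).
  have := ab ord0; rewrite le_eqVlt => /predU1P[->|->//].
  by rewrite ltxx subrr.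
- have -> : [set x : 'rV[R]_n | forall i, a' ord0 i <= x ord0 i <= b' ord0 i] =
      \bigcap_(i in [set: 'I_n])
        ((fun x : 'rV[R]_n => x ord0 i) @^-1` `[a' ord0 i, b' ord0 i]%classic).
    apply/seteqP; split => x /= H i => [_|].
      by rewrite /= in_itv/=; exact: H.
    by have := H i I; rewrite /= in_itv.
  apply: fin_bigcap_measurable => // i _.
  rewrite -[X in measurable X]setTI; apply: measurable_coord => //.
Qed.

End lebesgue_row.

Section surface_measure.
Variables (R : realType) (n : nat).

Lemma measurable_enorm : measurable_fun setT (@enorm R n).
Proof.
have -> : @enorm R n = (fun x => (\sum_(i < n) x ord0 i ^+ 2) `^ 2^-1).
  by apply/funext => x; rewrite powR12_sqrt// sumr_ge0// => i _; exact: sqr_ge0.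
apply: (measurableT_comp (measurable_powR _)).
apply: measurable_sum => i; apply: measurable_funX; exact: measurable_coord.
Qed.

Definition normalize (x : 'rV[R]_n) : 'rV[R]_n := (enorm x)^-1 *: x.

Lemma measurable_normalize : measurable_fun setT normalize.
Proof.
apply/measurable_fun_rowP => i.
have -> : (fun x => normalize x ord0 i) =
    (fun x => enorm x `^ (-1)) \* (fun x : 'rV[R]_n => x ord0 i).
  by apply/funext => x; rewrite mxE/= powR_inv1// sqrtr_ge0.
apply: measurable_funM; last exact: measurable_coord.
exact: (measurableT_comp (measurable_powR _) measurable_enorm).
Qed.

Definition punctured_ball : set 'rV[R]_n := [set x | 0 < enorm x <= 1].

Lemma measurable_punctured_ball : measurable punctured_ball.
Proof.
rewrite (_ : punctured_ball = @enorm R n @^-1` `]0, 1]%classic).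
  by rewrite -[X in measurable X]setTI; exact: measurable_enorm.
by apply/seteqP; split => x /=; rewrite in_itv.
Qed.

(* The surface measure of A `<=` S^(n-1) is n times the volume of the cone
   {r w | 0 < r <= 1, w \in A}; it is the unique measure for which integration
   in polar coordinates, dx = r^(n-1) dr dV(w), holds.  For n = 1 it is the
   counting measure on {-1, 1}.  It is a measure on the ambient R^n, null
   outside the sphere. *)
Definition surface_measure (A : set 'rV[R]_n) : \bar R :=
  (n%:R%:E * lebesgue_row R n (normalize @^-1` A `&` punctured_ball))%E.

Let mnorm := measurable_normalize.

Let cone_measure := pushforward
  (mrestr (lebesgue_row R n) measurable_punctured_ball) normalize.

Let surface0 : surface_measure set0 = 0%E.
Proof. by rewrite /surface_measure preimage_set0 set0I measure0 mule0. Qed.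

Let surface_ge0 A : (0 <= surface_measure A)%E.
Proof. by rewrite mule_ge0. Qed.

Let cone0 : cone_measure set0 = 0%E. Proof. exact: measure0. Qed.

Let cone_ge0 A : (0 <= cone_measure A)%E. Proof. exact: measure_ge0. Qed.

Let cone_sigma_additive : semi_sigma_additive cone_measure.
Proof. exact: measure_semi_sigma_additive. Qed.

HB.instance Definition _ := isMeasure.Build _ _ _ cone_measure
  cone0 cone_ge0 cone_sigma_additive.

Let surface_sigma_additive : semi_sigma_additive surface_measure.
Proof. exact: (@measure_semi_sigma_additive _ _ _ (mscale n%:R%:nng cone_measure)). Qed.

HB.instance Definition _ := isMeasure.Build _ _ _ surface_measure
  surface0 surface_ge0 surface_sigma_additive.

End surface_measure.

(* The integrability clause says that the spherical averages are defined, and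
   eps <= pi that the spheres of radius at most eps lie in the cube on which
   A is given. *)
Definition regular_at_origin (R : realType) (d : nat) (f : 'rV[R]_d -> R) :=
  exists (A : 'rV[R]_d -> R) (c1 c2 eps : R),
  let avg (r : R) :=
    r ^- 2 * \int[@surface_measure R d]_(w in usphere) A (r *: w) in
  [/\ [/\ 0 < c1, 0 < c2, 0 < eps & eps <= pi],
      forall xi, cube xi -> enorm xi <= eps ->
        c1 * A xi <= f xi <= c2 * A xi,
      forall r, 0 < r <= eps ->
        (@surface_measure R d).-integrable usphere
          (fun w => (A (r *: w))%:E) &
      (forall r s, 0 < r -> r <= s -> s <= eps -> avg r <= avg s) \/
      (forall r s, 0 < r -> r <= s -> s <= eps -> avg s <= avg r)].

Definition is_Theta (R : realType) (f g : R -> \bar R) :=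
  exists c1 c2 L0 : R, [/\ 0 < c1, 0 < c2, 0 < L0 &
    forall L, L0 < L -> (c1%:E * g L <= f L <= c2%:E * g L)%E].

Definition lattice_pt (R : realType) (d : nat) (i : 'rV[int]_d) : 'rV[R]_d :=
  map_mx intr i.

Definition expi (R : realType) (x : R) : R[i] := (cos x +i* sin x)%C.

(* Unconditional sum over Z^d in the complex plane.  When K is even and
   summable, as for a covariance, the sum is real and Re only retypes it. *)
Definition structure_function (R : realType) (d : nat) (K : 'rV[int]_d -> R)
    (theta : 'rV[R]_d) : R :=
  complex.Re (summability.sum (fun j : 'rV[int]_d =>
    (expi (dotp theta (lattice_pt R j)) * (K j)%:C%C : (R[i])^o))).

Section random_field.
Context {disp : measure_display} {Omega : measurableType disp} {R : realType}
  (P : probability Omega R) {d : nat}.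
Implicit Type X : 'rV[int]_d -> {RV P >-> R}.

(* The product sigma-algebra on R^(Z^d). *)
Definition field_events : set (set ('rV[int]_d -> R)) :=
  <<s \bigcup_i
        preimage_set_system setT (fun x : 'rV[int]_d -> R => x i) measurable >>.

Definition translation_invariant X :=
  forall (k : 'rV[int]_d) (E : set ('rV[int]_d -> R)), field_events E ->
    P [set w | E (fun i => X (i + k) w)] = P [set w | E (fun i => X i w)].

(* A finite sum for bounded Lambda. *)
Definition Q (Lambda : set 'rV[R]_d) X : Omega -> R :=
  fun w => \sum_(i \in [set i | Lambda (lattice_pt R i)]) X i w.

End random_field.

(* Main.v *)
(* The variance is (2 pi)^-d times the integral of S D^2 over the cube, where
   D(xi) is the sum of cos (xi . j) over the lattice points j of the ball.

   Near the origin D is compared with the Fourier transform F of the ball, which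
   is radial.  If s is the Fourier transform of the unit cell, bounded below near
   0, then D s - F has squared L^2 norm O(L^(d-1)), by Parseval and by a count of
   the lattice points at bounded distance from the sphere.

   Bessel asymptotics are avoided.  Shifting the lattice ball by h e_i multiplies
   D^2 by 2 - 2 cos (h xi_i), and the symmetric difference is counted directly;
   hence D^2 has mass O(L^(d-1) / t) on |xi| > t, and |xi|^2 D^2 has mass
   comparable to t L^(d-1) on |xi| <= t.  So |xi|^2 F^2 and |xi|^2 k_L, where
   k_L(r) is L^(2d) for r <= 1/L and L^(d-1) / r^(d+1) beyond, have comparable
   integrals over all small balls.  In polar coordinates the spherical average
   of S is comparable to r^2 m(r) with m monotone: if m is nonincreasing, a layer
   cake decomposition of m makes the integrals of S F^2 and S k_L comparable; if
   m is nondecreasing, both are O(L^(d-1)).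

   The errors O(L^(d-1)) are harmless.  The integral of S k_L is at least
   c L^(d-1) because k_L is, on the cube.  For the variance, Cauchy-Schwarz for
   the covariance form is applied to the sum over the ball and to a sum of
   differences X_p - X_(p + e), where p runs over c L^(d-1) points on top of the
   ball around which the ball and its translate by - e differ, in a large window,
   only at the centre. *)
Require Import Defs.
Set Warnings "-all".
From HB Require Import structures.
From mathcomp Require Import all_boot all_order all_algebra.
From mathcomp Require Import all_classical all_reals all_analysis.
From mathcomp Require Import measurable_realfun complex.
From mathcomp Require Import ring lra.
From mathcomp Require Import zify.
From mathcomp Require summability.

Import Order.TTheory GRing.Theory Num.Theory.
Import numFieldNormedType.Exports.

Set Implicit Arguments.
Unset Strict Implicit.
Unset Printing Implicit Defensive.

Local Open Scope classical_set_scope.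
Local Open Scope ring_scope.

(** * Lebesgue measure on R^n *)

(** The transform of the ball oscillates and has zeros, so it dominates the kernel only after
    averaging over balls, never pointwise. Regularity is what carries a comparison over balls to
    integrals against S, and it speaks of spherical averages only; hence the passage from the
    lattice sum, which is not radial, to the transform of the ball, and back. The weight |xi|^2
    matches the factor r^-2 of regularity, and under it the masses at the radii t and t / 2 are
    comparable, which leaves room in the layer cake argument. The discretization error is small only
    in L^2, so against S it costs sup S times L^(d-1). Absorbing it needs a lower bound on the
    variance, and the estimates in frequency do not give one: S may vanish on open sets away from
    the origin, and they locate the mass of D^2 only by its distance to the origin. That bound is
    therefore proved in space. From the lattice ball on, the dimension is mostly written n + 1, so
    that L^(d-1) is L^n. *)

Notation pushm mu mf :=
  (measure_function_pushforward__canonical__measure_function_Measure mu mf).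

Section row_measurability.
Variable R : realType.

Lemma measurable_dotp n (x : 'rV[R]_n) : measurable_fun setT (dotp x).
Proof.
apply: measurable_sum => i; apply: measurable_funM; first exact: measurable_cst.
exact: measurable_coord.
Qed.

Lemma measurable_row_shift n (v : 'rV[R]_n) :
  measurable_fun setT (fun x : 'rV[R]_n => x + v).
Proof.
apply/measurable_fun_rowP => i.
have -> : (fun t : 'rV[R]_n => (t + v) ord0 i) = (fun t => t ord0 i + v ord0 i).
  by apply/funext => t; rewrite mxE.
apply: measurable_funD; last exact: measurable_cst.
exact: measurable_coord.
Qed.

Lemma measurable_row_add n :
  measurable_fun setT (fun p : 'rV[R]_n * 'rV[R]_n => p.1 + p.2).
Proof.
apply/measurable_fun_rowP => i.
have -> : (fun t : 'rV[R]_n * 'rV[R]_n => (t.1 + t.2) ord0 i) =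
    (fun t => t.1 ord0 i + t.2 ord0 i).
  by apply/funext => t; rewrite mxE.
apply: measurable_funD.
  apply: (@measurableT_comp _ _ _ _ _ _ (fun x : 'rV[R]_n => x ord0 i)).
    exact: measurable_coord.
  exact: measurable_fst.
apply: (@measurableT_comp _ _ _ _ _ _ (fun x : 'rV[R]_n => x ord0 i)).
  exact: measurable_coord.
exact: measurable_snd.
Qed.

Lemma measurable_preim d1 d2 (T1 : measurableType d1) (T2 : measurableType d2)
    (f : T1 -> T2) (A : set T2) :
  measurable_fun setT f -> measurable A -> measurable (f @^-1` A).
Proof. by move=> mf mA; rewrite -[X in measurable X]setTI; exact: mf. Qed.

(** The translated measure agrees with Lebesgue measure on half-open intervals, which determine
    it. *)
Lemma lebesgue_measure_shift (a : R) (A : set (measurableTypeR R)) :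
  measurable A ->
  lebesgue_measure ((fun x : R => x + a) @^-1` A) = lebesgue_measure A.
Proof.
move=> mA.
have mf : measurable_fun setT
    (fun x : measurableTypeR R => (x + a)%R : measurableTypeR R).
  by apply: measurable_funD; [exact: measurable_id|exact: measurable_cst].
pose mu := pushm (@lebesgue_measure R) mf.
apply/esym; change (lebesgue_measure A = mu A).
apply: (@lebesgue_measure_unique R mu _ A mA) => _ [[b c]] _ <-.
rewrite [RHS]/=/pushforward /=.
have -> : (fun x : R => x + a) @^-1` `]b, c]%classic = `]b - a, c - a]%classic.
  apply/seteqP; split => x /=; rewrite !in_itv/=.
    by rewrite ltrBlDr lerBrDr.
  by rewrite ltrBlDr lerBrDr.
rewrite !lebesgue_measure_itv/= !lte_fin ltrD2r.
by case: ifP => // _; rewrite -!EFinB; congr EFin; ring.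
Qed.

(** Induction on the dimension: through [row_cons] a translation is a product of two translations,
    and a product measure is determined by its values on rectangles. *)
Lemma lebesgue_row_shift n (v : 'rV[R]_n) (A : set 'rV[R]_n) : measurable A ->
  lebesgue_row R n ((fun x => x + v) @^-1` A) = lebesgue_row R n A.
Proof.
elim: n v A => [|n IH] v A mA.
  by congr (lebesgue_row R 0 _); apply/seteqP; split => x /=; rewrite !thinmx0.
rewrite /= /lebesgue_step /pushforward.
pose a := v ord0 ord0; pose w : 'rV[R]_n := \row_j v ord0 (lift ord0 j).
pose tr (p : measurableTypeR R * 'rV[R]_n) : measurableTypeR R * 'rV[R]_n :=
  (p.1 + a, p.2 + w).
have mtr : measurable_fun setT tr.
  apply/measurable_fun_pairP; split.
    apply: measurable_funD; first exact: measurable_fst.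
    exact: measurable_cst.
  apply: (@measurableT_comp _ _ _ _ _ _ (fun x : 'rV[R]_n => x + w)).
    exact: measurable_row_shift.
  exact: measurable_snd.
have E p : row_cons p + v = row_cons (tr p).
  apply/rowP => i; rewrite !mxE.
  by have [j ->|->] := unliftP ord0 i; rewrite ?liftK ?unlift_none/= ?mxE.
have -> : @row_cons R n @^-1` ((fun x => x + v) @^-1` A) =
    tr @^-1` (@row_cons R n @^-1` A).
  by apply/seteqP; split => p; rewrite /preimage/= E.
apply/esym.
pose mu := pushm (@lebesgue_measure R \x lebesgue_row R n)%E mtr.
change ((lebesgue_measure \x lebesgue_row R n)%E (@row_cons R n @^-1` A) =
  mu (@row_cons R n @^-1` A)).
apply: (@product_measure_unique _ _ _ _ _ _ _ mu).
  move=> B C mB mC; rewrite [LHS]/= /pushforward.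
  have -> : tr @^-1` (B `*` C) =
     ((fun x : measurableTypeR R => (x + a)%R : measurableTypeR R) @^-1` B) `*`
     ((fun x => x + w) @^-1` C) by [].
  rewrite product_measure1E//; first 1 last.
  - apply: measurable_preim => //.
    by apply: measurable_funD; [exact: measurable_id|exact: measurable_cst].
  - apply: measurable_preim => //; exact: measurable_row_shift.
  congr (_ * _)%E; [exact: lebesgue_measure_shift|exact: IH].
exact: measurable_preim (@measurable_row_cons R n) mA.
Qed.

(** Slicing along either factor defines a measure with the same values on rectangles. *)
Lemma product_measure12 d1 d2 (T1 : measurableType d1) (T2 : measurableType d2)
    (m1 : {sigma_finite_measure set T1 -> \bar R})
    (m2 : {sigma_finite_measure set T2 -> \bar R}) (G : set (T1 * T2)) :
  measurable G -> (\int[m1]_x m2 (xsection G x) = \int[m2]_y m1 (ysection G y))%E.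
Proof.
move=> mG; change ((m1 \x m2)%E G = (m1 \x^ m2)%E G).
by apply: product_measure_unique => // A B mA mB /=; rewrite product_measure2E.
Qed.

(* Tonelli applied to the indicators of {(x, y) | y \in F, x + y \in E} and of
   its image {(x, y) | y - x \in F, y \in E}, whose fibres over x are translates
   of each other. *)
Lemma shift_invariant_measure n (mu : {sigma_finite_measure set 'rV[R]_n -> \bar R})
    (E F : set 'rV[R]_n) :
  (forall (v : 'rV[R]_n) (A : set 'rV[R]_n), measurable A ->
    mu ((fun x => x + v) @^-1` A) = mu A) ->
  measurable E -> measurable F -> (forall x, F x -> F (- x)) ->
  (lebesgue_row R n E * mu F = mu E * lebesgue_row R n F)%E.
Proof.
move=> inv mE mF symF.
pose G := [set p : 'rV[R]_n * 'rV[R]_n | F p.2 /\ E (p.1 + p.2)].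
pose G' := [set p : 'rV[R]_n * 'rV[R]_n | F (p.2 - p.1) /\ E p.2].
have mneg : measurable_fun setT (fun p : 'rV[R]_n * 'rV[R]_n => p.2 - p.1).
  apply/measurable_fun_rowP => i.
  have -> : (fun t : 'rV[R]_n * 'rV[R]_n => (t.2 - t.1) ord0 i) =
      (fun t => t.2 ord0 i - t.1 ord0 i).
    by apply/funext => t; rewrite !mxE.
  apply: measurable_funB.
    apply: (@measurableT_comp _ _ _ _ _ _ (fun x : 'rV[R]_n => x ord0 i)).
      exact: measurable_coord.
    exact: measurable_snd.
  apply: (@measurableT_comp _ _ _ _ _ _ (fun x : 'rV[R]_n => x ord0 i)).
    exact: measurable_coord.
  exact: measurable_fst.
have mG : measurable G.
  apply: measurableI.
    exact: (measurable_preim (@measurable_snd _ _ 'rV[R]_n 'rV[R]_n) mF).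
  exact: (measurable_preim (@measurable_row_add n) mE).
have mG' : measurable G'.
  apply: measurableI.
    exact: (measurable_preim mneg mF).
  exact: (measurable_preim (@measurable_snd _ _ 'rV[R]_n 'rV[R]_n) mE).
have GG' : (\int[lebesgue_row R n]_x mu (xsection G x) =
    \int[lebesgue_row R n]_x mu (xsection G' x))%E.
  apply: eq_integral => x _.
  rewrite -(inv (- x) (xsection G x)); last exact: measurable_xsection.
  have e (y : 'rV[R]_n) : x + (y - x) = y by rewrite addrC subrK.
  by congr (mu _); apply/seteqP; split => y;
    rewrite /= /xsection /G /G' /= !inE /= e.
move: GG'; rewrite !product_measure12//.
have -> : (\int[mu]_y lebesgue_row R n (ysection G y) =
    \int[mu]_y (lebesgue_row R n E * (\1_F y)%:E))%E.
  apply: eq_integral => y _; rewrite indicE.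
  have [yF|yF] := boolP (y \in F); rewrite ?mule1 ?mule0.
    rewrite -(lebesgue_row_shift y mE); congr (lebesgue_row R n _).
    apply/seteqP; split => x; rewrite /= /ysection /G /= !inE /=; first by case.
    by split => //; rewrite -inE.
  rewrite (_ : ysection G y = set0) ?measure0//; apply/seteqP; split => x //.
  by rewrite /ysection /G /= !inE /= => -[+ _]; rewrite -inE (negbTE yF).
(* The fibre over y is y - F, which the symmetry of [F] turns into a translate of [F]. *)
have -> : (\int[mu]_y lebesgue_row R n (ysection G' y) =
    \int[mu]_y (lebesgue_row R n F * (\1_E y)%:E))%E.
  apply: eq_integral => y _; rewrite indicE.
  have [yE|yE] := boolP (y \in E); rewrite ?mule1 ?mule0.
    rewrite -(lebesgue_row_shift (- y) mF); congr (lebesgue_row R n _).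
    apply/seteqP; split => x; rewrite /= /ysection /G' /= !inE /=.
      by move=> [/symF + _]; rewrite opprB.
    by move=> /symF; rewrite opprB => ?; split => //; rewrite -inE.
  rewrite (_ : ysection G' y = set0) ?measure0//; apply/seteqP; split => x //.
  by rewrite /ysection /G' /= !inE /= => -[_]; rewrite -inE (negbTE yE).
rewrite !ge0_integralZl//.
- by rewrite !integral_indic// !setIT => ->; rewrite muleC.
all: by [move=> *; rewrite lee_fin|
  apply/measurable_EFinP; exact: measurable_indic].
Qed.

End row_measurability.

(** * Euclidean norm and inner product *)

Section euclidean_norm.
Variable R : realType.
Implicit Types (n : nat).

Lemma enorm_ge0 n (x : 'rV[R]_n) : 0 <= enorm x.
Proof. exact: sqrtr_ge0. Qed.

Lemma sqr_enorm n (x : 'rV[R]_n) : enorm x ^+ 2 = \sum_i x ord0 i ^+ 2.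
Proof. by rewrite sqr_sqrtr// sumr_ge0// => i _; exact: sqr_ge0. Qed.

Lemma dotpp n (x : 'rV[R]_n) : dotp x x = enorm x ^+ 2.
Proof. by rewrite sqr_enorm; apply: eq_bigr => i _; rewrite expr2. Qed.

Lemma enorm0 n : enorm (0 : 'rV[R]_n) = 0.
Proof. by rewrite /enorm big1 ?sqrtr0// => i _; rewrite mxE expr0n. Qed.

Lemma enormZ n (r : R) (x : 'rV[R]_n) : enorm (r *: x) = `|r| * enorm x.
Proof.
rewrite -sqrtr_sqr -sqrtrM ?sqr_ge0//; congr Num.sqrt.
by rewrite mulr_sumr; apply: eq_bigr => i _; rewrite mxE exprMn.
Qed.

Lemma enormN n (x : 'rV[R]_n) : enorm (- x) = enorm x.
Proof. by rewrite -scaleN1r enormZ normrN1 mul1r. Qed.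

Lemma coord_le_enorm n (x : 'rV[R]_n) i : `|x ord0 i| <= enorm x.
Proof.
rewrite -sqrtr_sqr ler_wsqrtr// (bigD1 i)//= lerDl sumr_ge0// => j _.
exact: sqr_ge0.
Qed.

Lemma dotpC n (x y : 'rV[R]_n) : dotp x y = dotp y x.
Proof. by apply: eq_bigr => i _; rewrite mulrC. Qed.

Lemma dotpDr n (x y z : 'rV[R]_n) : dotp x (y + z) = dotp x y + dotp x z.
Proof.
by rewrite /dotp -big_split/=; apply: eq_bigr => i _; rewrite mxE mulrDr.
Qed.

Lemma dotpZr n r (x y : 'rV[R]_n) : dotp x (r *: y) = r * dotp x y.
Proof. by rewrite /dotp mulr_sumr; apply: eq_bigr => i _; rewrite mxE mulrCA. Qed.

Lemma dotpDl n (x y z : 'rV[R]_n) : dotp (y + z) x = dotp y x + dotp z x.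
Proof. by rewrite dotpC dotpDr !(dotpC x). Qed.

Lemma dotpZl n r (x y : 'rV[R]_n) : dotp (r *: x) y = r * dotp x y.
Proof. by rewrite dotpC dotpZr dotpC. Qed.

Lemma dotpNr n (x y : 'rV[R]_n) : dotp x (- y) = - dotp x y.
Proof. by rewrite -scaleN1r dotpZr mulN1r. Qed.

Lemma dotpBr n (x y z : 'rV[R]_n) : dotp x (y - z) = dotp x y - dotp x z.
Proof. by rewrite dotpDr dotpNr. Qed.

Lemma dotpNl n (x y : 'rV[R]_n) : dotp (- x) y = - dotp x y.
Proof. by rewrite dotpC dotpNr dotpC. Qed.

Lemma dotp0 n (x : 'rV[R]_n) : dotp x 0 = 0.
Proof. by rewrite -(scale0r 0) dotpZr mul0r. Qed.

Lemma sqr_enormD n (x y : 'rV[R]_n) :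
  enorm (x + y) ^+ 2 = enorm x ^+ 2 + 2 * dotp x y + enorm y ^+ 2.
Proof. by rewrite -!dotpp dotpDr !dotpDl (dotpC y x); ring. Qed.

Lemma enorm_eq0 n (x : 'rV[R]_n) : enorm x = 0 -> x = 0.
Proof.
move=> x0; apply/rowP => i; rewrite mxE; apply/eqP.
by rewrite -normr_le0 -x0 coord_le_enorm.
Qed.

(** Cauchy-Schwarz, from the square of the vector |y| x - |x| y once zero vectors are set aside. *)
Lemma dotp_le n (x y : 'rV[R]_n) : dotp x y <= enorm x * enorm y.
Proof.
have [/enorm_eq0 ->|x0] := eqVneq (enorm x) 0.
  by rewrite enorm0 mul0r dotpC dotp0.
have [/enorm_eq0 ->|y0] := eqVneq (enorm y) 0.
  by rewrite enorm0 mulr0 dotp0.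
have xy0 : 0 < enorm x * enorm y.
  by rewrite mulr_gt0// lt_neqAle eq_sym ?x0 ?y0 enorm_ge0.
have := sqr_ge0 (enorm (enorm y *: x - enorm x *: y)).
rewrite sqr_enormD enormN !enormZ !ger0_norm ?enorm_ge0// dotpNr dotpZl dotpZr.
move: (enorm x) (enorm y) (dotp x y) xy0 => a b c ab0 H.
rewrite -subr_ge0 -(pmulr_rge0 _ ab0).
have -> : a * b * (a * b - c) =
  ((b * a) ^+ 2 + 2 * - (b * (a * c)) + (a * b) ^+ 2) / 2 by field.
by rewrite divr_ge0.
Qed.

Lemma norm_dotp_le n (x y : 'rV[R]_n) : `|dotp x y| <= enorm x * enorm y.
Proof.
by rewrite ler_norml dotp_le andbT lerNl -dotpNl -(enormN x) dotp_le.
Qed.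

Lemma enorm_le_sum n (x : 'rV[R]_n) : enorm x <= \sum_i `|x ord0 i|.
Proof.
have s0 : 0 <= \sum_i `|x ord0 i| by rewrite sumr_ge0.
rewrite -(@ler_pXn2r _ 2)// ?nnegrE ?enorm_ge0// sqr_enorm expr2 mulr_suml.
apply: ler_sum => i _; rewrite -[X in X <= _]ger0_norm ?sqr_ge0// normrX expr2.
rewrite ler_wpM2l//.
by rewrite (bigD1 i)//= lerDl sumr_ge0.
Qed.

End euclidean_norm.

(** * Lebesgue measure under linear maps, dilations and isometries *)

Section linear_image.
Variable (R : realType) (n : nat) (f g : 'rV[R]_n -> 'rV[R]_n).
Hypotheses (fD : {morph f : x y / x + y}) (fg : cancel f g) (gf : cancel g f).
Hypotheses (mf : measurable_fun setT f) (mg : measurable_fun setT g).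

Let image_measure : set 'rV[R]_n -> \bar R := pushforward (lebesgue_row R n) f.

Let image0 : image_measure set0 = 0%E.
Proof. by rewrite /image_measure /pushforward preimage_set0 measure0. Qed.

Let image_ge0 A : (0 <= image_measure A)%E. Proof. exact: measure_ge0. Qed.

Let image_sigma_additive : semi_sigma_additive image_measure.
Proof. exact: (@measure_semi_sigma_additive _ _ _ (pushm (lebesgue_row R n) mf)). Qed.

HB.instance Definition _ := isMeasure.Build _ _ _ image_measure
  image0 image_ge0 image_sigma_additive.

Let image_sigma_finite : sigma_finite setT image_measure.
Proof.
have [F FT Foo] := sigma_finiteT (lebesgue_row R n).
exists (fun k => g @^-1` F k).
  by rewrite -preimage_bigcup -FT preimage_setT.
move=> k; have [mF Fk] := Foo k; split; first exact: measurable_preim.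
rewrite /image_measure /pushforward (_ : f @^-1` _ = F k)//.
by apply/seteqP; split => x; rewrite /preimage/= fg.
Qed.

HB.instance Definition _ := Measure_isSigmaFinite.Build _ _ _ image_measure
  image_sigma_finite.

(** The push-forward of Lebesgue measure by a linear bijection is translation invariant, hence
    proportional to Lebesgue measure. The symmetric set [F] calibrates the factor, so that no
    determinant appears. *)
Lemma linear_preimage_measure (E F : set 'rV[R]_n) :
  measurable E -> measurable F -> (forall x, F x -> F (- x)) ->
  (lebesgue_row R n E * lebesgue_row R n (f @^-1` F) =
   lebesgue_row R n (f @^-1` E) * lebesgue_row R n F)%E.
Proof.
move=> mE mF symF.
apply: (@shift_invariant_measure R n image_measure) => // v A mA.
rewrite /= /image_measure /pushforward.
rewrite -(lebesgue_row_shift (g v) (measurable_preim mf mA)).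
by congr (lebesgue_row R n _); apply/seteqP; split => x;
  rewrite /preimage/= fD gf.
Qed.

End linear_image.

Section measure_preserving.
Context d1 d2 (T1 : measurableType d1) (T2 : measurableType d2) (R : realType).
Variables (m1 : {measure set T1 -> \bar R}) (m2 : {measure set T2 -> \bar R}).
Variable (f : T1 -> T2).
Hypotheses (mf : measurable_fun setT f)
  (m12 : forall A, measurable A -> m1 (f @^-1` A) = m2 A).

Lemma integral_measure_preserving (D : set T2) (h : T2 -> \bar R) :
  measurable D -> measurable_fun setT h ->
  m1.-integrable (f @^-1` D) (h \o f) ->
  (\int[m1]_(x in f @^-1` D) h (f x) = \int[m2]_(y in D) h y)%E.
Proof.
move=> mD mh ih; rewrite -(integral_pushforward mf mh ih mD).
apply: (@eq_measure_integral _ _ _ D m2 (pushm m1 mf) h) => A mA _.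
exact: m12.
Qed.

End measure_preserving.

Section scaling.
Variable (R : realType) (n : nat).

Lemma measurable_row_scale (r : R) :
  measurable_fun setT (fun x : 'rV[R]_n => r *: x).
Proof.
apply/measurable_fun_rowP => i.
have -> : (fun t : 'rV[R]_n => (r *: t) ord0 i) = (fun t => r * t ord0 i).
  by apply/funext => t; rewrite mxE.
apply: measurable_funM; first exact: measurable_cst.
exact: measurable_coord.
Qed.

Definition centered_box (a : R) : set 'rV[R]_n :=
  [set x | forall i, - a <= x ord0 i <= a].

Lemma measurable_box (a b : 'rV[R]_n) :
  measurable [set x : 'rV[R]_n | forall i, a ord0 i <= x ord0 i <= b ord0 i].
Proof.
have -> : [set x : 'rV[R]_n | forall i, a ord0 i <= x ord0 i <= b ord0 i] =
    \bigcap_(i in [set: 'I_n])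
      ((fun x : 'rV[R]_n => x ord0 i) @^-1` `[a ord0 i, b ord0 i]%classic).
  apply/seteqP; split => x /= H i => [_|].
    by rewrite /= in_itv/=; exact: H.
  by have := H i I; rewrite /= in_itv.
apply: fin_bigcap_measurable => // i _.
by apply: measurable_preim => //; exact: measurable_coord.
Qed.

Lemma centered_boxE (a : R) : centered_box a =
  [set x : 'rV[R]_n | forall i,
    (const_mx (- a) : 'rV_n) ord0 i <= x ord0 i <= (const_mx a : 'rV_n) ord0 i].
Proof. by apply/seteqP; split => x H i; have := H i; rewrite !mxE. Qed.

Lemma measurable_centered_box (a : R) : measurable (centered_box a).
Proof. by rewrite centered_boxE; exact: measurable_box. Qed.

Lemma lebesgue_centered_box (a : R) : 0 <= a ->
  lebesgue_row R n (centered_box a) = ((2 * a) ^+ n)%:E.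
Proof.
move=> a0; rewrite centered_boxE lebesgue_row_box => [|i]; last first.
  by rewrite !mxE; lra.
congr EFin; rewrite (eq_bigr (fun=> 2 * a)) => [|i _]; last by rewrite !mxE; ring.
by rewrite prodr_const card_ord.
Qed.

Lemma centered_boxN (a : R) (x : 'rV[R]_n) : centered_box a x -> centered_box a (- x).
Proof. by move=> H i; have := H i; rewrite mxE; lra. Qed.

(** The factor is read off the box of half-width 1/2, which has volume 1 and whose preimage is again
    a centered box. *)
Lemma lebesgue_row_scale (r : R) (E : set 'rV[R]_n) : 0 < r -> measurable E ->
  lebesgue_row R n ((fun x => r *: x) @^-1` E) =
  ((r ^+ n)^-1%:E * lebesgue_row R n E)%E.
Proof.
move=> r0 mE; have rn0 : r != 0 by rewrite gt_eqF.
have := @linear_preimage_measure R n (fun x => r *: x) (fun x => r^-1 *: x)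
  (scalerDr _) (scalerK rn0) (scalerKV rn0) (measurable_row_scale _)
  (measurable_row_scale _) E (centered_box 2^-1) mE (measurable_centered_box _)
  (@centered_boxN _).
rewrite lebesgue_centered_box ?invr_ge0//.
rewrite mulfV ?expr1n ?pnatr_eq0// mule1 => <-; rewrite muleC; congr (_ * _)%E.
have -> : (fun x : 'rV[R]_n => r *: x) @^-1` centered_box 2^-1 =
    centered_box (2^-1 / r).
  apply/seteqP; split => x H i; have := H i; rewrite /preimage/= mxE => /andP[].
    by rewrite ler_pdivlMr// -mulNr ler_pdivrMr// !(mulrC r) => -> ->.
  by rewrite -mulNr ler_pdivlMr// ler_pdivrMr// !(mulrC r) => -> ->.
rewrite lebesgue_centered_box ?divr_ge0 ?invr_ge0 ?(ltW r0)//; congr EFin.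
by rewrite mulrA mulfV ?pnatr_eq0// mul1r exprVn.
Qed.

Lemma measurable_eball (r : R) : measurable (eball r : set 'rV[R]_n).
Proof.
rewrite (_ : eball r = @enorm R n @^-1` `]-oo, r]%classic).
  by apply: measurable_preim => //; exact: measurable_enorm.
by apply/seteqP; split => x /=; rewrite in_itv.
Qed.

Lemma eball_sub_box (r : R) : (eball r : set 'rV[R]_n) `<=` centered_box r.
Proof.
by move=> x xr i; rewrite -ler_norml (le_trans (coord_le_enorm _ _)).
Qed.

Lemma box_sub_eball (r : R) : 0 <= r ->
  centered_box r `<=` (eball (n%:R * r) : set 'rV[R]_n).
Proof.
move=> r0 x xr; rewrite /eball/= (le_trans (enorm_le_sum _))//.
rewrite (_ : n%:R * r = \sum_(i < n) r); last first.
  by rewrite sumr_const card_ord mulr_natl.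
by apply: ler_sum => i _; rewrite ler_norml; exact: xr.
Qed.

Definition unit_ball_volume : R := fine (lebesgue_row R n (eball 1)).

Lemma lebesgue_eball_fin (r : R) : 0 <= r ->
  lebesgue_row R n (eball r) \is a fin_num.
Proof.
move=> r0; rewrite ge0_fin_numE//.
apply: (@le_lt_trans _ _ (lebesgue_row R n (centered_box r))).
  apply: le_measure; rewrite ?inE; [exact: measurable_eball|
    exact: measurable_centered_box|exact: eball_sub_box].
by rewrite lebesgue_centered_box// ltry.
Qed.

Lemma lebesgue_eball (r : R) : 0 < r ->
  lebesgue_row R n (eball r) = (r ^+ n * unit_ball_volume)%:E.
Proof.
move=> r0; rewrite EFinM /unit_ball_volume fineK ?lebesgue_eball_fin//.
have := lebesgue_row_scale r0 (measurable_eball r).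
have -> : (fun x : 'rV[R]_n => r *: x) @^-1` eball r = eball 1.
  apply/seteqP; split => x; rewrite /preimage/eball/= enormZ gtr0_norm//.
    by rewrite -ler_pdivlMl// mulVf ?gt_eqF.
  by move=> x1; rewrite ler_piMr// ltW.
move=> ->; rewrite muleA -EFinM mulfV ?mul1e//.
by rewrite expf_neq0 ?gt_eqF.
Qed.

(** The ball contains the box of half-width 1 / (n + 1), a number that makes sense in dimension 0 as
    well. *)
Lemma unit_ball_volume_gt0 : 0 < unit_ball_volume.
Proof.
have e0 : 0 < n.+1%:R^-1 :> R by rewrite invr_gt0 ltr0n.
rewrite -lte_fin /unit_ball_volume fineK ?lebesgue_eball_fin//.
apply: (@lt_le_trans _ _ (lebesgue_row R n (centered_box n.+1%:R^-1))).
  by rewrite lebesgue_centered_box ?(ltW e0)// lte_fin exprn_gt0// mulr_gt0.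
apply: le_measure; rewrite ?inE; [exact: measurable_centered_box|
  exact: measurable_eball|].
apply: (subset_trans (box_sub_eball (ltW e0))) => x; rewrite /eball/=.
move/le_trans; apply; rewrite ler_pdivrMr ?ltr0n// mul1r ler_nat//.
Qed.

End scaling.

Section isometry.
Variable (R : realType) (n : nat) (f : 'rV[R]_n -> 'rV[R]_n).
Hypotheses (fD : {morph f : x y / x + y}) (ff : involutive f).
Hypotheses (mf : measurable_fun setT f) (fnorm : forall x, enorm (f x) = enorm x).

(** The unit ball is its own preimage, so the factor of proportionality is 1; it cancels because the
    volume of the ball is finite and positive. *)
Lemma isometry_preimage_measure (E : set 'rV[R]_n) : measurable E ->
  lebesgue_row R n (f @^-1` E) = lebesgue_row R n E.
Proof.
move=> mE.
have := @linear_preimage_measure R n f f fD ff ff mf mf E (eball 1) mE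
  (measurable_eball _).
have -> : f @^-1` eball 1 = eball 1.
  by apply/seteqP; split => x; rewrite /preimage/eball/= fnorm.
rewrite -(fineK (lebesgue_eball_fin n (@ler01 R))) => H.
have /eqP : ((unit_ball_volume R n)%:E * lebesgue_row R n E =
   (unit_ball_volume R n)%:E * lebesgue_row R n (f @^-1` E))%E.
  rewrite muleC [RHS]muleC; apply: H => x.
  by rewrite /eball/= enormN.
by rewrite eq_le !lee_pmul2l ?lte_fin ?unit_ball_volume_gt0// -eq_le => /eqP.
Qed.

End isometry.

(** * Polar coordinates and regular functions *)

Section polar.
Variable (R : realType) (n : nat).
Hypothesis n_gt0 : (0 < n)%N.

Let lam := lebesgue_row R n.
Let v := unit_ball_volume R n.

Lemma punctured_space : ~` [set x : 'rV[R]_n | 0 < enorm x] = [set 0].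
Proof.
apply/seteqP; split => x /=; last by move=> ->; rewrite enorm0 ltxx.
by move=> /negP; rewrite -leNgt => x0; apply: enorm_eq0; apply/eqP;
  rewrite eq_le x0 enorm_ge0.
Qed.

Lemma lebesgue_row0 : lam [set 0] = 0%E.
Proof.
rewrite (_ : [set 0] = [set x : 'rV[R]_n | forall i,
    (0 : 'rV_n) ord0 i <= x ord0 i <= (0 : 'rV_n) ord0 i]).
  rewrite /lam lebesgue_row_box// (bigD1 (Ordinal n_gt0))//= subrr mul0r//.
apply/seteqP; split => x /=; first by move=> -> i; rewrite lexx.
by move=> H; apply/rowP => i; apply/eqP; rewrite eq_le andbC; exact: H.
Qed.

Lemma lebesgue_row_punctured (E : set 'rV[R]_n) : measurable E ->
  lam (E `&` [set x | 0 < enorm x]) = lam E.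
Proof.
move=> mE.
have m0 : measurable [set x : 'rV[R]_n | 0 < enorm x].
  rewrite (_ : [set _ | _] = @enorm R n @^-1` `]0, +oo[%classic).
    by apply: measurable_preim => //; exact: measurable_enorm.
  by apply/seteqP; split => x /=; rewrite in_itv/= andbT.
apply/eqP; rewrite eq_le; apply/andP; split.
  by apply: le_measure; rewrite ?inE//; exact: measurableI.
rewrite -[in leLHS](setUIDK E [set x | 0 < enorm x]).
apply: (le_trans (measureU2 _ _ _)) => //; first exact: measurableI.
  exact: measurableD.
rewrite -[leRHS]adde0 leeD2l// -lebesgue_row0.
apply: le_measure; rewrite ?inE; first exact: measurableD.
  by rewrite -punctured_space; exact: measurableC.
by rewrite -punctured_space; exact: subDsetr.
Qed.

Let cone (B : set 'rV[R]_n) := @normalize R n @^-1` B `&` [set x | 0 < enorm x].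

Let mnorm := @measurable_normalize R n.
Let menorm : measurable_fun setT (@enorm R n : 'rV[R]_n -> measurableTypeR R) :=
  @measurable_enorm R n.

Let mpunct : measurable [set x : 'rV[R]_n | 0 < enorm x].
Proof.
rewrite (_ : [set _ | _] = @enorm R n @^-1` `]0, +oo[%classic).
  by apply: measurable_preim.
by apply/seteqP; split => x /=; rewrite in_itv/= andbT.
Qed.

Let mcone B : measurable B -> measurable (cone B).
Proof. by move=> mB; apply: measurableI => //; exact: measurable_preim. Qed.

(** Volume of the truncated cone over [B]; n times it is the surface measure of [B]. *)
Let u (B : set 'rV[R]_n) := fine (lam (cone B `&` eball 1)).

Let lam_cone_fin B : measurable B ->
  lam (cone B `&` eball 1) \is a fin_num.
Proof.
move=> mB; rewrite ge0_fin_numE//.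
apply: (@le_lt_trans _ _ (lam (eball 1))).
  apply: le_measure; rewrite ?inE; [|exact: measurable_eball|exact: subIsetr].
  by apply: measurableI; [exact: mcone|exact: measurable_eball].
by rewrite -ge0_fin_numE// lebesgue_eball_fin.
Qed.

(** A cone is invariant under dilations, so its part of radius at most r scales as r^n. The value 0
    for r <= 0 is right because the cone omits the origin. *)
Let lam_cone (r : R) B : measurable B ->
  lam (cone B `&` eball r) = ((if 0 < r then r ^+ n else 0) * u B)%:E.
Proof.
move=> mB; case: ltP => r0.
  rewrite /u EFinM fineK ?lam_cone_fin//.
  have := lebesgue_row_scale r0
    (measurableI _ _ (mcone mB) (measurable_eball r)).
  rewrite (_ : _ @^-1` _ = cone B `&` eball 1).
    rewrite -/lam => ->; rewrite muleA -EFinM mulfV ?mul1e//.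
    by rewrite expf_neq0 ?gt_eqF.
  apply/seteqP; rewrite /cone /normalize; split => x /=;
    rewrite /eball /preimage/= enormZ gtr0_norm// pmulr_rgt0//;
    rewrite invfM scalerA mulrAC mulVf ?gt_eqF// mul1r => -[[Bx x0]].
    by rewrite -ler_pdivlMl// mulVf ?gt_eqF// => x1.
  by move=> x1; split => //; rewrite ler_piMr// ltW.
rewrite mul0r (_ : _ `&` _ = set0) ?measure0// -subset0 => x [[_ /=]].
by rewrite /eball/= => /lt_le_trans/[apply]/lt_le_trans/(_ r0); rewrite ltxx.
Qed.

Let lam_shell (a b : R) B : measurable B -> a < b ->
  lam (@enorm R n @^-1` `]a, b]%classic `&` @normalize R n @^-1` B) =
  (((if 0 < b then b ^+ n else 0) - (if 0 < a then a ^+ n else 0)) * u B)%:E.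
Proof.
move=> mB ab; rewrite -lebesgue_row_punctured; last first.
  by apply: measurableI; apply: measurable_preim.
rewrite (_ : _ `&` _ = (cone B `&` eball b) `\` (cone B `&` eball a)); last first.
  apply/seteqP; split => x /=; rewrite /cone /eball /preimage/= in_itv/=.
    move=> [[/andP[ax xb] Bx] x0]; split => // -[_].
    by rewrite leNgt ax.
  move=> [[[Bx x0] xb] H]; split => //; split => //; rewrite xb andbT ltNge.
  by apply/negP => xa; apply: H.
have mI r : measurable (cone B `&` eball r).
  by apply: measurableI; [exact: mcone|exact: measurable_eball].
transitivity (lam (cone B `&` eball b) - lam (cone B `&` eball a))%E; last first.
  by rewrite !lam_cone// -EFinB mulrBl.
rewrite measureD//; last first.
  have: (lam (cone B `&` eball b) < +oo)%E by rewrite lam_cone// ltry.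
  exact.
congr (_ - lam _)%E.
rewrite setIACA setIid (_ : eball b `&` eball a = eball a)//.
by rewrite setIidr// => x /le_trans; apply; exact: ltW.
Qed.

Let u_ge0 B : 0 <= u B. Proof. exact: fine_ge0. Qed.

(** The distribution of the radius under Lebesgue measure. It stands for n v r^(n-1) dr, v being the
    volume of the unit ball, and spares all computation with that density. *)
Definition radial_measure : set (measurableTypeR R) -> \bar R :=
  pushforward lam (@enorm R n).

Let radial0 : radial_measure set0 = 0%E.
Proof. by rewrite /radial_measure /pushforward preimage_set0 measure0. Qed.

Let radial_ge0 A : (0 <= radial_measure A)%E. Proof. exact: measure_ge0. Qed.

Let radial_sigma_additive : semi_sigma_additive radial_measure.
Proof. exact: (@measure_semi_sigma_additive _ _ _ (pushm lam menorm)). Qed.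

HB.instance Definition _ := isMeasure.Build _ _ _ radial_measure
  radial0 radial_ge0 radial_sigma_additive.

Let radial_sigma_finite : sigma_finite setT radial_measure.
Proof.
exists (fun k => `]-oo, k%:R]%classic).
  apply/esym; rewrite -subTset => x _; exists (Num.bound x) => //=.
  rewrite in_itv/= (le_trans (ler_norm _))// ltW//.
  exact: unstable.ltr_norm_bound.
move=> k; split; first exact: measurable_itv.
rewrite /radial_measure /pushforward (_ : _ @^-1` _ = eball k%:R).
  by rewrite -ge0_fin_numE// lebesgue_eball_fin.
by apply/seteqP; split => x; rewrite /preimage/= in_itv.
Qed.

HB.instance Definition _ := Measure_isSigmaFinite.Build _ _ _ radial_measure
  radial_sigma_finite.

Lemma surface_measureE B : measurable B ->
  surface_measure B = (n%:R * u B)%:E.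
Proof.
move=> mB; rewrite /surface_measure EFinM /u fineK ?lam_cone_fin//.
congr (_ * lam _)%E; rewrite /cone -setIA; congr (_ `&` _).
by apply/seteqP; split => x /=; rewrite /punctured_ball /eball /= => /andP.
Qed.

Let surface_sigma_finite : sigma_finite setT (@surface_measure R n).
Proof.
exists (fun k => setT); first by rewrite bigcup_const//; exists 0%N.
by move=> k; split => //; rewrite surface_measureE// ltry.
Qed.

HB.instance Definition _ := Measure_isSigmaFinite.Build _ _ _
  (@surface_measure R n) surface_sigma_finite.

Let polar_map (x : 'rV[R]_n) : measurableTypeR R * 'rV[R]_n :=
  (enorm x, normalize x).

Let mpolar : measurable_fun setT polar_map.
Proof. by apply/measurable_fun_pairP. Qed.

(** For fixed [B] both sides are measures in [A], and they agree on half-open intervals by the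
    scaling of cones. *)
Lemma polar_rectangle (A : set (measurableTypeR R)) (B : set 'rV[R]_n) :
  measurable A -> measurable B ->
  (v%:E * lam (@enorm R n @^-1` A `&` @normalize R n @^-1` B) =
   (u B)%:E * radial_measure A)%E.
Proof.
move=> mA mB.
have mB' : measurable (@normalize R n @^-1` B) by exact: measurable_preim.
pose m1 : {measure set (measurableTypeR R) -> \bar R} := mscale (NngNum (ltW (unit_ball_volume_gt0 R n)))
  (pushm (mrestr lam mB') menorm).
pose m2 : {measure set (measurableTypeR R) -> \bar R} := mscale (NngNum (u_ge0 B)) radial_measure.
change (m1 A = m2 A).
have uT : u setT = v.
  rewrite /u /v /unit_ball_volume -(lebesgue_row_punctured (@measurable_eball R n 1)).
  by rewrite /cone preimage_setT setTI setIC.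
have m12 a b : a < b -> m1 `]a, b]%classic =
    (v * (((if 0 < b then b ^+ n else 0) - (if 0 < a then a ^+ n else 0)) * u B))%:E.
  by move=> ab; rewrite EFinM -lam_shell.
refine (@measure_unique _ R (measurableTypeR R) (@ocitv R)
  (fun k => `](- k%:R), k%:R]%classic) _ _ _ _ m1 m2 _ _ A mA) => //.
- exact: ocitvI.
- by move=> k; exact: is_ocitv.
- rewrite -subTset => x _; exists (Num.bound x) => //=.
  rewrite in_itv/= ltrNl; apply/andP; split.
    by rewrite (le_lt_trans (ler_norm _))// normrN unstable.ltr_norm_bound.
  by rewrite (le_trans (ler_norm _))// ltW// unstable.ltr_norm_bound.
- move=> C /ocitvP[->|[[a b]/= ab ->]]; first by rewrite !measure0.
  rewrite m12//; transitivity ((u B)%:E * radial_measure `]a, b]%classic)%E => //.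
  have /= := lam_shell measurableT ab; rewrite preimage_setT setIT uT.
  rewrite /radial_measure /pushforward => ->; rewrite -EFinM; congr EFin.
  have e (x y z : R) : x * (y * z) = z * (y * x) by ring.
  exact: e.
- move=> k; have [k0|k0] := ltP (- k%:R) (k%:R : R); first by rewrite m12// ltry.
  by rewrite set_itv_ge ?measure0// bnd_simp -leNgt.
Qed.

(** The factor n v is the total surface measure of the sphere: it appears because [radial_measure]
    already contains the integral over directions. *)
Lemma polar_coordinates (g : measurableTypeR R * 'rV[R]_n -> \bar R) :
  measurable_fun setT g -> (forall p, 0 <= g p)%E ->
  ((n%:R * v)%:E * \int[lam]_x g (enorm x, normalize x) =
   \int[radial_measure]_r \int[@surface_measure R n]_w g (r, w))%E.
Proof.
move=> mg g0.
have nv0 : 0 <= n%:R * v by rewrite mulr_ge0// ltW// unit_ball_volume_gt0.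
pose m' : {measure set (measurableTypeR R * 'rV[R]_n) -> \bar R} := mscale (NngNum nv0) (pushm lam mpolar).
transitivity (\int[m']_p g p)%E.
  rewrite ge0_integral_mscale//; congr (_ * _)%E.
  by rewrite ge0_integral_pushforward.
transitivity (\int[(radial_measure \x @surface_measure R n)%E]_p g p)%E.
  apply/esym; apply: (@eq_measure_integral _ _ _ setT m' _ g) => A mA _.
  apply: (@product_measure_unique _ _ _ _ _ _ _ m') => // B C mB mC.
  transitivity ((n%:R * v)%:E *
    lam (@enorm R n @^-1` B `&` @normalize R n @^-1` C))%E => //.
  rewrite EFinM -muleA polar_rectangle//.
  transitivity (radial_measure B * surface_measure C)%E => //.
  by rewrite surface_measureE// muleA -EFinM muleC.
exact: fubini_tonelli1.
Qed.

End polar.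

(** * Layer cake formula and comparison of radial integrals *)

Section layer_cake.
Local Open Scope ereal_scope.
Context d (T : measurableType d) (R : realType).
Variable mu : {sigma_finite_measure set T -> \bar R}.
Variables (w M : T -> R).
Hypotheses (mw : measurable_fun setT w) (mM : measurable_fun setT M).
Hypotheses (w0 : forall x, (0 <= w x)%R) (M0 : forall x, (0 <= M x)%R).

Let G := [set p : T * measurableTypeR R | (0 <= p.2)%R /\ (p.2 < M p.1)%R].

Let mG : measurable G.
Proof.
rewrite (_ : G = snd @^-1` (`[0%R, +oo[%classic : set (measurableTypeR R)) `&`
    (fun p : T * measurableTypeR R => (p.2 < M p.1)%R) @^-1` [set true]).
  apply: measurableI.
    by apply: measurable_preim => //; exact: (@measurable_snd _ _ T (measurableTypeR R)).
  apply: measurable_preim => //; apply: measurable_fun_ltr.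
    exact: (@measurable_snd _ _ T (measurableTypeR R)).
  by apply: measurableT_comp => //; exact: (@measurable_fst _ _ T (measurableTypeR R)).
by apply/seteqP; split => x /=; rewrite in_itv/= andbT.
Qed.

(** Tonelli on the region under the graph of [M], weighted by [w]. *)
Lemma layer_cake :
  \int[mu]_x (w x * M x)%:E =
  \int[@lebesgue_measure R]_(y in `[0%R, +oo[)
    \int[mu]_(x in [set x | (y < M x)%R]) (w x)%:E.
Proof.
pose h (p : T * measurableTypeR R) := (w p.1 * \1_G p)%:E.
have mh : measurable_fun setT h.
  apply/measurable_EFinP; apply: measurable_funM.
    by apply: measurableT_comp => //; exact: measurable_fst.
  exact: measurable_indic.
have h0 p : 0 <= h p by rewrite lee_fin mulr_ge0.
have := @fubini_tonelli _ _ _ _ R mu (@lebesgue_measure R) h mh h0.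
transitivity (\int[mu]_x \int[@lebesgue_measure R]_y h (x, y)).
  apply: eq_integral => x _; rewrite /h/=.
  transitivity (\int[@lebesgue_measure R]_y ((w x)%:E * (\1_(`[0%R, M x[%classic) y)%:E)).
    rewrite ge0_integralZl//=.
    - rewrite integral_indic// setIT EFinM; congr (_ * _).
      have := lebesgue_measure_itv `[0%R, M x[.
      rewrite /= lte_fin; case: ltP => [_ /esym|]; first by rewrite sube0.
      have := M0 x => H1 H2 /esym; rewrite (_ : M x = 0%R)//; apply/eqP.
      by rewrite eq_le H1 H2.
    - by apply/measurable_EFinP; exact: measurable_indic.
    - by rewrite lee_fin.
  apply: eq_integral => y _; rewrite -EFinM; congr (_ * _)%R%:E.
  rewrite !indicE; congr (_%:R); congr nat_of_bool; apply/idP/idP.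
    by rewrite inE/= in_itv/= => /andP[? ?]; rewrite inE.
  by rewrite inE => -[/= ? ?]; rewrite inE/= in_itv/=; apply/andP.
rewrite H [RHS]integral_mkcond; apply: eq_integral => y _; rewrite patchE.
case: ifPn; rewrite ?notin_setE ?inE/= in_itv/= andbT => y0.
  rewrite [RHS]integral_mkcond; apply: eq_integral => x _; rewrite patchE/= /h/=.
  rewrite indicE; case: ifPn; rewrite ?notin_setE ?inE/= => xy.
    by rewrite mem_set ?mulr1.
  by rewrite memNset ?mulr0// => -[].
rewrite integral0_eq// => x _; rewrite /h indicE memNset ?mulr0// => -[] /=.
by move=> yy _; exact: y0.
Qed.

End layer_cake.

(** Superlevel sets at heights y >= 0 are intervals by monotonicity; at negative heights they are
    the whole line. *)
Lemma measurable_nonincreasing (R : realType) (eps : R) (m : R -> R) :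
  (forall r, 0 <= m r) ->
  (forall r s, 0 < r -> r <= s -> s <= eps -> m s <= m r) ->
  measurable_fun setT (fun r : R => if 0 < r <= eps then m r else 0).
Proof.
move=> m0 mdec.
apply: (measurability _ (RGenOInfty.measurableE R)) => // _ [_ [y ->] <-].
rewrite setTI; have [y0|y0] := leP 0 y; last first.
  rewrite (_ : _ @^-1` _ = setT)// -subTset => r _.
  by rewrite /= in_itv/= andbT; case: ifP => // _; rewrite (lt_le_trans y0).
apply: is_interval_measurable => r s /=; rewrite !in_itv/= !andbT => yr ys z.
move=> /andP[rz zs]; rewrite in_itv/= andbT.
move: yr ys; case: ifPn => [/andP[r0 reps] yr|_]; last by rewrite ltNge y0.
case: ifPn => [/andP[s0 seps] ys|_]; last by rewrite ltNge y0.
rewrite (lt_le_trans r0 rz) (le_trans zs seps)/= (lt_le_trans ys)//.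
by apply: mdec => //; exact: lt_le_trans rz.
Qed.

Section radial_comparison.
Variable (R : realType) (n : nat).
Let lam := lebesgue_row R n.

Definition pball (t : R) : set 'rV[R]_n := [set x | 0 < enorm x <= t].

Lemma measurable_pball t : measurable (pball t).
Proof.
rewrite (_ : pball t = @enorm R n @^-1` `]0, t]%classic).
  by apply: measurable_preim => //; exact: measurable_enorm.
by apply/seteqP; split => x /=; rewrite in_itv.
Qed.

Lemma pball_sub (s t : R) : s <= t -> pball s `<=` pball t.
Proof. by move=> st x /andP[x0 xs]; apply/andP; rewrite (le_trans xs). Qed.

(* Halving the radius on the right absorbs the difference between the open and
   the closed balls that occur as superlevel sets of m. *)
Lemma nonincreasing_radial_le (eps C : R) (m : R -> R) (w1 w2 : 'rV[R]_n -> R) :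
  (forall r, 0 <= m r) ->
  (forall r s, 0 < r -> r <= s -> s <= eps -> m s <= m r) ->
  measurable_fun setT w1 -> measurable_fun setT w2 ->
  (forall x, 0 <= w1 x) -> (forall x, 0 <= w2 x) -> 0 <= C ->
  (forall t, 0 < t -> t <= eps ->
    (\int[lam]_(x in pball t) (w1 x)%:E <=
     C%:E * \int[lam]_(x in pball (t / 2)) (w2 x)%:E)%E) ->
  (\int[lam]_(x in pball eps) (w1 x * m (enorm x))%:E <=
   C%:E * \int[lam]_(x in pball eps) (w2 x * m (enorm x))%:E)%E.
Proof.
move=> m0 mdec mw1 mw2 w10 w20 C0 H.
pose mm r := if 0 < r <= eps then m r else 0.
have mmm : measurable_fun setT (mm : R -> R) by exact: measurable_nonincreasing.
have mM : measurable_fun setT (mm \o @enorm R n).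
  by apply: measurableT_comp => //; exact: measurable_enorm.
have M0 x : 0 <= (mm \o @enorm R n) x by rewrite /= /mm; case: ifP.
have E w : (\int[lam]_(x in pball eps) (w x * m (enorm x))%:E =
    \int[lam]_x (w x * (mm \o @enorm R n) x)%:E)%E.
  rewrite integral_mkcond; apply: eq_integral => x _; rewrite patchE /= /mm.
  case: ifPn; rewrite ?notin_setE ?inE/= => xe; first by rewrite ifT.
  by rewrite ifF ?mulr0//; apply/negbTE/negP.
rewrite !E.
rewrite (layer_cake lam mw1 mM)// (layer_cake lam mw2 mM)//.
have mU y : measurable [set x : 'rV[R]_n | y < (mm \o @enorm R n) x].
  rewrite (_ : [set _ | _] = (mm \o @enorm R n) @^-1` `]y, +oo[%classic).
    by apply: measurable_preim.
  by apply/seteqP; split => x /=; rewrite in_itv/= andbT.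
have mI (w : 'rV[R]_n -> R) : measurable_fun setT w -> (forall x, 0 <= w x) ->
    measurable_fun setT (fun y : R =>
      (\int[lam]_(x in [set x | (y < (mm \o @enorm R n) x)%R]) (w x)%:E)%E).
  move=> mw w0.
  pose G := [set p : 'rV[R]_n * measurableTypeR R | p.2 < (mm \o @enorm R n) p.1].
  have mG : measurable G.
    rewrite (_ : G =
      (fun p : 'rV[R]_n * measurableTypeR R => (p.2 < (mm \o @enorm R n) p.1)%R)
      @^-1` [set true])//.
    apply: measurable_preim => //; apply: measurable_fun_ltr.
      exact: (@measurable_snd _ _ 'rV[R]_n (measurableTypeR R)).
    apply: (measurableT_comp mM).
    exact: (@measurable_fst _ _ 'rV[R]_n (measurableTypeR R)).
  pose h (p : 'rV[R]_n * measurableTypeR R) := (w p.1 * \1_G p)%:E.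
  have mh : measurable_fun setT h.
    apply/measurable_EFinP; apply: measurable_funM.
      apply: (measurableT_comp mw).
      exact: (@measurable_fst _ _ 'rV[R]_n (measurableTypeR R)).
    exact: measurable_indic.
  have h0 p : (0 <= h p)%E by rewrite lee_fin mulr_ge0.
  have := measurable_fun_fubini_tonelli_G (m1 := lam) h mh h0.
  congr (measurable_fun _ _); apply/funext => y; rewrite /fubini_G.
  rewrite [RHS]integral_mkcond; apply: eq_integral => x _; rewrite patchE/= /h/=.
  rewrite indicE; case: ifPn; rewrite ?notin_setE ?inE/= => xy.
    by rewrite mem_set ?mulr1.
  by rewrite memNset ?mulr0.
have I0 w y : (forall x, 0 <= w x) ->
    (0 <= \int[lam]_(x in [set x | (y < (mm \o @enorm R n) x)%R]) (w x)%:E)%E.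
  by move=> w0; apply: integral_ge0 => x _; rewrite lee_fin.
rewrite -ge0_integralZl//; last 2 first.
  exact: measurable_funTS (mI _ mw2 w20).
  by move=> y _; exact: I0.
apply: ge0_le_integral => //.
- by move=> y _; exact: I0.
- exact: measurable_funTS (mI _ mw1 w10).
- apply: measurable_funTS; apply: measurable_funeM; exact: mI.
move=> y; rewrite /= in_itv/= andbT => y0.
(* At a fixed height y, [T] is an initial interval of ]0, eps]; the hypothesis on the weights is
   applied at the radius [sup T]. *)
pose T := [set r | 0 < r <= eps /\ y < m r].
have UE : [set x : 'rV[R]_n | y < (mm \o @enorm R n) x] = @enorm R n @^-1` T.
  apply/seteqP; split => x /=; rewrite /mm /T/=.
    by case: ifPn => [? ? //|_]; rewrite ltNge y0.
  by move=> [-> ].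
rewrite UE.
have [T0|/set0P[r0 Tr0]] := eqVneq T set0.
  by rewrite T0 preimage_set0 !integral_set0 mule0.
have supT : has_sup T by split; [exists r0|exists eps => r [/andP[]]].
have sT r : T r -> r <= sup T by move=> Tr; exact: sup_upper_bound.
have t0 : 0 < sup T by apply: lt_le_trans (sT _ Tr0); case: Tr0 => /andP[].
have teps : sup T <= eps.
  by apply: ge_sup; [exists r0|move=> r [/andP[]]].
have mT : measurable (@enorm R n @^-1` T) by rewrite -UE; exact: mU.
apply: (@le_trans _ _ (\int[lam]_(x in pball (sup T)) (w1 x)%:E)%E).
  apply: ge0_subset_integral => //; first exact: measurable_pball.
  - by apply/measurable_EFinP; exact: measurable_funTS.
  - by move=> x _; rewrite lee_fin.
  - by move=> x Tx; apply/andP; split; [case: Tx => /andP[]|exact: sT].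
apply: (le_trans (H _ t0 teps)); apply: lee_wpmul2l; first by rewrite lee_fin.
apply: ge0_subset_integral => //; first exact: measurable_pball.
- by apply/measurable_EFinP; exact: measurable_funTS.
- by move=> x _; rewrite lee_fin.
move=> x /andP[x0 xt].
have [r [/andP[r1 reps] yr] xr] : exists2 r, T r & enorm x < r.
  have : 0 < sup T / 2 by rewrite divr_gt0.
  move=> h; have [r Tr tr] := sup_adherent h supT; exists r => //.
  by apply: le_lt_trans tr; rewrite (le_trans xt)//; lra.
split; first by rewrite x0 (le_trans (ltW xr)).
by apply: (lt_le_trans yr); apply: mdec => //; exact: ltW.
Qed.

End radial_comparison.

(** * Spherical averages and regular functions *)

Section spherical_average.
Variable (R : realType) (n : nat).
Hypothesis n_gt0 : (0 < n)%N.

Let lam := lebesgue_row R n.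
Let v := unit_ball_volume R n.
Let sigma := @surface_measure R n.

Variables (f : 'rV[R]_n -> R).
Hypotheses (mf : measurable_fun setT f) (f0 : forall x, 0 <= f x).

Lemma measurable_usphere : measurable (usphere : set 'rV[R]_n).
Proof.
rewrite (_ : usphere = @enorm R n @^-1` [set 1]).
  by apply: measurable_preim => //; exact: measurable_enorm.
by apply/seteqP; split => x.
Qed.

Let fu (p : measurableTypeR R * 'rV[R]_n) := f (p.1 *: p.2) * \1_(usphere) p.2.

Let mfu : measurable_fun setT fu.
Proof.
apply: measurable_funM.
  apply: (measurableT_comp mf); apply/measurable_fun_rowP => i.
  rewrite (_ : (fun t : measurableTypeR R * 'rV[R]_n => (t.1 *: t.2) ord0 i) =
      (fun t => t.1 * t.2 ord0 i)); last by apply/funext => t; rewrite mxE.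
  apply: measurable_funM.
    exact: (@measurable_fst _ _ (measurableTypeR R) 'rV[R]_n).
  apply: (measurableT_comp (measurable_coord i)).
  exact: (@measurable_snd _ _ (measurableTypeR R) 'rV[R]_n).
apply: measurableT_comp; last first.
  exact: (@measurable_snd _ _ (measurableTypeR R) 'rV[R]_n).
by apply: measurable_indic; exact: measurable_usphere.
Qed.

Let fu0 p : 0 <= fu p. Proof. by rewrite mulr_ge0. Qed.

Let spherical_sumE r :
  (\int[sigma]_(w in usphere) (f (r *: w))%:E = \int[sigma]_w (fu (r, w))%:E)%E.
Proof.
rewrite integral_mkcond; apply: eq_integral => w _; rewrite patchE /fu/= indicE.
by case: ifPn => _; rewrite ?mulr1 ?mulr0.
Qed.

(** Polar coordinates are used twice: to pull the radial factor out of the integral over the sphere,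
    and to return from the radius to the ball with what is then a radial integrand. *)
Lemma spherical_average (phi : R -> R) (eps : R) :
  measurable_fun setT phi -> (forall r, 0 <= phi r) ->
  ((n%:R * v)%:E * \int[lam]_(x in pball eps) (f x * phi (enorm x))%:E =
   \int[lam]_(x in pball eps)
     ((phi (enorm x))%:E *
      \int[sigma]_(w in usphere) (f (enorm x *: w))%:E))%E.
Proof.
move=> mphi phi0.
pose psi r := phi r * \1_(`]0, eps]) r.
have mpsi : measurable_fun setT psi.
  by apply: measurable_funM => //; exact: measurable_indic.
have psi0 r : 0 <= psi r by rewrite mulr_ge0.
pose g (p : measurableTypeR R * 'rV[R]_n) := (psi p.1 * fu p)%:E.
have mg : measurable_fun setT g.
  apply/measurable_EFinP; apply: measurable_funM => //.
  apply: (measurableT_comp mpsi).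
  exact: (@measurable_fst _ _ (measurableTypeR R) 'rV[R]_n).
have g0 p : (0 <= g p)%E by rewrite lee_fin mulr_ge0.
have mF : measurable_fun setT (fun r : measurableTypeR R =>
    (\int[sigma]_w (fu (r, w))%:E)%E).
  have := @measurable_fun_fubini_tonelli_F _ _ (measurableTypeR R) 'rV[R]_n R
    sigma (EFin \o fu).
  by apply => [|p]; [exact/measurable_EFinP|rewrite lee_fin].
have F0 r : (0 <= \int[sigma]_w (fu (r, w))%:E)%E.
  by apply: integral_ge0 => w _; rewrite lee_fin.
have := polar_coordinates n_gt0 mg g0.
rewrite (_ : (\int[lebesgue_row R n]_x g (enorm x, normalize x))%E =
   (\int[lam]_(x in pball eps) (f x * phi (enorm x))%:E)%E); last first.
  rewrite [RHS]integral_mkcond; apply: eq_integral => x _; rewrite patchE /g /psi/=.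
  rewrite indicE mem_setE in_itv/=.
  case: ifPn; rewrite ?notin_setE ?inE/= => xe; last first.
    by rewrite (negbTE (introN idP xe)) !mulr0 mul0r.
  have /andP[x0 _] := xe; rewrite xe mulr1 /fu/= /normalize.
  rewrite scalerA mulfV ?gt_eqF// scale1r indicE mem_set ?mulr1 1?mulrC//.
  by rewrite /usphere/= enormZ gtr0_norm ?invr_gt0// mulVf ?gt_eqF.
move=> ->.
transitivity (\int[radial_measure n]_r
    ((psi r)%:E * \int[sigma]_w (fu (r, w))%:E))%E.
  apply: eq_integral => r _; rewrite -ge0_integralZl//.
  - apply/measurable_EFinP; apply: (measurableT_comp mfu).
    by apply/measurable_fun_pairP; split; [exact: measurable_cst|exact: measurable_id].
  - by move=> w _; rewrite lee_fin.
  - by rewrite lee_fin.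
transitivity (\int[lam]_x
    ((psi (enorm x))%:E * \int[sigma]_w (fu (enorm x, w))%:E))%E.
  pose h r := ((psi r)%:E * \int[sigma]_w (fu (r, w))%:E)%E.
  have mh : measurable_fun setT (h : measurableTypeR R -> \bar R).
    by apply: emeasurable_funM => //; exact/measurable_EFinP.
  rewrite -[LHS]/(\int[radial_measure n]_r h r)%E.
  rewrite ge0_integral_pushforward//.
    exact: measurable_enorm.
  by move=> r _; rewrite mule_ge0// lee_fin.
rewrite [RHS]integral_mkcond; apply: eq_integral => x _; rewrite patchE /psi/=.
rewrite indicE mem_setE in_itv/= spherical_sumE.
case: ifPn; rewrite ?notin_setE ?inE/= => xe; first by rewrite xe mulr1.
by rewrite (negbTE (introN idP xe)) mulr0 mul0e.
Qed.

Lemma spherical_average_measurable :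
  measurable_fun setT (fun r : R =>
    (\int[sigma]_(w in usphere) (f (r *: w))%:E)%E).
Proof.
rewrite (_ : (fun r => _) = (fun r : measurableTypeR R =>
    (\int[sigma]_w (fu (r, w))%:E)%E)); last by apply/funext => r; rewrite spherical_sumE.
have := @measurable_fun_fubini_tonelli_F _ _ (measurableTypeR R) 'rV[R]_n R
  sigma (EFin \o fu).
by apply => [|p]; [exact/measurable_EFinP|rewrite lee_fin].
Qed.

End spherical_average.

Section regular_functions.
Variable (R : realType) (n : nat).
Hypothesis n_gt0 : (0 < n)%N.

Let lam := lebesgue_row R n.
Let v := unit_ball_volume R n.
Let sigma := @surface_measure R n.

Variables (S : 'rV[R]_n -> R).
Hypotheses (mS : measurable_fun setT S) (S0 : forall x, 0 <= S x).
Hypothesis S_reg : regular_at_origin S.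

Let s (r : R) := (\int[sigma]_(w in usphere) (S (r *: w))%:E)%E.

(** Integrate the two-sided bound by the envelope over spheres. Here m(r) is r^-2 times the
    spherical integral of the envelope, nonnegative because S is, and set to 0 off ]0, eps]. *)
Let regular_spherical_average : exists (m : R -> R) (c1 c2 eps : R),
  [/\ [/\ 0 < c1, 0 < c2 & 0 < eps], forall r, 0 <= m r,
    forall r, 0 < r <= eps ->
      ((c1 * (r ^+ 2 * m r))%:E <= s r <= (c2 * (r ^+ 2 * m r))%:E)%E &
    (forall r t, 0 < r -> r <= t -> t <= eps -> m r <= m t) \/
    (forall r t, 0 < r -> r <= t -> t <= eps -> m t <= m r)].
Proof.
have [A [c1 [c2 [eps [[c10 c20 eps0 epi] SA iA mono]]]]] := S_reg.
pose avg r := r ^- 2 * \int[@surface_measure R n]_(w in usphere) A (r *: w).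
pose m r := if 0 < r <= eps then avg r else 0.
have SA' r w : 0 < r <= eps -> usphere w ->
    c1 * A (r *: w) <= S (r *: w) <= c2 * A (r *: w).
  move=> /andP[r0 reps] w1; have rw : enorm (r *: w) <= eps.
    by rewrite enormZ w1 mulr1 gtr0_norm.
  apply: SA => // i; rewrite -ler_norml (le_trans (coord_le_enorm _ _))//.
  by rewrite (le_trans rw).
have A0 r w : 0 < r <= eps -> usphere w -> 0 <= A (r *: w).
  move=> re /(SA' _ _ re)/andP[_]; have := S0 (r *: w).
  by move=> /le_trans/[apply]; rewrite pmulr_rge0.
exists m, c1, c2, eps; split => //.
- move=> r; rewrite /m; case: ifPn => // re; rewrite mulr_ge0 ?invr_ge0 ?sqr_ge0//.
  by apply: Rintegral_ge0 => w; exact: A0.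
- move=> r re; rewrite /m re /avg; have /andP[r0 reps] := re.
  rewrite mulVKf ?expf_neq0 ?gt_eqF//.
  have iAr := iA r re.
  have mSr : measurable_fun usphere (fun w : 'rV[R]_n => (S (r *: w))%:E).
    apply/measurable_EFinP; apply: measurable_funTS.
    by apply: (measurableT_comp mS); exact: measurable_row_scale.
  have mus := @measurable_usphere R n.
  have iS : (@surface_measure R n).-integrable usphere (fun w => (S (r *: w))%:E).
    apply: (le_integrable mus mSr _ (integrableZl mus c2 iAr)) => w w1 /=.
    rewrite lee_fin !ger0_norm//; last by rewrite mulr_ge0 ?(ltW c20)// A0.
    by case/andP: (SA' _ _ re w1).
  have iAE : (\int[sigma]_(w in usphere) (A (r *: w))%:E =
      (\int[sigma]_(w in usphere) A (r *: w))%:E)%E.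
    by rewrite /Rintegral fineK//; exact: integrable_fin_num.
  by rewrite !EFinM -iAE -!integralZl//; apply/andP; split;
    apply: le_integral => //; try exact: integrableZl;
    move=> w; rewrite inE => /(SA' _ _ re)/andP[? ?]; rewrite -EFinM lee_fin.
case: mono => H; [left|right] => r t r0 rt te; rewrite /m r0 (le_trans rt te)/=;
  by rewrite (lt_le_trans r0 rt) te/=; exact: H.
Qed.

Let mnormf (phi : R -> R) : measurable_fun setT phi ->
  measurable_fun setT (fun x : 'rV[R]_n => phi (enorm x)).
Proof. by move=> mphi; apply: (measurableT_comp mphi); exact: measurable_enorm. Qed.

(** One statement serves both kinds of monotonicity: the comparison with factor [C1] is used when m
    is nonincreasing, the bound [B] when m is nondecreasing and so at most m(eps). The constant [C]
    depends on S alone, so the lemma can be applied to profiles that vary with L. *)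
Lemma regular_radial_compare : exists eps C : R, [/\ 0 < eps, 0 < C &
  forall (e C1 B : R) (phi1 phi2 : R -> R), 0 < e -> e <= eps ->
    measurable_fun setT phi1 -> measurable_fun setT phi2 ->
    (forall r, 0 <= phi1 r) -> (forall r, 0 <= phi2 r) -> 0 <= C1 -> 0 <= B ->
    (forall t, 0 < t -> t <= e ->
      (\int[lam]_(x in pball t) (enorm x ^+ 2 * phi1 (enorm x))%:E <=
      C1%:E * \int[lam]_(x in pball (t / 2)) (enorm x ^+ 2 * phi2 (enorm x))%:E)%E) ->
    (\int[lam]_(x in pball e) (enorm x ^+ 2 * phi1 (enorm x))%:E <= B%:E)%E ->
    (\int[lam]_(x in pball e) (S x * phi1 (enorm x))%:E <=
     C%:E * (C1%:E * \int[lam]_(x in pball e) (S x * phi2 (enorm x))%:E + B%:E))%E].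
Proof.
have [m [c1 [c2 [eps [[c10 c20 eps0] m0 sm mono]]]]] := regular_spherical_average.
have nv0 : 0 < n%:R * v by rewrite mulr_gt0 ?ltr0n ?unit_ball_volume_gt0.
have C0 : 0 < c2 / c1 + c2 * m eps / (n%:R * v).
  apply: ltr_pwDl; first exact: divr_gt0.
  by apply: divr_ge0; [apply: mulr_ge0 => //|]; exact: ltW.
(* The first summand serves the nonincreasing case, where the average of S is squeezed between c1
   r^2 m and c2 r^2 m; the second serves the nondecreasing case. *)
exists eps, (c2 / c1 + c2 * m eps / (n%:R * v)); split => //.
move=> e C1 B phi1 phi2 e0 eeps mphi1 mphi2 phi10 phi20 C10 B0 H HB.
have mpb : measurable (pball e : set 'rV[R]_n) by exact: measurable_pball.
have me2 : measurable_fun setT (fun x : 'rV[R]_n => enorm x ^+ 2).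
  by apply: measurable_funX; exact: measurable_enorm.
have ms : measurable_fun setT s by exact: spherical_average_measurable.
have mphis (phi : R -> R) : measurable_fun setT phi -> measurable_fun (pball e)
    (fun x : 'rV[R]_n => ((phi (enorm x))%:E * s (enorm x))%E).
  move=> mphi; apply: measurable_funTS; apply: emeasurable_funM.
    by apply/measurable_EFinP; exact: mnormf.
  by apply: (measurableT_comp ms); exact: measurable_enorm.
have s0 r : (0 <= s r)%E by apply: integral_ge0 => w _; rewrite lee_fin.
have phis0 (phi : R -> R) : (forall r, 0 <= phi r) ->
    forall x : 'rV[R]_n, (0 <= (phi (enorm x))%:E * s (enorm x))%E.
  by move=> phi0 x; rewrite mule_ge0// lee_fin.
have I0 : (0 <= \int[lam]_(x in pball e) (S x * phi2 (enorm x))%:E)%E.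
  by apply: integral_ge0 => x _; rewrite lee_fin mulr_ge0.
have pe r : 0 < r <= e -> 0 < r <= eps.
  by move=> /andP[-> /le_trans]/=; apply.
have avgE (phi : R -> R) : measurable_fun setT phi -> (forall r, 0 <= phi r) ->
    ((n%:R * v)%:E * \int[lam]_(x in pball e) (S x * phi (enorm x))%:E =
    \int[lam]_(x in pball e) ((phi (enorm x))%:E * s (enorm x)))%E.
  by move=> mphi phi0; exact: spherical_average.
rewrite -(@lee_pmul2l _ (n%:R * v)%:E)// ?lte_fin// avgE//.
case: mono => mono.
- apply: (@le_trans _ _ (\int[lam]_(x in pball e)
    ((c2 * m eps)%:E * (enorm x ^+ 2 * phi1 (enorm x))%:E))%E).
    apply: ge0_le_integral => //.
    + by move=> x _; exact: phis0.
    + exact: mphis.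
    + apply: measurable_funTS; apply/measurable_EFinP.
      by apply: measurable_funM => //; apply: measurable_funM => //; exact: mnormf.
    + move=> x xe; have /andP[_ /le_trans] := sm _ (pe _ xe).
      move=> /(_ ((c2 * (enorm x ^+ 2 * m eps))%:E)%E) h.
      apply: (@le_trans _ _ ((phi1 (enorm x))%:E * (c2 * (enorm x ^+ 2 * m eps))%:E)%E).
        apply: lee_wpmul2l; first by rewrite lee_fin.
        apply: h; rewrite lee_fin ler_wpM2l ?(ltW c20)// ler_wpM2l ?sqr_ge0//.
        by case/andP: xe => x0 xe; apply: mono => //; exact: le_trans eeps.
      by rewrite -!EFinM lee_fin le_eqVlt; apply/orP; left; apply/eqP; ring.
  rewrite ge0_integralZl//; first 1 last.
  + apply: measurable_funTS; apply/measurable_EFinP.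
    by apply: measurable_funM => //; exact: mnormf.
  + by move=> x _; rewrite lee_fin mulr_ge0// sqr_ge0.
  + by rewrite lee_fin mulr_ge0 ?(ltW c20).
  apply: (@le_trans _ _ ((c2 * m eps)%:E * B%:E)%E).
    by apply: lee_wpmul2l; rewrite ?lee_fin ?mulr_ge0 ?(ltW c20).
  rewrite [leRHS]muleA -[in leRHS]EFinM.
  apply: (@le_trans _ _ ((n%:R * v * (c2 / c1 + c2 * m eps / (n%:R * v)))%:E * B%:E)%E).
    apply: lee_wpmul2r; first by rewrite lee_fin.
    rewrite lee_fin mulrDr [_ * (c2 * m eps / _)]mulrC divfK ?gt_eqF// lerDr.
    by rewrite mulr_ge0 ?(ltW nv0)// divr_ge0 ?(ltW c20) ?(ltW c10).
  apply: lee_wpmul2l; first by rewrite lee_fin mulr_ge0 ?(ltW nv0) ?(ltW C0).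
  by rewrite leeDr// mule_ge0 ?lee_fin.
- pose mm r := if 0 < r <= e then m r else 0.
  have mdec r t : 0 < r -> r <= t -> t <= e -> m t <= m r.
    by move=> r0 rt te; apply: mono => //; exact: le_trans eeps.
  have mmm : measurable_fun setT (mm : R -> R).
    exact: measurable_nonincreasing m0 mdec.
  have mw (phi : R -> R) : measurable_fun setT phi -> measurable_fun setT
      (fun x : 'rV[R]_n => enorm x ^+ 2 * phi (enorm x)).
    by move=> mphi; apply: measurable_funM => //; exact: mnormf.
  have mwm (phi : R -> R) : measurable_fun setT phi -> measurable_fun (pball e)
      (fun x : 'rV[R]_n => (enorm x ^+ 2 * phi (enorm x) * m (enorm x))%:E).
    move=> mphi; apply: (eq_measurable_fun
      (fun x : 'rV[R]_n => (enorm x ^+ 2 * phi (enorm x) * mm (enorm x))%:E)).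
      by move=> x; rewrite inE => xe; rewrite /mm xe.
    apply: measurable_funTS; apply/measurable_EFinP.
    by apply: measurable_funM; [exact: mw|exact: mnormf].
  have w0 (phi : R -> R) : (forall r, 0 <= phi r) ->
      forall x : 'rV[R]_n, 0 <= enorm x ^+ 2 * phi (enorm x).
    by move=> phi0 x; rewrite mulr_ge0// sqr_ge0.
  have wm0 (phi : R -> R) : (forall r, 0 <= phi r) -> forall x : 'rV[R]_n,
      (0 <= (enorm x ^+ 2 * phi (enorm x) * m (enorm x))%:E)%E.
    by move=> phi0 x; rewrite lee_fin mulr_ge0// w0.
  apply: (@le_trans _ _ (\int[lam]_(x in pball e)
      (c2%:E * (enorm x ^+ 2 * phi1 (enorm x) * m (enorm x))%:E))%E).
    apply: ge0_le_integral => //.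
    + by move=> x _; exact: phis0.
    + exact: mphis.
    + by apply: measurable_funeM; exact: mwm.
    + move=> x xe; have /andP[_ h] := sm _ (pe _ xe).
      apply: (le_trans (lee_wpmul2l _ h)); first by rewrite lee_fin.
      by rewrite -!EFinM lee_fin le_eqVlt; apply/orP; left; apply/eqP; ring.
  rewrite ge0_integralZl//; first 1 last.
  + exact: mwm.
  + by move=> x _; exact: wm0.
  + by rewrite lee_fin ltW.
  have cmp := nonincreasing_radial_le m0 mdec (mw _ mphi1) (mw _ mphi2) (w0 _ phi10)
    (w0 _ phi20) C10 H.
  apply: (le_trans (lee_wpmul2l _ cmp)); first by rewrite lee_fin ltW.
  have le2 : (c1%:E * \int[lam]_(x in pball e)
      (enorm x ^+ 2 * phi2 (enorm x) * m (enorm x))%:E <=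
      (n%:R * v)%:E * \int[lam]_(x in pball e) (S x * phi2 (enorm x))%:E)%E.
    rewrite avgE// -ge0_integralZl//; first 1 last.
    + exact: mwm.
    + by move=> x _; exact: wm0.
    + by rewrite lee_fin ltW.
    apply: ge0_le_integral => //.
    + by move=> x _; rewrite mule_ge0 ?wm0// lee_fin ltW.
    + by apply: measurable_funeM; exact: mwm.
    + exact: mphis.
    + move=> x xe; have /andP[h _] := sm _ (pe _ xe).
      apply: (le_trans _ (lee_wpmul2l _ h)); last by rewrite lee_fin.
      by rewrite -!EFinM lee_fin le_eqVlt; apply/orP; left; apply/eqP; ring.
  move: le2 I0; set J := (\int[lam]_(x in _) _)%E; set K := (\int[lam]_(x in _) _)%E.
  move=> le2 K0.
  rewrite muleA -EFinM (_ : c2 * C1 = c2 * C1 / c1 * c1); last by rewrite divfK ?gt_eqF.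
  rewrite EFinM -muleA.
  apply: (le_trans (lee_wpmul2l _ le2)).
    by rewrite lee_fin; apply: divr_ge0; [apply: mulr_ge0 => //|]; exact: ltW.
  rewrite muleCA; apply: lee_wpmul2l; first by rewrite lee_fin ltW.
  apply: (@le_trans _ _ ((c2 / c1)%:E * (C1%:E * K + B%:E))%E); last first.
    apply: lee_wpmul2r; first by rewrite adde_ge0 ?mule_ge0 ?lee_fin.
    by rewrite lee_fin lerDl; apply: divr_ge0; [apply: mulr_ge0 => //|]; exact: ltW.
  apply: (@le_trans _ _ ((c2 / c1)%:E * (C1%:E * K))%E).
    by rewrite muleA -EFinM mulrAC.
  apply: lee_wpmul2l; first by rewrite lee_fin; apply: divr_ge0; exact: ltW.
  by rewrite leeDl// lee_fin.
Qed.

End regular_functions.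

(** * Trigonometric polynomials and the structure function *)

Section trigonometry.
Variable R : realType.
Implicit Types x y : R.

Lemma norm_le_sqr x y : `|x| <= `|y| -> x ^+ 2 <= y ^+ 2.
Proof.
rewrite -(real_normK (num_real x)) -(real_normK (num_real y)) => xy.
by rewrite ler_pXn2r ?nnegrE.
Qed.

Lemma sin_natpi (k : nat) : sin (k%:R * pi) = 0 :> R.
Proof.
elim: k => [|k IH]; first by rewrite mul0r sin0.
by rewrite -addn1 natrD mulrDl mul1r sinDpi IH oppr0.
Qed.

Lemma sin_intpi (k : int) : sin (k%:~R * pi) = 0 :> R.
Proof.
case: k => k; first exact: sin_natpi.
by rewrite NegzE mulrNz mulNr sinN -pmulrn sin_natpi oppr0.
Qed.

Lemma norm_sin_le x : `|sin x| <= `|x|.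
Proof.
wlog x0 : x / 0 <= x.
  move=> H; have [x0|x0] := leP 0 x; first exact: H.
  by rewrite -normrN -sinN -(normrN x); apply: H; rewrite oppr_ge0 ltW.
have [->|xn0] := eqVneq x 0; first by rewrite sin0.
have xp : 0 < x by rewrite lt_neqAle eq_sym xn0.
have [|c _ H] := @MVT R (@sin R) (@cos R) 0 x xp (fun y _ => is_derive_sin y).
  by apply: continuous_subspaceT => y; exact: continuous_sin.
rewrite -[sin x]subr0 -[X in _ - X]sin0 H subr0 normrM.
by rewrite ler_piMl// cos_max.
Qed.

Lemma cos_sin_half x : cos x = 1 - 2 * sin (x / 2) ^+ 2.
Proof.
have {1}-> : x = (x / 2) *+ 2 by rewrite -mulr_natr divfK.
by rewrite cos_mulr2n cos2sin2; ring.
Qed.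

Lemma cos_ge x : 1 - x ^+ 2 / 2 <= cos x.
Proof.
rewrite cos_sin_half.
have : sin (x / 2) ^+ 2 <= (x / 2) ^+ 2.
  by apply: norm_le_sqr; exact: norm_sin_le.
have -> : (x / 2) ^+ 2 = x ^+ 2 / 4 by field.
lra.
Qed.

Lemma cos_ge_half x : `|x| <= 1 -> 2^-1 <= cos x.
Proof.
move=> x1; have := cos_ge x; have : x ^+ 2 <= 1 ^+ 2 by apply: norm_le_sqr; rewrite normr1.
rewrite expr1n.
lra.
Qed.

Lemma sin_ge_half x : 0 <= x <= 1 -> x / 2 <= sin x.
Proof.
move=> /andP[x0 x1].
have [->|xn0] := eqVneq x 0; first by rewrite sin0 mul0r.
have xp : 0 < x by rewrite lt_neqAle eq_sym xn0.
have [|c cx H] := @MVT R (@sin R) (@cos R) 0 x xp (fun y _ => is_derive_sin y).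
  by apply: continuous_subspaceT => y; exact: continuous_sin.
rewrite -[sin x]subr0 -[X in _ - X]sin0 H subr0 mulrC ler_wpM2r//.
apply: cos_ge_half; move: cx; rewrite in_itv/= => /andP[c0 cx].
by rewrite gtr0_norm// (le_trans (ltW cx)).
Qed.

(* sin x = 2 sin (x/2) cos (x/2), where x/2 <= 1 *)
Lemma sin_ge_sixth x : 0 <= x <= pi / 2 -> x / 6 <= sin x.
Proof.
move=> /andP[x0 xpi]; have xlt2 : x < 2 by rewrite (le_lt_trans xpi) ?pihalf_lt2.
have h1 : 0 <= x / 2 <= 1 by lra.
have := sin_ge_half h1; have : 2^-1 <= cos (x / 2).
  by apply: cos_ge_half; rewrite ger0_norm; lra.
have -> : sin x = 2 * (cos (x / 2) * sin (x / 2)).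
  by rewrite -[in LHS](@divfK _ 2 _ x) ?pnatr_eq0// mulr_natr sin_mulr2n mulr_natl.
move: (cos _) (sin _) => c s c1 s1.
suff : x / 12 <= c * s by lra.
apply: (@le_trans _ _ (2^-1 * (x / 2 / 2))); first lra.
by apply: ler_pM => //; lra.
Qed.

Lemma one_sub_cos_ge x : `|x| <= 1 -> x ^+ 2 / 8 <= 1 - cos x.
Proof.
move=> x1; rewrite -cos_norm -(real_normK (num_real x)); move: x1 (normr_ge0 x).
move: `|x| => y y1 y0; rewrite cos_sin_half opprB addrC subrK.
have h1 : 0 <= y / 2 <= 1 by lra.
have h := sin_ge_half h1; have : (y / 2 / 2) ^+ 2 <= sin (y / 2) ^+ 2.
  by rewrite ler_pXn2r// nnegrE; lra.
rewrite (_ : (y / 2 / 2) ^+ 2 = y ^+ 2 / 16); last by field.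
lra.
Qed.

(** The Dirichlet kernel in closed form: each term is a difference of sines at consecutive
    half-integer multiples of x. *)
Lemma sum_cos_telescope x (H : nat) :
  2 * sin (x / 2) * (\sum_(1 <= h < H.+1) cos (h%:R * x)) =
  sin ((H%:R + 2^-1) * x) - sin (x / 2).
Proof.
elim: H => [|H IH].
  by rewrite big_nil mulr0 add0r mulrC subrr.
rewrite big_nat_recr//= mulrDr IH.
have -> : (H.+1%:R + 2^-1) * x = H.+1%:R * x + x / 2 by field.
have -> : (H%:R + 2^-1) * x = H.+1%:R * x - x / 2 by rewrite -natr1; field.
by rewrite sinB sinD; ring.
Qed.

(* The Dirichlet kernel is bounded by a multiple of 1/|x|, so the nonnegative
   terms 1 - cos (h x) average to at least 1/2 over 1 <= h <= H. *)
Lemma sum_one_sub_cos_ge x (H : nat) : `|x| <= pi -> 12 <= H%:R * `|x| ->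
  H%:R / 2 <= \sum_(1 <= h < H.+1) (1 - cos (h%:R * x)).
Proof.
have -> : \sum_(1 <= h < H.+1) (1 - cos (h%:R * x)) =
    \sum_(1 <= h < H.+1) (1 - cos (h%:R * `|x|)).
  apply: eq_bigr => h _; rewrite -[cos (_ * x)]cos_norm normrM ger0_norm//.
move: `|x| (normr_ge0 x) => {x} y y0 ypi Hy.
have yp : 0 < y.
  by rewrite lt_neqAle y0 andbT; apply/eqP => y00; move: Hy; rewrite -y00; lra.
have := sum_cos_telescope y H.
have s6 : y / 2 / 6 <= sin (y / 2) by apply: sin_ge_sixth; lra.
have := sin_le1 ((H%:R + 2^-1) * y).
rewrite big_split/= sumrN sumr_const_nat subn1/=.
have := sin_le1 (y / 2); move: (sin (_ * y)) (sin _) s6 => u s s6 s1 u1.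
set T := \sum_(_ <= _ < _) _ => E.
have T1 : 2 * s * T <= 1 by lra.
have sp : 0 < s by lra.
rewrite -[1 *+ H]/(H%:R).
have Hp : 0 <= H%:R :> R by [].
suff : T <= H%:R / 2 by lra.
(* Origin of the 12: sin (y / 2) >= y / 12 and H y >= 12 give 2 s (H / 2) >= 1, which contradicts 2
   s T <= 1 as soon as T > H / 2. *)
rewrite leNgt; apply/negP => HT.
have sT : s * (H%:R / 2) < s * T by rewrite ltr_pM2l.
have : y / 2 / 6 * (H%:R / 2) <= s * (H%:R / 2).
  by apply: ler_wpM2r => //; lra.
lra.
Qed.

End trigonometry.

(** * Fourier series on the cube *)

Section cube_fourier.
Variable R : realType.

Lemma lattice_ptD n (j k : 'rV[int]_n) :
  lattice_pt R (j + k) = lattice_pt R j + lattice_pt R k.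
Proof. by apply/rowP => i; rewrite !mxE rmorphD. Qed.

Lemma lattice_ptN n (j : 'rV[int]_n) : lattice_pt R (- j) = - lattice_pt R j.
Proof. by apply/rowP => i; rewrite !mxE rmorphN. Qed.

Lemma lattice_ptB n (j k : 'rV[int]_n) :
  lattice_pt R (j - k) = lattice_pt R j - lattice_pt R k.
Proof. by rewrite lattice_ptD lattice_ptN. Qed.

Lemma lattice_pt0 n : lattice_pt R (0 : 'rV[int]_n) = 0.
Proof. by apply/rowP => i; rewrite !mxE. Qed.

Lemma integral_cos_int (k : int) (a : R) :
  (\int[@lebesgue_measure R]_(r in `[(- pi)%R, pi%R]) (cos (a + r * k%:~R))%:E =
   (if k == 0 then 2 * pi * cos a else 0)%R%:E)%E.
Proof.
have pp : - pi < pi :> R by have := pi_gt0 R; lra.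
have [->|k0] := eqVneq k 0.
  under eq_integral do rewrite mulr0 addr0.
  rewrite integral_cst/= ?lebesgue_measure_itv/= ?lte_fin ?pp -?EFinB -?EFinM.
    by congr EFin; ring.
  exact: measurable_itv.
have kR : k%:~R != 0 :> R by rewrite intr_eq0.
pose F (r : R) := sin (a + r * k%:~R) / k%:~R.
have dF (r : R) : is_derive r (1 : R) F (cos (a + r * k%:~R)).
  apply: is_derive_eq; rewrite /= ?scaler0 ?addr0 ?add0r.
  by rewrite /GRing.scale/=; field.
have cF r : {for r, continuous F}.
  apply/differentiable_continuous/derivable1_diffP.
  exact: ex_derive.
rewrite (@continuous_FTC2 R (fun r => cos (a + r * k%:~R)) F)//.
- rewrite /F !sinD !mulNr sinN cosN (mulrC pi) sin_intpi -EFinB; congr EFin; ring.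
- apply: continuous_subspaceT => r.
  apply: (@continuous_comp _ _ _ (fun r : R => a + r * k%:~R) cos).
    apply: cvgD; first exact: cvg_cst.
    by apply: cvgMl; exact: cvg_id.
  exact: continuous_cos.
- split.
  + by move=> r _; exact: ex_derive.
  + by apply: cvg_at_right_filter; exact: cF.
  + by apply: cvg_at_left_filter; exact: cF.
- by move=> r _; rewrite derive1E; exact: derive_val.
Qed.

Lemma cubeE n : cube = centered_box pi :> set 'rV[R]_n.
Proof. by []. Qed.

Lemma measurable_cube n : measurable (cube : set 'rV[R]_n).
Proof. exact: measurable_centered_box. Qed.

Lemma lebesgue_cube n : lebesgue_row R n cube = ((2 * pi) ^+ n)%:E.
Proof. by rewrite cubeE lebesgue_centered_box// pi_ge0. Qed.

Lemma lebesgue_cube_fin n : (lebesgue_row R n cube < +oo)%E.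
Proof. by rewrite lebesgue_cube ltry. Qed.

Lemma bounded_integrable d (T : measurableType d) (mu : {measure set T -> \bar R})
    (A : set T) (f : T -> R) (M : R) : measurable A -> (mu A < +oo)%E ->
  measurable_fun setT f -> (forall x, `|f x| <= M) -> mu.-integrable A (EFin \o f).
Proof.
move=> mA Afin mf fM; apply: measurable_bounded_integrable => //.
  exact: measurable_funTS.
by exists M; split=> //= r Mr x _ /=; rewrite (le_trans (fM x))// ltW.
Qed.

Lemma cube_integrable n (f : 'rV[R]_n -> R) (M : R) :
  measurable_fun setT f -> (forall x, `|f x| <= M) ->
  (lebesgue_row R n).-integrable cube (EFin \o f).
Proof.
apply: bounded_integrable; first exact: measurable_cube.
exact: lebesgue_cube_fin.
Qed.

Lemma measurable_cos_dotp n (a : R) (x : 'rV[R]_n) :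
  measurable_fun setT (fun xi : 'rV[R]_n => cos (a + dotp xi x)).
Proof.
apply: measurableT_comp.
  by apply: continuous_measurable_fun; exact: continuous_cos.
apply: measurable_funD; first exact: measurable_cst.
by under eq_fun do rewrite dotpC; exact: measurable_dotp.
Qed.

(** Orthogonality of characters, by induction on the dimension. The free phase [a] absorbs the first
    coordinate, so that cosines are closed under the induction and complex exponentials are
    avoided. *)
Lemma integral_cube_cosD n (k : 'rV[int]_n) (a : R) :
  (\int[lebesgue_row R n]_(xi in cube) (cos (a + dotp xi (lattice_pt R k)))%:E =
   (if k == 0 then (2 * pi) ^+ n * cos a else 0)%R%:E)%E.
Proof.
elim: n k a => [|n IH] k a.
  have -> : (k == 0) by apply/eqP; exact: thinmx0.
  rewrite expr0 mul1r -[RHS]mule1 -(expr0 (2 * pi)) -(lebesgue_cube 0).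
  rewrite -integral_cst; last exact: measurable_cube.
  by apply: eq_integral => x _; rewrite /dotp big_ord0 addr0.
pose k0 := k ord0 ord0; pose k' : 'rV[int]_n := \row_j k ord0 (lift ord0 j).
have kE : (k == 0) = (k0 == 0) && (k' == 0).
  apply/eqP/andP => [kz|[/eqP k00 /eqP k'0]].
    by split; apply/eqP; [rewrite /k0 kz mxE|apply/rowP => j; rewrite !mxE kz mxE].
  apply/rowP => i; rewrite mxE; have [j ->|->] := unliftP ord0 i => //.
  by have /rowP/(_ j) := k'0; rewrite !mxE.
pose I : set (measurableTypeR R) := `[(- pi)%R, pi]%classic.
pose h (p : measurableTypeR R * 'rV[R]_n) : R :=
  \1_I p.1 * (\1_cube p.2 * cos (a + p.1 * k0%:~R + dotp p.2 (lattice_pt R k'))).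
have mI : measurable I by exact: measurable_itv.
have Ioo : (@lebesgue_measure R I < +oo)%E.
  have := lebesgue_measure_itv `[(- pi)%R, (pi : R)].
  rewrite /= lte_fin => ->; case: ifP => // _.
  by rewrite -EFinB ltry.
have mfst := @measurable_fst _ _ (measurableTypeR R) 'rV[R]_n.
have msnd := @measurable_snd _ _ (measurableTypeR R) 'rV[R]_n.
have mh : measurable_fun setT h.
  apply: measurable_funM.
    by apply: measurableT_comp mfst; exact: measurable_indic.
  apply: measurable_funM.
    by apply: measurableT_comp msnd; apply: measurable_indic; exact: measurable_cube.
  apply: measurableT_comp.
    by apply: continuous_measurable_fun; exact: continuous_cos.
  apply: measurable_funD.
    apply: measurable_funD; first exact: measurable_cst.
    by apply: measurable_funM => //; exact: measurable_cst.
  under eq_fun do rewrite dotpC.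
  by apply: measurableT_comp msnd; exact: measurable_dotp.
have hE (p : measurableTypeR R * 'rV[R]_n) :
    (if p \in row_cons (n:=n) @^-1` cube then
      (cos (a + dotp (row_cons p) (lattice_pt R k)))%:E else 0%E) = (h p)%:E.
  have -> : dotp (row_cons p) (lattice_pt R k) =
      p.1 * k0%:~R + dotp p.2 (lattice_pt R k').
    rewrite /dotp big_ord_recl !mxE unlift_none; congr (_ + _).
    by apply: eq_bigr => i _; rewrite !mxE liftK.
  rewrite addrA /h !indicE.
  have -> : (p \in row_cons (n:=n) @^-1` cube) = (p.1 \in I) && (p.2 \in cube).
    apply/idP/andP; rewrite !inE/= /I/= in_itv/=.
      move=> H; split; first by have := H ord0; rewrite mxE unlift_none.
      by move=> i; have := H (lift ord0 i); rewrite mxE liftK.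
    move=> [H1 H2] i; have [j ij|i0] := unliftP ord0 i.
      by rewrite ij mxE liftK; exact: H2.
    by rewrite i0 mxE unlift_none.
  by case: (p.1 \in I); case: (p.2 \in cube); rewrite ?mul1r ?mul0r.
have h1 p : `|h p| <= 1.
  rewrite /h !normrM; apply: mulr_ile1 => //.
    by rewrite indicE; case: (_ \in _); rewrite ?normr0 ?normr1.
  apply: mulr_ile1 => //; last exact: cos_max.
  by rewrite indicE; case: (_ \in _); rewrite ?normr0 ?normr1.
have ih : (@lebesgue_measure R \x lebesgue_row R n)%E.-integrable setT (EFin \o h).
  have mIc : measurable (I `*` (cube : set 'rV[R]_n)).
    by apply: measurableX => //; exact: measurable_cube.
  apply: (eq_integrable _ ((EFin \o h) \_ (I `*` (cube : set 'rV[R]_n)))) => //.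
    move=> p _; rewrite patchE; case: ifPn => //=.
    rewrite notin_setE => H; rewrite /h !indicE.
    have [pI|] := boolP (p.1 \in I); last by rewrite mul0r.
    have [pc|] := boolP (p.2 \in cube); last by rewrite mul0r mulr0.
    by exfalso; apply: H; split; rewrite -inE.
  apply: (iffLR (integrable_mkcond _ mIc)).
  refine (@bounded_integrable _ _ (@lebesgue_measure R \x lebesgue_row R n)%E
    _ h 1 mIc _ mh h1).
  have E := @product_measure1E _ _ _ _ R (@lebesgue_measure R) (lebesgue_row R n)
    I cube mI (@measurable_cube n).
  have : (@lebesgue_measure R I * lebesgue_row R n cube < +oo)%E.
    apply: lte_mul_pinfty; first exact: measure_ge0.
      by rewrite ge0_fin_numE; [exact: Ioo|exact: measure_ge0].
    exact: lebesgue_cube_fin.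
  by rewrite -E.
transitivity (\int[(@lebesgue_measure R \x lebesgue_row R n)%E]_p (h p)%:E)%E.
  rewrite -(@integral_measure_preserving _ _ _ _ _
    (@lebesgue_measure R \x lebesgue_row R n)%E _ (@row_cons R n)
    (@measurable_row_cons R n) _ cube (fun xi => (cos (a + dotp xi (lattice_pt R k)))%:E)).
  - rewrite integral_mkcond; apply: eq_integral => p _; rewrite patchE.
    exact: hE.
  - by [].
  - exact: measurable_cube.
  - by apply/measurable_EFinP; exact: measurable_cos_dotp.
  - apply: (iffRL (integrable_mkcond _ _)).
      exact: measurable_preim (@measurable_row_cons R n) (@measurable_cube _).
    apply: eq_integrable ih => // p _; rewrite patchE /=; exact/esym/hE.
rewrite -(integral12_prod_meas1 ih) /fubini_F.
transitivity (\int[@lebesgue_measure R]_(r in I)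
    ((if k' == 0 then (2 * pi) ^+ n * cos (a + r * k0%:~R) else 0)%R%:E))%E.
  rewrite [RHS]integral_mkcond; apply: eq_integral => r _; rewrite patchE /h/= indicE.
  case: ifPn => rI; last first.
    by apply: integral0_eq => x _; rewrite mul0r.
  rewrite -IH [RHS]integral_mkcond; apply: eq_integral => x _.
  by rewrite patchE indicE mul1r; case: ifPn => _; rewrite ?mul1r ?mul0r.
rewrite kE andbC; case: (k' == 0) => /=; last by rewrite integral0.
under eq_integral do rewrite EFinM.
rewrite integralZl//; last first.
  apply: (@bounded_integrable _ _ _ _ _ 1) => //.
  - apply: measurableT_comp.
      by apply: continuous_measurable_fun; exact: continuous_cos.
    apply: measurable_funD; first exact: measurable_cst.
    by apply: measurable_funM; [exact: measurable_id|exact: measurable_cst].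
  - by move=> r; exact: cos_max.
rewrite /I integral_cos_int -EFinM; congr EFin.
by case: ifP => _; rewrite ?mulr0// exprSr; ring.
Qed.

End cube_fourier.

Section trigonometric_polynomials.
Variables (R : realType) (n : nat).
Implicit Types (s t : seq 'rV[int]_n) (a b : 'rV[int]_n -> R) (xi : 'rV[R]_n).

Let lam := lebesgue_row R n.

Definition phase xi (j : 'rV[int]_n) : R := dotp xi (lattice_pt R j).

Lemma phaseD xi j k : phase xi (j + k) = phase xi j + phase xi k.
Proof. by rewrite /phase lattice_ptD dotpDr. Qed.

Lemma phaseB xi j k : phase xi (j - k) = phase xi j - phase xi k.
Proof. by rewrite /phase lattice_ptB dotpBr. Qed.

Lemma phaseN xi j : phase xi (- j) = - phase xi j.
Proof. by rewrite /phase lattice_ptN dotpNr. Qed.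

Lemma measurable_phase j : measurable_fun setT (phase ^~ j).
Proof. by under eq_fun do rewrite /phase dotpC; exact: measurable_dotp. Qed.

Lemma measurable_cosf d (T : measurableType d) (f : T -> R) :
  measurable_fun setT f -> measurable_fun setT (fun x => cos (f x)).
Proof.
move=> mf; apply: measurableT_comp => //.
by apply: continuous_measurable_fun; exact: continuous_cos.
Qed.

Lemma measurable_sinf d (T : measurableType d) (f : T -> R) :
  measurable_fun setT f -> measurable_fun setT (fun x => sin (f x)).
Proof.
move=> mf; apply: measurableT_comp => //.
by apply: continuous_measurable_fun; exact: continuous_sin.
Qed.

(** Real part, imaginary part and squared modulus of the trigonometric polynomial with coefficients
    [a] on [s]. *)
Definition tcos s a xi : R := \sum_(j <- s) a j * cos (phase xi j).
Definition tsin s a xi : R := \sum_(j <- s) a j * sin (phase xi j).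
Definition tpow s a xi : R := tcos s a xi ^+ 2 + tsin s a xi ^+ 2.

Lemma tpow_ge0 s a xi : 0 <= tpow s a xi.
Proof. by rewrite addr_ge0// sqr_ge0. Qed.

Lemma tpowE s a xi : tpow s a xi =
  \sum_(i <- s) \sum_(j <- s) a i * a j * cos (phase xi (i - j)).
Proof.
rewrite /tpow !expr2 !mulr_suml -big_split/=; apply: eq_bigr => i _.
rewrite !mulr_sumr -big_split/=; apply: eq_bigr => j _.
by rewrite phaseB cosB; ring.
Qed.

Lemma measurable_tcos s a : measurable_fun setT (tcos s a).
Proof.
apply: measurable_sum => j; apply: measurable_funM => //.
by apply: measurable_cosf; exact: measurable_phase.
Qed.

Lemma measurable_tsin s a : measurable_fun setT (tsin s a).
Proof.
apply: measurable_sum => j; apply: measurable_funM => //.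
by apply: measurable_sinf; exact: measurable_phase.
Qed.

Lemma measurable_tpow s a : measurable_fun setT (tpow s a).
Proof.
apply: measurable_funD; apply: measurable_funX.
  exact: measurable_tcos.
exact: measurable_tsin.
Qed.

Lemma tpow_le s a xi :
  tpow s a xi <= \sum_(i <- s) \sum_(j <- s) `|a i * a j|.
Proof.
rewrite tpowE; apply: ler_sum => i _; apply: ler_sum => j _.
by rewrite (le_trans (ler_norm _))// normrM ler_piMr// cos_max.
Qed.

Lemma Rintegral_sum d (T : measurableType d) (mu : {measure set T -> \bar R})
    (D : set T) (I : eqType) (r : seq I) (f : I -> T -> R) : measurable D ->
  (forall i, mu.-integrable D (EFin \o f i)) ->
  (\int[mu]_(x in D) \sum_(i <- r) f i x = \sum_(i <- r) \int[mu]_(x in D) f i x)%R.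
Proof.
move=> mD fi; rewrite {1}/Rintegral.
under eq_integral do rewrite -sumEFin.
rewrite (integral_sum mD (f := fun i x => (f i x)%:E))//.
elim: r => [|i r IH]; first by rewrite !big_nil.
rewrite !big_cons fineD//; first by rewrite IH.
  exact: integrable_fin_num (fi i).
by apply/sum_fin_numP => k _ _; exact: integrable_fin_num (fi k).
Qed.

Lemma integral_cube_cos k : (\int[lam]_(xi in cube) cos (phase xi k) =
  if k == 0 then (2 * pi) ^+ n else 0)%R.
Proof.
rewrite /Rintegral; under eq_integral do rewrite -[phase _ _]add0r.
by rewrite integral_cube_cosD cos0 mulr1.
Qed.

Section weighted.
Variables (W : 'rV[R]_n -> R) (M : R).
Hypotheses (mW : measurable_fun setT W) (WM : forall xi, `|W xi| <= M).

Lemma cube_integrable_weight (f : 'rV[R]_n -> R) (B : R) :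
  measurable_fun setT f -> (forall x, `|f x| <= B) ->
  lam.-integrable cube (EFin \o (fun xi => W xi * f xi)).
Proof.
move=> mf fB; apply: (@cube_integrable _ _ _ (M * B)).
  exact: measurable_funM.
by move=> x; rewrite normrM ler_pM.
Qed.

Lemma integral_weight_tpow s a :
  (\int[lam]_(xi in cube) (W xi * tpow s a xi) =
  \sum_(i <- s) \sum_(j <- s) a i * a j *
    \int[lam]_(xi in cube) (W xi * cos (phase xi (i - j))))%R.
Proof.
have ic k : lam.-integrable cube (EFin \o (fun xi => W xi * cos (phase xi k))).
  apply: (@cube_integrable_weight _ 1).
    by apply: measurable_cosf; exact: measurable_phase.
  by move=> x; exact: cos_max.
have mc := @measurable_cube R n.
transitivity (\int[lam]_(xi in cube) \sum_(i <- s) \sum_(j <- s)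
    a i * a j * (W xi * cos (phase xi (i - j))))%R.
  apply: eq_Rintegral => xi _; rewrite tpowE mulr_sumr; apply: eq_bigr => i _.
  by rewrite mulr_sumr; apply: eq_bigr => j _; ring.
have icM i j : lam.-integrable cube
    (EFin \o (fun xi => a i * a j * (W xi * cos (phase xi (i - j))))).
  apply: eq_integrable (integrableZl mc (a i * a j) (ic (i - j))) => //.
rewrite Rintegral_sum//; last first.
  move=> i; apply: eq_integrable (integrable_sum mc s (P := xpredT)
    (fun j _ => icM i j)) => // x _ /=.
  by rewrite sumEFin.
apply: eq_bigr => i _; rewrite Rintegral_sum//.
by apply: eq_bigr => j _; rewrite RintegralZl.
Qed.

End weighted.

Lemma parseval s a : uniq s ->
  (\int[lam]_(xi in cube) tpow s a xi = (2 * pi) ^+ n * \sum_(j <- s) a j ^+ 2)%R.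
Proof.
move=> us; have := @integral_weight_tpow (fun=> 1) 1 (measurable_cst _) _ s a.
under eq_Rintegral do rewrite mul1r.
move=> ->; last by move=> _; rewrite normr1.
rewrite mulr_sumr; apply: eq_big_seq => i si.
rewrite (bigD1_seq i)//= subrr.
under eq_Rintegral do rewrite mul1r.
rewrite integral_cube_cos eqxx big1 ?addr0; first by rewrite expr2 mulrC.
move=> j ji; under eq_Rintegral do rewrite mul1r.
by rewrite integral_cube_cos subr_eq0 eq_sym (negbTE ji) mulr0.
Qed.

Lemma sum_indicator (V : zmodType) s t (f : 'rV[int]_n -> V) : uniq s -> uniq t ->
  {subset s <= t} -> \sum_(j <- t | j \in s) f j = \sum_(j <- s) f j.
Proof.
move=> us ut st; rewrite -big_filter; apply: perm_big.
apply: uniq_perm => //; first exact: filter_uniq.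
by move=> j; rewrite mem_filter; case sj: (j \in s) => //; rewrite st.
Qed.

Lemma sum_indicatorM s t (f : 'rV[int]_n -> R) : uniq s -> uniq t ->
  {subset s <= t} -> \sum_(j <- t) (j \in s)%:R * f j = \sum_(j <- s) f j.
Proof.
move=> us ut st; rewrite -(sum_indicator f us ut st) [RHS]big_mkcond/=.
by apply: eq_bigr => j _; case: (j \in s); rewrite ?mul1r ?mul0r.
Qed.

(* The Fourier series of 1_s(j - v) - 1_s(j) is that of 1_s times e(v) - 1. *)
Lemma tpow_shift s t (v : 'rV[int]_n) xi : uniq s -> uniq t ->
  {subset s <= t} -> {subset map (fun j => j + v) s <= t} ->
  tpow t (fun j => (j \in map (fun j => j + v) s)%:R - (j \in s)%:R) xi =
  (2 - 2 * cos (phase xi v)) * tpow s (fun=> 1) xi.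
Proof.
move=> us ut st svt.
have usv : uniq (map (fun j => j + v) s) by rewrite map_inj_uniq//; exact: addIr.
rewrite /tpow /tcos /tsin.
under eq_bigr do rewrite mulrBl.
under [in X in _ + X]eq_bigr do rewrite mulrBl.
rewrite !sumrB !sum_indicatorM// !big_map.
under eq_bigr do rewrite phaseD cosD.
under [in X in _ + X]eq_bigr do rewrite phaseD sinD.
rewrite sumrB big_split/= -!mulr_suml.
under [in RHS]eq_bigr do rewrite mul1r.
under [in X in _ = _ * (_ + X ^+ 2)]eq_bigr do rewrite mul1r.
move: (\sum_(_ <- _) _) (\sum_(_ <- _) _) (cos2Dsin2 (phase xi v)).
move: (cos _) (sin _) => c s' Sn C cs.
have -> : (C * c - Sn * s' - C) ^+ 2 + (Sn * c + C * s' - Sn) ^+ 2 =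
  ((c ^+ 2 + s' ^+ 2) + 1 - 2 * c) * (C ^+ 2 + Sn ^+ 2) by ring.
by rewrite cs; congr (_ * _); ring.
Qed.

Lemma parseval_shift s t (v : 'rV[int]_n) : uniq s -> uniq t ->
  {subset s <= t} -> {subset map (fun j => j + v) s <= t} ->
  (\int[lam]_(xi in cube) ((2 - 2 * cos (phase xi v)) * tpow s (fun=> 1) xi) =
   (2 * pi) ^+ n *
   \sum_(j <- t) ((j \in map (fun j => j + v) s)%:R - (j \in s)%:R) ^+ 2)%R.
Proof.
move=> us ut st svt; rewrite -(parseval _ ut); apply: eq_Rintegral => xi _.
by rewrite tpow_shift.
Qed.

End trigonometric_polynomials.

(** * The structure function as a uniform limit of cosine polynomials *)

Section structure_function_theory.
Variables (R : realType) (n : nat) (K : 'rV[int]_n -> R).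
Hypothesis K_l1 : summable [set: 'rV[int]_n] (fun j => (K j)%:E).
Implicit Types (s t : seq 'rV[int]_n).

#[local] Existing Instance summability.totally_filter.

Definition l1_norm : R := fine (\esum_(j in [set: 'rV[int]_n]) `|(K j)%:E|)%E.

Let esum_fin : (\esum_(j in [set: 'rV[int]_n]) `|(K j)%:E|)%E \is a fin_num.
Proof. by rewrite -summableE. Qed.

Lemma sum_norm_le_l1 s : uniq s -> \sum_(j <- s) `|K j| <= l1_norm.
Proof.
move=> us; rewrite -lee_fin /l1_norm fineK//; apply: esum_ge.
exists [set` s]; first by split => //; exact: finite_seq.
by rewrite -fsbig_seq// -sumEFin.
Qed.

Lemma l1_norm_ge0 : 0 <= l1_norm.
Proof. by have := @sum_norm_le_l1 [::] isT; rewrite big_nil. Qed.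

(** A finite set that nearly exhausts the sum of |K| leaves at most eta for any finite set disjoint
    from it. *)
Lemma l1_tail (eta : R) : 0 < eta -> exists2 s, uniq s &
  forall t, uniq t -> {in t, forall j, j \notin s} -> \sum_(j <- t) `|K j| <= eta.
Proof.
move=> eta0.
have : (l1_norm%:E - eta%:E < \esum_(j in [set: 'rV[int]_n]) `|(K j)%:E|)%E.
  by rewrite /l1_norm fineK// lteBlDr// lteDl.
move=> /ereal_sup_gt[_ [A [finA _] <-]] HA.
pose sA := finmap.enum_fset (fset_set A).
have usA : uniq sA by exact: finmap.fset_uniq.
exists sA => // t ut tA.
have := @sum_norm_le_l1 (sA ++ t); rewrite cat_uniq usA ut andbT big_cat/=.
move: HA; rewrite fsbig_finite//= sumEFin -EFinB lte_fin -/sA => HA.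
have -> : ~~ has (mem sA) t by apply/hasPn => j /tA.
move=> /(_ isT); lra.
Qed.

Let trig_sum (c : R -> R) (xi : 'rV[R]_n) (A : finmap.finSet 'rV[int]_n) : R :=
  \sum_(j <- finmap.enum_fset A) K j * c (phase xi j).

Let trig_sum_diff (c : R -> R) xi (eta : R) s (A : finmap.finSet 'rV[int]_n) :
  (forall x, `|c x| <= 1) -> uniq s ->
  (forall t, uniq t -> {in t, forall j, j \notin s} -> \sum_(j <- t) `|K j| <= eta) ->
  {subset s <= finmap.enum_fset A} ->
  `|trig_sum c xi A - \sum_(j <- s) K j * c (phase xi j)| <= eta.
Proof.
move=> c1 us tail sA; rewrite /trig_sum (bigID (mem s))/=.
rewrite (sum_indicator (fun j => K j * c (phase xi j)) us (finmap.fset_uniq A) sA).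
rewrite addrAC subrr add0r -big_filter (le_trans (ler_norm_sum _ _ _))//.
apply: le_trans (tail [seq j <- finmap.enum_fset A | j \notin s] _ _).
- by apply: ler_sum => j _; rewrite normrM ler_piMr.
- by apply: filter_uniq; exact: finmap.fset_uniq.
- by move=> j; rewrite mem_filter => /andP[].
Qed.

Let totally_subset s (P : set (finmap.finSet 'rV[int]_n)) :
  (forall A, {subset s <= finmap.enum_fset A} -> P A) -> summability.totally P.
Proof.
move=> H; exists (fset_set [set` s]) => // A /= /finmap.fsubsetP sA.
apply: H => j js; apply: sA.
by rewrite in_fset_set; [exact: mem_set|exact: finite_seq].
Qed.

Let cvg_trig_sum (c : R -> R) xi : (forall x, `|c x| <= 1) ->
  cvg (trig_sum c xi @ summability.totally).
Proof.
move=> c1; apply/cauchy_cvgP; apply: cauchy_exP => e e0.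
have e20 : 0 < e / 2 by rewrite divr_gt0.
have [s us tail] := l1_tail e20.
exists (\sum_(j <- s) K j * c (phase xi j)).
apply: (@totally_subset s) => A sA.
rewrite /ball/= distrC (le_lt_trans (trig_sum_diff xi c1 us tail sA))//; lra.
Qed.

Let term (xi : 'rV[R]_n) (j : 'rV[int]_n) : (R[i])^o :=
  expi (dotp xi (lattice_pt R j)) * (K j)%:C%C.

Let partial_sumE xi A : summability.partial_sum (term xi) A =
  (trig_sum cos xi A +i* trig_sum sin xi A)%C.
Proof.
rewrite /summability.partial_sum /trig_sum.
rewrite -(finmap.big_seq_fsetE _ _ xpredT (term xi))/=.
elim: (finmap.enum_fset A) => [|j s IH]; first by rewrite !big_nil.
by rewrite !big_cons IH /term /expi; simpc; rewrite !(mulrC (K j)).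
Qed.

(** The complex sum converges because its real and imaginary parts do, both being dominated by |K|;
    its real part is the cosine series. *)
Lemma structure_function_lim xi : structure_function K xi =
  lim (trig_sum cos xi @ summability.totally).
Proof.
set a := lim (trig_sum cos xi @ summability.totally).
pose b := lim (trig_sum sin xi @ summability.totally).
suff H : summability.partial_sum (term xi) @ summability.totally -->
    ((a +i* b)%C : (R[i])^o).
  rewrite /structure_function /summability.sum.
  by rewrite (cvg_lim (@norm_hausdorff _ _) H).
have ca : trig_sum cos xi @ summability.totally --> a.
  by apply: cvg_trig_sum; exact: cos_max.
have cb : trig_sum sin xi @ summability.totally --> b.
  by apply: cvg_trig_sum; exact: sin_max.
apply/cvgrPdist_le => e e0.
have [e' e'0 ->] : exists2 e' : R, 0 < e' & e = e'%:C%C.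
  move: e0; case: e => x y; rewrite ltcE/= => /andP[/eqP -> x0].
  by exists x.
have e20 : 0 < e' / 2 by rewrite divr_gt0.
have /cvgrPdist_le/(_ _ e20) Ha := ca.
have /cvgrPdist_le/(_ _ e20) Hb := cb.
apply: filterS2 Ha Hb => A Ha Hb; rewrite partial_sumE.
have -> : (a +i* b)%C - (trig_sum cos xi A +i* trig_sum sin xi A)%C =
    ((a - trig_sum cos xi A) +i* (b - trig_sum sin xi A))%C by [].
rewrite normc_def/= lecR -[leRHS](ger0_norm (ltW e'0)) -sqrtr_sqr ler_wsqrtr//.
set x := a - _; set y := b - _.
have hx : x ^+ 2 <= (e' / 2) ^+ 2.
  by apply: norm_le_sqr; rewrite (ger0_norm (ltW e20)).
have hy : y ^+ 2 <= (e' / 2) ^+ 2.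
  by apply: norm_le_sqr; rewrite (ger0_norm (ltW e20)).
have : 0 <= e' ^+ 2 by exact: sqr_ge0.
have : (e' / 2) ^+ 2 = e' ^+ 2 / 4 by field.
lra.
Qed.

(** Uniform in xi because the tail of |K| does not involve xi. Boundedness, measurability and the
    Fourier coefficients of S all follow from this. *)
Lemma structure_function_approx (eta : R) : 0 < eta -> exists2 s, uniq s &
  forall t, uniq t -> {subset s <= t} ->
  forall xi, `|structure_function K xi - tcos t K xi| <= eta.
Proof.
move=> eta0; have [s us tail] := l1_tail eta0.
exists s => // t ut st xi.
have tailt u : uniq u -> {in u, forall j, j \notin t} -> \sum_(j <- u) `|K j| <= eta.
  move=> uu H; apply: tail => // j ju; apply/negP => js.
  by have := H j ju; rewrite (st _ js).
have c : trig_sum cos xi @ summability.totally --> structure_function K xi.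
  by rewrite structure_function_lim; apply: cvg_trig_sum; exact: cos_max.
apply/ler_addgt0Pr => e e0; have /cvgrPdist_le/(_ _ e0) ce := c.
have ct : \forall A \near summability.totally,
    `|trig_sum cos xi A - tcos t K xi| <= eta.
  apply: (@totally_subset t) => A tA.
  by apply: trig_sum_diff => // x; exact: cos_max.
have [A [h1 h2]] := filter_ex (filterI ce ct).
rewrite -(subrK (trig_sum cos xi A) (structure_function K xi)) -addrA addrC.
by rewrite (le_trans (ler_normD _ _))// lerD.
Qed.

Lemma norm_structure_function_le xi : `|structure_function K xi| <= l1_norm.
Proof.
apply/ler_addgt0Pr => e e0; have [s us H] := structure_function_approx e0.
have := H s us (fun=> id) xi.
rewrite -{2}(subrK (tcos s K xi) (structure_function K xi)) => h.
rewrite addrC (le_trans (ler_normD _ _))// lerD//.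
apply: le_trans (sum_norm_le_l1 us); rewrite (le_trans (ler_norm_sum _ _ _))//.
by apply: ler_sum => j _; rewrite normrM ler_piMr// cos_max.
Qed.

Lemma measurable_structure_function : measurable_fun setT (structure_function K).
Proof.
have /choice[s Hs] (m : nat) : exists s, forall xi,
    `|structure_function K xi - tcos s K xi| <= m.+1%:R^-1.
  have [|s us H] := @structure_function_approx m.+1%:R^-1; first by rewrite invr_gt0.
  by exists s => xi; exact: H.
apply: (measurable_fun_cvg (h := fun m => tcos (s m) K)) => //.
  by move=> m; exact: measurable_tcos.
move=> xi _; apply/cvgrPdist_le => e e0.
near=> m; rewrite (le_trans (Hs m xi))// ltW//.
near: m; exact: near_infty_natSinv_lt (PosNum e0).
Unshelve. all: by end_near. Qed.

Section even.
Hypothesis K_even : forall j, K (- j) = K j.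

(** True for every partial sum that contains both k and - k, where the cosine picks up half a
    coefficient each and evenness merges the halves; the uniform approximation then passes to the
    limit. *)
Lemma fourier_structure_function (k : 'rV[int]_n) :
  (\int[lebesgue_row R n]_(xi in cube) (structure_function K xi * cos (phase xi k)) =
   (2 * pi) ^+ n * K k)%R.
Proof.
have mc := @measurable_cube R n.
have mcos j : measurable_fun setT (fun xi : 'rV[R]_n => cos (phase xi j)).
  by apply: measurable_cosf; exact: measurable_phase.
have icos j : (lebesgue_row R n).-integrable cube (EFin \o (fun xi => cos (phase xi j))).
  by apply: (@cube_integrable _ _ _ 1) => // x; exact: cos_max.
have pin0 : 0 <= (2 * pi) ^+ n :> R by rewrite exprn_ge0// mulr_ge0// pi_ge0.
have trig t : uniq t -> k \in t -> - k \in t ->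
    (\int[lebesgue_row R n]_(xi in cube) (tcos t K xi * cos (phase xi k)) =
    (2 * pi) ^+ n * K k)%R.
  move=> ut kt Nkt.
  transitivity (\int[lebesgue_row R n]_(xi in cube) \sum_(j <- t)
      ((K j / 2) * cos (phase xi (j + k)) + (K j / 2) * cos (phase xi (j - k))))%R.
    apply: eq_Rintegral => xi _; rewrite /tcos mulr_suml; apply: eq_bigr => j _.
    by rewrite phaseB phaseD cosB cosD; field.
  have iZ c j : (lebesgue_row R n).-integrable cube
      (EFin \o (fun xi => c * cos (phase xi j))).
    by apply: eq_integrable (integrableZl mc c (icos j)).
  rewrite Rintegral_sum//; last first.
    by move=> j; apply: eq_integrable (integrableD mc (iZ (K j / 2) (j + k))
      (iZ (K j / 2) (j - k))).
  rewrite (eq_bigr (fun j => K j / 2 * (if j == - k then (2 * pi) ^+ n else 0) +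
      K j / 2 * (if j == k then (2 * pi) ^+ n else 0))); last first.
    move=> j _; rewrite RintegralD// !RintegralZl//.
    by rewrite !integral_cube_cos addr_eq0 subr_eq0.
  rewrite big_split/= (bigD1_seq (- k))//= (bigD1_seq k)//= !eqxx K_even.
  rewrite !big1 => [|j /negbTE ->|j /negbTE ->]; rewrite ?mulr0//.
  by field.
apply/eqP; rewrite -subr_eq0 -normr_le0; apply/ler_addgt0Pr => e e0; rewrite add0r.
have e'0 : 0 < e / (2 * pi) ^+ n by rewrite divr_gt0// exprn_gt0// mulr_gt0// pi_gt0.
have [s us H] := structure_function_approx e'0.
pose t := undup (k :: - k :: s).
have ut : uniq t by exact: undup_uniq.
have st : {subset s <= t} by move=> j js; rewrite mem_undup !inE js !orbT.
have {}H := H t ut st.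
rewrite -(trig t ut) ?mem_undup ?inE ?eqxx ?orbT//.
have iS : (lebesgue_row R n).-integrable cube
    (EFin \o (fun xi => structure_function K xi * cos (phase xi k))).
  apply: (cube_integrable_weight measurable_structure_function
    norm_structure_function_le (B := 1)) => // x; exact: cos_max.
have iT : (lebesgue_row R n).-integrable cube
    (EFin \o (fun xi => tcos t K xi * cos (phase xi k))).
  apply: (@cube_integrable_weight _ _ _ l1_norm _ _ _ 1) => //.
  - exact: measurable_tcos.
  - move=> xi; apply: le_trans (sum_norm_le_l1 ut).
    rewrite (le_trans (ler_norm_sum _ _ _))//.
    by apply: ler_sum => j _; rewrite normrM ler_piMr// cos_max.
  - by move=> x; exact: cos_max.
rewrite -RintegralB//.
have iD : (lebesgue_row R n).-integrable cube (EFin \o (fun xi =>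
    structure_function K xi * cos (phase xi k) - tcos t K xi * cos (phase xi k))).
  by apply: eq_integrable (integrableB mc iS iT).
apply: (le_trans (le_normr_Rintegral mc iD)).
have -> : e = (\int[lebesgue_row R n]_(x in cube) (e / (2 * pi) ^+ n))%R.
  rewrite Rintegral_cst//.
  have -> : fine (lebesgue_row R n cube) = (2 * pi) ^+ n by rewrite lebesgue_cube.
  by rewrite divfK// gt_eqF// exprn_gt0// mulr_gt0// pi_gt0.
apply: le_Rintegral => //.
- by apply: eq_integrable (integrable_norm iD).
- apply: (@cube_integrable _ _ _ (e / (2 * pi) ^+ n)) => // x.
  by rewrite ger0_norm// ltW.
- move=> x _; rewrite -mulrBl normrM (le_trans _ (H x))//.
  by rewrite ler_piMr// cos_max.
Qed.

End even.

End structure_function_theory.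

(** * Covariances *)

Lemma norm_mul_le (R : realDomainType) (x y : R) : `|x * y| <= x ^+ 2 + y ^+ 2.
Proof.
rewrite ler_norml; have h1 := sqr_ge0 (x - y); have h2 := sqr_ge0 (x + y).
have h3 := sqr_ge0 x; have h4 := sqr_ge0 y.
have e1 : (x - y) ^+ 2 = x ^+ 2 + y ^+ 2 - 2 * (x * y) by ring.
have e2 : (x + y) ^+ 2 = x ^+ 2 + y ^+ 2 + 2 * (x * y) by ring.
by apply/andP; split; lra.
Qed.

Section covariance_form.
Context {disp : measure_display} {Omega : measurableType disp} {R : realType}
  (P : probability Omega R) {n : nat}.
Variables (X : 'rV[int]_n -> {RV P >-> R}) (K : 'rV[int]_n -> R).
Hypotheses (X_mean0 : forall i, ('E_P[X i] = 0)%E)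
  (X_cov : forall i j, ('E_P[X i \* X j] = (K (i - j)%R)%:E)%E).
Implicit Types (s t : seq 'rV[int]_n) (a b : 'rV[int]_n -> R).

Let covE i j : (\int[P]_w (X i w * X j w)%:E = (K (i - j))%:E)%E.
Proof. by rewrite -X_cov unlock. Qed.

Let mX i : measurable_fun setT (X i : Omega -> R).
Proof. exact: measurable_funP. Qed.

Let intX2 i : P.-integrable setT (EFin \o (fun w => X i w ^+ 2)).
Proof.
apply/integrableP; split.
  by apply/measurable_EFinP; exact: measurable_funX.
rewrite (_ : (fun _ => _) = (fun w => (X i w * X i w)%:E)).
  by rewrite covE ltry.
by apply/funext => w /=; rewrite ger0_norm ?sqr_ge0// expr2.
Qed.

Let intXX i j : P.-integrable setT (EFin \o (fun w => X i w * X j w)).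
Proof.
apply: (le_integrable measurableT _ _ (integrableD measurableT (intX2 i) (intX2 j))).
  by apply/measurable_EFinP; exact: measurable_funM.
by move=> w _ /=; rewrite lee_fin [leRHS]ger0_norm ?addr_ge0 ?sqr_ge0// norm_mul_le.
Qed.

Let intX i : P.-integrable setT (EFin \o (X i : Omega -> R)).
Proof.
have i1 : P.-integrable setT (EFin \o (cst 1 : Omega -> R)).
  by apply: finite_measure_integrable_cst.
apply: (le_integrable measurableT _ _ (integrableD measurableT i1 (intX2 i))).
  exact/measurable_EFinP.
move=> w _ /=; rewrite lee_fin [leRHS]ger0_norm ?addr_ge0 ?sqr_ge0//.
by have := norm_mul_le 1 (X i w); rewrite mul1r expr1n.
Qed.

Lemma cov_even i : K (- i) = K i.
Proof.
apply: EFin_inj; have := covE i 0; rewrite subr0 => <-.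
by rewrite -[- i]sub0r -covE; apply: eq_integral => w _; rewrite mulrC.
Qed.

Lemma cov_0 : (variance P (X 0) = 1%E) -> K 0 = 1.
Proof.
rewrite /variance unlock X_mean0 /= => H.
apply: EFin_inj; have := covE 0 0; rewrite subrr => <-.
rewrite -[RHS]H unlock; apply: eq_integral => w _.
change ((X 0 w * X 0 w)%:E = ((X 0 w - 0) * (X 0 w - 0))%:E).
by rewrite subr0.
Qed.

Lemma second_moment s a :
  (\int[P]_w ((\sum_(i <- s) a i * X i w) ^+ 2)%:E =
   (\sum_(i <- s) \sum_(j <- s) a i * a j * K (i - j))%:E)%E.
Proof.
transitivity (\int[P]_w (\sum_(i <- s) \sum_(j <- s)
    ((a i * a j)%:E * (X i w * X j w)%:E)))%E.
  apply: eq_integral => w _; rewrite expr2 mulr_suml -sumEFin.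
  apply: eq_bigr => i _; rewrite mulr_sumr -sumEFin; apply: eq_bigr => j _.
  by rewrite -EFinM; congr EFin; ring.
have iZ i j : P.-integrable setT (fun w => (a i * a j)%:E * (X i w * X j w)%:E)%E.
  by apply: eq_integrable (integrableZl measurableT (a i * a j) (intXX i j)).
rewrite integral_sum//; last by move=> i; apply: integrable_sum.
rewrite -sumEFin; apply: eq_bigr => i _; rewrite integral_sum// -sumEFin.
apply: eq_bigr => j _; rewrite integralZl//; last exact: intXX.
by rewrite covE -EFinM.
Qed.

Lemma cov_psd s a : 0 <= \sum_(i <- s) \sum_(j <- s) a i * a j * K (i - j).
Proof.
rewrite -lee_fin -second_moment; apply: integral_ge0 => w _.
by rewrite lee_fin sqr_ge0.
Qed.

Lemma variance_Q (Lambda : set 'rV[R]_n) s : uniq s ->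
  (forall i, (i \in s) <-> Lambda (lattice_pt R i)) ->
  variance P (Q Lambda X) = (\sum_(i <- s) \sum_(j <- s) K (i - j))%:E.
Proof.
move=> us sL; have QE w : Q Lambda X w = \sum_(i <- s) 1 * X i w.
  rewrite /Q (_ : [set i | _] = [set` s]).
    by rewrite -fsbig_seq//; apply: eq_bigr => i _; rewrite mul1r.
  by apply/seteqP; split => i /=; rewrite sL.
have EQ : ('E_P[Q Lambda X] = 0)%E.
  rewrite unlock.
  transitivity (\int[P]_w (\sum_(i <- s) (X i w)%:E))%E.
    by apply: eq_integral => w _; rewrite QE -sumEFin; apply: eq_bigr => i _; rewrite mul1r.
  rewrite integral_sum// big1// => i _.
  by rewrite -expectation_def.
rewrite /variance unlock EQ unlock /=.
transitivity (\int[P]_w ((\sum_(i <- s) 1 * X i w) ^+ 2)%:E)%E.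
  apply: eq_integral => w _.
  change (((Q Lambda X w - 0) * (Q Lambda X w - 0))%:E =
    ((\sum_(i <- s) 1 * X i w) ^+ 2)%:E).
  by rewrite subr0 QE expr2.
rewrite (second_moment s (fun=> 1)); congr EFin.
by apply: eq_bigr => i _; apply: eq_bigr => j _; rewrite !mul1r.
Qed.

End covariance_form.

Section positive_semidefinite.
Variables (R : realType) (n : nat) (K : 'rV[int]_n -> R).
Hypotheses (K_even : forall j, K (- j) = K j)
  (K_psd : forall s (a : 'rV[int]_n -> R),
    0 <= \sum_(i <- s) \sum_(j <- s) a i * a j * K (i - j)).

Definition cov_form s (a b : 'rV[int]_n -> R) : R :=
  \sum_(i <- s) \sum_(j <- s) a i * b j * K (i - j).

Lemma cov_formC s a b : cov_form s a b = cov_form s b a.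
Proof.
rewrite /cov_form exchange_big/=; apply: eq_bigr => i _; apply: eq_bigr => j _.
by rewrite -K_even opprB (mulrC (a _)).
Qed.

(** The form may be degenerate. If A <> 0, its value at p a - A b is A (A B - p^2). If A = 0, its
    value at - (B + 1) a + p b is p^2 (- B - 2), which forces p = 0. *)
Lemma cov_form_cauchy_schwarz s a b :
  cov_form s a b ^+ 2 <= cov_form s a a * cov_form s b b.
Proof.
set p := cov_form s a b; set A := cov_form s a a; set B := cov_form s b b.
have H x y : 0 <= x ^+ 2 * A + 2 * (x * y) * p + y ^+ 2 * B.
  have := K_psd s (fun j => x * a j + y * b j).
  suff -> : \sum_(i <- s) \sum_(j <- s) (x * a i + y * b i) * (x * a j + y * b j) *
      K (i - j) = x ^+ 2 * A + 2 * (x * y) * p + y ^+ 2 * B by [].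
  have -> : 2 * (x * y) * p = x * y * p + x * y * cov_form s b a.
    by rewrite (cov_formC s b a) -/p; ring.
  rewrite /A /B /p /cov_form !mulr_sumr -!big_split/=; apply: eq_bigr => i _.
  rewrite !mulr_sumr -!big_split/=; apply: eq_bigr => j _.
  by ring.
have A0 : 0 <= A by exact: K_psd.
have B0 : 0 <= B by exact: K_psd.
have [Az|An] := eqVneq A 0.
  have := H (- (B + 1)) p; rewrite Az mulr0 add0r => h; rewrite mul0r.
  have : 0 <= p ^+ 2 * (- B - 2).
    by apply: (le_trans h); rewrite le_eqVlt; apply/orP; left; apply/eqP; ring.
  by have := sqr_ge0 p; nra.
have Ap : 0 < A by rewrite lt_neqAle eq_sym An.
have h := H p (- A); rewrite -subr_ge0 -(pmulr_rge0 _ Ap); move: h.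
by have -> : p ^+ 2 * A + 2 * (p * - A) * p + (- A) ^+ 2 * B =
  A * (A * B - p ^+ 2) by ring.
Qed.

End positive_semidefinite.

(** * Nonnegativity of the structure function *)

Section lattice_boxes.
Variable n : nat.

Definition lbox (m : nat) : seq 'rV[int]_n :=
  [seq map_mx (fun k : 'I_m.*2.+1 => (k : nat)%:Z - m%:Z) x
  | x <- enum 'rV['I_m.*2.+1]_n].

Lemma lbox_uniq m : uniq (lbox m).
Proof.
rewrite map_inj_uniq ?enum_uniq// => x y /rowP xy; apply/rowP => i.
have := xy i; rewrite !mxE => /addIr /eqP; rewrite eqz_nat => /eqP ?.
exact: val_inj.
Qed.

Lemma mem_lbox m (j : 'rV[int]_n) :
  (j \in lbox m) = [forall i, - m%:Z <= j ord0 i <= m%:Z].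
Proof.
apply/mapP/forallP => [[x _ ->] i|H].
  by rewrite mxE; have := ltn_ord (x ord0 i); move: (x ord0 i : nat) => k; lia.
have jm i : (`|(j ord0 i + m%:Z)%R| < m.*2.+1)%N by have := H i; lia.
exists (\row_i Ordinal (jm i)); first by rewrite mem_enum.
apply/rowP => i; rewrite !mxE/= gez0_abs ?addrK//; have := H i; lia.
Qed.

Lemma size_lbox m : size (lbox m) = (m.*2.+1 ^ n)%N.
Proof. by rewrite size_map -cardE card_mx card_ord mul1n. Qed.

End lattice_boxes.

Section structure_function_ge0.
Variables (R : realType) (n : nat) (K : 'rV[int]_n -> R).
Hypothesis K_l1 : summable [set: 'rV[int]_n] (fun j => (K j)%:E).
Hypothesis K_psd : forall s (a : 'rV[int]_n -> R),
    0 <= \sum_(i <- s) \sum_(j <- s) a i * a j * K (i - j).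

Lemma bernoulli_sub (x : R) k : 0 <= x <= 1 -> 1 - k%:R * x <= (1 - x) ^+ k.
Proof.
move=> /andP[x0 x1]; elim: k => [|k IH]; first by rewrite mul0r subr0 expr0.
rewrite exprS (le_trans _ (ler_wpM2l _ IH)) ?subr_ge0//.
rewrite -natr1; have : 0 <= k%:R :> R by []; have : 0 <= x * x by rewrite mulr_ge0.
by move: (k%:R : R) => r h1 h2; have := mulr_ge0 h2 h1; lra.
Qed.

Let fejer_sum (xi : 'rV[R]_n) (m : nat) : R :=
  \sum_(i <- lbox n m) \sum_(j <- lbox n m) K (i - j) * cos (phase xi (i - j)).

Let fejer_sum_ge0 xi m : 0 <= fejer_sum xi m.
Proof.
pose c (i : 'rV[int]_n) := cos (phase xi i); pose s (i : 'rV[int]_n) := sin (phase xi i).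
rewrite [leRHS](_ : _ =
  \sum_(i <- lbox n m) \sum_(j <- lbox n m) c i * c j * K (i - j) +
  \sum_(i <- lbox n m) \sum_(j <- lbox n m) s i * s j * K (i - j)).
  by rewrite addr_ge0.
rewrite /fejer_sum -big_split/=; apply: eq_bigr => i _.
rewrite -big_split/=; apply: eq_bigr => j _.
by rewrite phaseB cosB /c /s; ring.
Qed.

(* Fejer: the nonnegative sum over pairs in a large box is, up to boundary
   terms, the number of points of the box times the structure function. *)
Lemma structure_function_ge0 xi : 0 <= structure_function K xi.
Proof.
apply/ler_addgt0Pr => e e0.
(* One third each for the tail of a row, the approximation of S and the boundary of the box. *)
pose eta := e / 3; have eta0 : 0 < eta by rewrite divr_gt0.
have [s0 us0 tail0] := l1_tail K_l1 eta0.
have [s1 us1 approx1] := structure_function_approx K_l1 eta0.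
pose s := undup (s0 ++ s1); have us : uniq s by exact: undup_uniq.
have approx := approx1 s us; rewrite -/s in approx.
have tail t : uniq t -> {in t, forall j, j \notin s} -> \sum_(j <- t) `|K j| <= eta.
  move=> ut H; apply: tail0 => // j /H; apply: contra => js.
  by rewrite mem_undup mem_cat js.
pose g j := K j * cos (phase xi j).
have gK j : `|g j| <= `|K j| by rewrite normrM ler_piMr// cos_max.
have {}approx : \sum_(j <- s) g j <= structure_function K xi + eta.
  have /(_ _)/(_ xi) := approx; rewrite ler_norml => /(_ _)/andP[].
    by move=> j js; rewrite mem_undup mem_cat js orbT.
  by rewrite /tcos -/g => h _; rewrite -lerBlDl; move: h; rewrite /g; lra.
have [b sb] : exists b, {subset s <= lbox n b}.
  exists (\sum_(j <- s) \sum_i `|j ord0 i|%N)%N => j js.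
  rewrite mem_lbox; apply/forallP => i; rewrite -ler_norml -abszE lez_nat.
  rewrite (bigD1_seq j)//= (bigD1 i)//=.
  by rewrite -addnA leq_addr.
have key m : (b <= m)%N ->
    fejer_sum xi m <= (m.*2.+1 ^ n)%:R * (\sum_(j <- s) g j + eta) +
      l1_norm K * ((m.*2.+1 ^ n)%:R - ((m - b).*2.+1 ^ n)%:R).
  move=> bm.
  (* For i at depth b inside the box the row runs over all of [s]. For the other i, the terms of [s]
     that are missing cost at most [l1_norm K]. *)
  have inner i : i \in lbox n m -> \sum_(j <- lbox n m) g (i - j) <=
      \sum_(j <- s) g j + eta + l1_norm K * (i \notin lbox n (m - b))%:R.
    move=> im; pose T := [seq i - j | j <- lbox n m].
    have uT : uniq T.
      rewrite map_inj_uniq ?lbox_uniq// => x y xy; apply: oppr_inj.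
      exact: addrI xy.
    rewrite -(big_map (fun j => i - j) xpredT g) -/T.
    rewrite (bigID (mem s))/= -lerBrDl.
    have h1 : \sum_(j <- T | j \notin s) g j <= eta.
      rewrite -big_filter; apply: le_trans (tail [seq j <- T | j \notin s] _ _).
      - by apply: ler_sum => j _; apply: le_trans (gK j); exact: ler_norm.
      - exact: filter_uniq.
      - by move=> j; rewrite mem_filter => /andP[].
    apply: (le_trans h1).
    have -> : \sum_(j <- T | j \in s) g j = \sum_(j <- s | j \in T) g j.
      rewrite -[LHS]big_filter -[RHS]big_filter; apply: perm_big.
      apply: uniq_perm; [exact: filter_uniq|exact: filter_uniq|].
      by move=> j; rewrite !mem_filter andbC.
    rewrite [X in _ <= X + _ + _ - _](bigID (mem T))/=.
    suff : - \sum_(j <- s | j \notin T) g j <= l1_norm K * (i \notin lbox n (m - b))%:R.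
      by move: (\sum_(_ <- _ | _ \in _) _) (\sum_(_ <- _ | _) _) => u v; lra.
    have [ib|ib] := boolP (i \in lbox n (m - b)).
      rewrite mulr0 big_seq_cond big1 ?oppr0// => j /andP[/sb jb /negP[]].
      apply/mapP; exists (i - j); last by rewrite opprB addrC subrK.
      rewrite mem_lbox; apply/forallP => k; rewrite !mxE.
      move: ib jb; rewrite !mem_lbox => /forallP/(_ k) ib /forallP/(_ k).
      rewrite -subzn// in ib; move: ib; move: (i ord0 k) (j ord0 k) => x y.
      by clear; lia.
    rewrite mulr1 -sumrN; apply: le_trans (sum_norm_le_l1 K_l1 us).
    rewrite [leRHS](bigID (fun j => j \in T))/= addrC -[leLHS]addr0; apply: lerD.
      by apply: ler_sum => j _; apply: le_trans (gK j); rewrite -normrN ler_norm.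
    exact: sumr_ge0.
  rewrite /fejer_sum big_seq_cond.
  apply: (@le_trans _ _ (\sum_(i <- lbox n m | (i \in lbox n m) && true)
     (\sum_(j <- s) g j + eta + l1_norm K * (i \notin lbox n (m - b))%:R))).
    by apply: ler_sum => i /andP[im _]; exact: inner.
  rewrite -big_seq_cond big_split/= lerD//.
    by rewrite big_const_seq count_predT size_lbox iter_addr_0 mulr_natl.
  rewrite -mulr_sumr ler_wpM2l ?(l1_norm_ge0 K_l1)//.
  have E : \sum_(i <- lbox n m) (i \in lbox n (m - b))%:R = ((m - b).*2.+1 ^ n)%:R :> R.
    have := sum_indicatorM (fun=> 1 : R) (@lbox_uniq n (m - b)) (@lbox_uniq n m).
    under eq_bigr do rewrite mulr1.
    move=> -> => [|j].
      by rewrite big_const_seq count_predT size_lbox iter_addr_0.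
    rewrite !mem_lbox => /forallP H; apply/forallP => k; have := H k; lia.
  rewrite -E; rewrite -[in leRHS](size_lbox n m).
  have -> : (size (lbox n m))%:R = \sum_(i <- lbox n m) 1 :> R.
    by rewrite big_const_seq count_predT iter_addr_0.
  rewrite -sumrB; apply: ler_sum => i _.
  by case: (_ \in _); rewrite /= ?subrr ?subr0.
pose c := l1_norm K * n%:R * (2 * b%:R).
have c0 : 0 <= c by rewrite !mulr_ge0// (l1_norm_ge0 K_l1).
(* By Bernoulli the boundary layer is a fraction at most 2 b n / (2 m + 1) of the box; this m brings
   its cost below eta. *)
pose m := (b + Num.bound (c / eta))%N.
have bm : (b <= m)%N by rewrite leq_addr.
have Hm : c <= eta * m.*2.+1%:R.
  rewrite mulrC -ler_pdivrMr//; apply: (le_trans (ler_norm _)).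
  apply: (le_trans (ltW (unstable.ltr_norm_bound _))).
  rewrite ler_nat /m; move: (Num.Def.archi_bound _) => q.
  by clear; lia.
have := le_trans (fejer_sum_ge0 xi m) (key m bm).
set N := (m.*2.+1)%:R : R; have N0 : 0 < N by rewrite ltr0n.
have -> : ((m - b).*2.+1 ^ n)%:R = N ^+ n * (1 - 2 * b%:R / N) ^+ n.
  rewrite natrX -exprMn mulrBr mulr1 mulrC divfK ?gt_eqF//; congr (_ ^+ _).
  rewrite /N (_ : m.*2.+1 = ((m - b).*2.+1 + 2 * b)%N); last by clear -bm; lia.
  by rewrite natrD natrM addrK.
rewrite natrX -/N -{2}[N ^+ n]mulr1 -mulrBr mulrCA -mulrDr pmulr_rge0 ?exprn_gt0//.
have : 1 - n%:R * (2 * b%:R / N) <= (1 - 2 * b%:R / N) ^+ n.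
  apply: bernoulli_sub; rewrite divr_ge0 ?mulr_ge0 ?(ltW N0)//= ler_pdivrMr// mul1r.
  by rewrite /N -natrM ler_nat; clear -bm; lia.
have h : l1_norm K * (n%:R * (2 * b%:R / N)) <= eta.
  have -> : l1_norm K * (n%:R * (2 * b%:R / N)) = c / N.
    by rewrite /c; field; rewrite gt_eqF.
  by rewrite ler_pdivrMr.
set p := (1 - _) ^+ n => /(ler_wpM2l (l1_norm_ge0 K_l1)).
rewrite !mulrBr !mulr1 => hp hk.
have ee : e = 3 * eta by rewrite /eta mulrC divfK.
have arith (S' g' L A P : R) : g' <= S' + eta -> A <= eta -> L - A <= P ->
    0 <= g' + eta + (L - P) -> 0 <= S' + 3 * eta by clear; lra.
by rewrite ee; exact: arith approx h hp hk.
Qed.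

End structure_function_ge0.

(** * The lattice ball and its transform *)

Definition ball_ind {R : realType} {n} (L : R) (x : 'rV[R]_n) : R :=
  ((enorm x <= L)%R)%:R.

Section ball_points.
Variables (R : realType) (n : nat).

Definition ball_pts (L : R) : seq 'rV[int]_n :=
  [seq j <- lbox n (Num.bound L) | enorm (lattice_pt R j) <= L].

Lemma ball_pts_uniq L : uniq (ball_pts L).
Proof. by apply: filter_uniq; exact: lbox_uniq. Qed.

Lemma mem_ball_pts L (j : 'rV[int]_n) :
  (j \in ball_pts L) = (enorm (lattice_pt R j) <= L).
Proof.
rewrite mem_filter; case: leP => //= jL; rewrite mem_lbox; apply/forallP => i.
have := le_lt_trans (le_trans (coord_le_enorm (lattice_pt R j) i) jL)
  (le_lt_trans (ler_norm L) (unstable.ltr_norm_bound L)).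
rewrite mxE => /ltW; rewrite ler_norml.
by rewrite pmulrn -mulrNz !ler_int.
Qed.

Lemma ball_ptsN L (j : 'rV[int]_n) : (- j \in ball_pts L) = (j \in ball_pts L).
Proof. by rewrite !mem_ball_pts lattice_ptN enormN. Qed.

End ball_points.

(** * Lattice points that enter or leave a shifted ball *)

Section lines.
Variables (R : realType) (n : nat).

Lemma size_int_itv (u : seq int) (a b : R) : uniq u -> a <= b ->
  (forall z, z \in u -> a <= z%:~R <= b) -> (size u)%:R <= b - a + 1.
Proof.
move=> uu ab H; case: u uu H => [|z u] uu H.
  by rewrite addr_ge0// subr_ge0.
pose ca := Num.ceil a; pose fb := Num.floor b.
have cafb x : x \in z :: u -> ca <= x <= fb.
  by move=> /H/andP[ax xb]; rewrite /ca /fb ceil_le_int floor_ge_int ax xb.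
have cf : ca <= fb.
  by have := cafb z; rewrite inE eqxx => /(_ isT)/andP[]; exact: le_trans.
pose N := `|(fb - ca + 1)%R|%N.
have NE : N%:Z = fb - ca + 1 by rewrite /N gez0_abs//; lia.
have /uniq_leq_size/(_ _) := uu.
move=> /(_ [seq ca + k%:Z | k <- iota 0 N]) h.
have : (size (z :: u) <= N)%N.
  rewrite -[leqRHS](size_iota 0) -(size_map (fun k : nat => ca + k%:Z)); apply: h => x xu.
  have /andP[cx xf] := cafb x xu; apply/mapP; exists `|(x - ca)%R|%N.
    rewrite mem_iota add0n /=; rewrite -ltz_nat NE gez0_abs; lia.
  by rewrite gez0_abs; lia.
rewrite -(ler_nat R) => /le_trans; apply.
have -> : N%:R = fb%:~R - ca%:~R + 1 :> R.
  by rewrite pmulrn NE !mulrzDr mulrNz.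
by rewrite lerD2r lerD// ?lerN2 ?ceil_ge// floor_le.
Qed.

Definition line_base {T : Type} (i : 'I_n.+1) (x : 'rV[T]_n.+1) : 'rV[T]_n :=
  \row_k x ord0 (lift i k).

Lemma sqr_enorm_line (i : 'I_n.+1) (x : 'rV[R]_n.+1) :
  enorm x ^+ 2 = x ord0 i ^+ 2 + enorm (line_base i x) ^+ 2.
Proof.
rewrite !sqr_enorm (bigD1_ord i)//=; congr (_ + _).
by apply: eq_bigr => k _; rewrite mxE.
Qed.

Lemma line_baseP {T : Type} (i : 'I_n.+1) (x y : 'rV[T]_n.+1) :
  x ord0 i = y ord0 i -> line_base i x = line_base i y -> x = y.
Proof.
move=> xy /rowP xy'; apply/rowP => k; have [j ->|->//] := unliftP i k.
by have := xy' j; rewrite !mxE.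
Qed.

Lemma sum_fibers (i : 'I_n.+1) (t : seq 'rV[int]_n.+1) (u : seq 'rV[int]_n)
    (F : 'rV[int]_n.+1 -> R) : uniq u ->
  (forall j, j \in t -> F j != 0 -> line_base i j \in u) ->
  \sum_(j <- t) F j = \sum_(r <- u) \sum_(j <- t | line_base i j == r) F j.
Proof.
move=> uu H; under [RHS]eq_bigr do rewrite big_mkcond.
rewrite exchange_big/=; apply: eq_big_seq => j jt.
have [Fj|Fj] := eqVneq (F j) 0.
  by rewrite Fj big1// => r _; case: ifP.
rewrite (bigD1_seq (line_base i j))//=; last exact: H.
by rewrite eqxx big1 ?addr0// => k; rewrite eq_sym => /negbTE ->.
Qed.

(* On a line parallel to the i-th axis the ball is a segment, and shifting a
   segment by s changes membership only at distance at most s from its ends. *)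
Lemma count_ball_shift (L s : R) (y : 'rV[R]_n.+1) (i : 'I_n.+1)
    (t : seq 'rV[int]_n.+1) :
  0 <= L -> 0 <= s -> (forall k, `|y ord0 k| <= 1) -> uniq t ->
  \sum_(j <- t) (ball_ind L (lattice_pt R j + y) -
    ball_ind L (lattice_pt R j + y + s *: delta_mx ord0 i)) ^+ 2 <=
  2 * (s + 1) * (2 * L + 3) ^+ n.
Proof.
move=> L0 s0 y1 ut.
set F := (F in \sum_(j <- t) F j).
pose z (j : 'rV[int]_n.+1) : R := (j ord0 i)%:~R + y ord0 i.
pose base (r : 'rV[int]_n) : R := enorm (lattice_pt R r + line_base i y) ^+ 2.
have E1 j : enorm (lattice_pt R j + y) ^+ 2 = z j ^+ 2 + base (line_base i j).
  rewrite (sqr_enorm_line i) /z /base !mxE; congr (_ + enorm _ ^+ 2).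
  by apply/rowP => k; rewrite !mxE.
have E2 j : enorm (lattice_pt R j + y + s *: delta_mx ord0 i) ^+ 2 =
    (z j + s) ^+ 2 + base (line_base i j).
  rewrite (sqr_enorm_line i) /z /base !mxE !eqxx mulr1; congr (_ + enorm _ ^+ 2).
  apply/rowP => k; rewrite !mxE [lift i k == i]eq_sym (negbTE (neq_lift i k)).
  by rewrite andbF mulr0 addr0.
have sqr_le (x : R) : 0 <= x -> (x <= L) = (x ^+ 2 <= L ^+ 2).
  by move=> x0; rewrite ler_pXn2r.
have FE j : F j = (((z j ^+ 2 + base (line_base i j) <= L ^+ 2)%R)%:R -
    (((z j + s) ^+ 2 + base (line_base i j) <= L ^+ 2)%R)%:R) ^+ 2.
  by rewrite /F /ball_ind !sqr_le ?enorm_ge0// E1 E2.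
have F01 j : F j = (F j != 0)%:R.
  by rewrite FE; do 2 case: (_ <= _); rewrite /= ?subrr ?subr0 ?sub0r ?sqrrN ?expr1n ?expr0n ?eqxx ?oner_neq0.
(* A line that meets the ball has base coordinates at most L + 1 < m + 2 in absolute value, because
   those of [y] are at most 1. This leaves 2 (m + 1) + 1 <= 2 L + 3 values for each of them. *)
pose m := Num.Def.trunc L.
have mL : m%:R <= L by rewrite /m truncn_le.
have Lm : L < m.+1%:R by exact: truncnS_gt.
have bL j : F j != 0 -> base (line_base i j) <= L ^+ 2.
  rewrite FE => Fj; rewrite leNgt; apply/negP => bj; move: Fj.
  rewrite !leNgt !(lt_le_trans bj) ?lerDr ?sqr_ge0//=.
  by rewrite subrr expr0n eqxx.
have inbox j : F j != 0 -> line_base i j \in lbox n m.+1.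
  move=> /bL; rewrite /base -sqr_le ?enorm_ge0// => bj.
  rewrite mem_lbox; apply/forallP => k.
  have := le_trans (coord_le_enorm _ k) bj; rewrite !mxE ler_norml => h.
  have := y1 (lift i k); rewrite ler_norml; move: (y _ _) h => yk h1 h2.
  have : (- m.+2%:Z < j ord0 (lift i k)) && (j ord0 (lift i k) < m.+2%:Z).
    rewrite -!(ltr_int R) mulrNz -!pmulrn; move: Lm; rewrite -[m.+2]addn1 natrD.
    move: h1 h2 => /andP[? ?] /andP[? ?] ?; apply/andP; split; lra.
  by move: (j _ _) => x; clear; lia.
rewrite (@sum_fibers i t (lbox n m.+1))//; [|exact: lbox_uniq|by move=> j _; exact: inbox].
suff fiber r : \sum_(j <- t | line_base i j == r) F j <= 2 * (s + 1).
  apply: (@le_trans _ _ (\sum_(r <- lbox n m.+1) 2 * (s + 1))).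
    by apply: ler_sum.
  rewrite big_const_seq count_predT size_lbox iter_addr_0 -[leLHS]mulr_natr.
  rewrite ler_wpM2l ?mulr_ge0 ?addr_ge0// natrX lerXn2r ?nnegrE//.
    by rewrite addr_ge0// mulr_ge0.
  by rewrite -addnn -natr1 natrD -natr1; lra.
have [rL|rL] := leP (base r) (L ^+ 2); last first.
  rewrite big1 ?mulr_ge0 ?addr_ge0// => j /eqP jr.
  apply/eqP; apply: contraTT rL => Fj; rewrite -leNgt -jr; exact: bL.
pose rho := Num.sqrt (L ^+ 2 - base r).
have rho0 : 0 <= rho by exact: sqrtr_ge0.
have rhoE : L ^+ 2 - base r = rho ^+ 2 by rewrite sqr_sqrtr// subr_ge0.
have sq (x : R) : (x ^+ 2 + base r <= L ^+ 2) = (- rho <= x <= rho).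
  by rewrite -lerBrDr rhoE -ler_norml -(real_normK (num_real x)) ler_pXn2r ?nnegrE.
pose tr := [seq j <- t | (line_base i j == r) && (F j != 0)].
have utr : uniq tr by exact: filter_uniq.
have inj : {in tr &, injective (fun j : 'rV[int]_n.+1 => j ord0 i)}.
  move=> j k; rewrite !mem_filter => /andP[/andP[/eqP jr _] _] /andP[/andP[/eqP kr _] _].
  by move=> jk; apply: (line_baseP jk); rewrite jr kr.
pose I1 (j : 'rV[int]_n.+1) := rho - s <= z j <= rho.
have zI j : j \in tr -> I1 j || (- rho - s <= z j <= - rho).
  rewrite mem_filter => /andP[/andP[/eqP jr Fj] _].
  move: Fj; rewrite FE jr !sq /I1.
  have [a1|a1] := boolP (- rho <= z j <= rho);
    have [a2|a2] := boolP (- rho <= z j + s <= rho); rewrite ?subrr ?expr0n ?eqxx//= => _.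
    move: a1 a2; rewrite negb_and -!ltNge => /andP[? ?] /orP[?|?].
      by lra.
    by apply/orP; left; apply/andP; split; lra.
  move: a2 a1; rewrite negb_and -!ltNge => /andP[? ?] /orP[?|?].
    by apply/orP; right; apply/andP; split; lra.
  lra.
have -> : \sum_(j <- t | line_base i j == r) F j = (size tr)%:R.
  rewrite -sum1_size natr_sum big_filter big_mkcond [RHS]big_mkcond/=.
  apply: eq_bigr => j _; case: (_ == r) => //=.
  by rewrite {1}F01; case: (_ != 0).
have -> : size tr = (size [seq j <- tr | I1 j] + size [seq j <- tr | ~~ I1 j])%N.
  by rewrite (size_filter I1) (size_filter (predC I1)) count_predC.
rewrite natrD mulrDl mul1r; apply: lerD.
  rewrite -(size_map (fun j : 'rV[int]_n.+1 => j ord0 i)).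
  have -> : s + 1 = (rho - y ord0 i) - (rho - s - y ord0 i) + 1 by ring.
  apply: size_int_itv.
  - rewrite map_inj_in_uniq ?filter_uniq// => j k.
    by rewrite (mem_filter _ _ tr) [in X in _ -> X -> _](mem_filter _ _ tr) =>
      /andP[_ ?] /andP[_ ?]; exact: inj.
  - lra.
  - move=> x /mapP[j + ->]; rewrite (mem_filter _ _ tr) => /andP[/andP[]].
    by rewrite /z => ? ? _; apply/andP; split; lra.
rewrite -(size_map (fun j : 'rV[int]_n.+1 => j ord0 i)).
have -> : s + 1 = (- rho - y ord0 i) - (- rho - s - y ord0 i) + 1 by ring.
apply: size_int_itv.
- rewrite map_inj_in_uniq ?filter_uniq// => j k.
  by rewrite (mem_filter _ _ tr) [in X in _ -> X -> _](mem_filter _ _ tr) =>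
    /andP[_ ?] /andP[_ ?]; exact: inj.
- lra.
- move=> x /mapP[j + ->]; rewrite (mem_filter _ _ tr) => /andP[/negbTE nI jtr].
  have := zI j jtr; rewrite nI /= /z => /andP[? ?]; apply/andP; split; lra.
Qed.

End lines.

Section tame_functions.
Variables (R : realType) (n : nat).
Implicit Types f g : 'rV[R]_n -> R.

(** A class of integrands closed under the ring operations, for which all integrals over the cube
    are finite. Boundedness is asked on the cube only, so that the norm belongs to it. *)
Definition tame f := measurable_fun setT f /\
  exists M, forall xi, cube xi -> `|f xi| <= M.

Definition cube_integral f : R := (\int[lebesgue_row R n]_(xi in cube) f xi)%R.

Lemma tame_integrable f : tame f ->
  (lebesgue_row R n).-integrable cube (EFin \o f).
Proof.
move=> [mf [M fM]]; apply: measurable_bounded_integrable.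
- exact: measurable_cube.
- exact: lebesgue_cube_fin.
- exact: measurable_funTS.
- by exists M; split=> //= r Mr x cx /=; rewrite (le_trans (fM x cx))// ltW.
Qed.

Lemma bounded_tame f M : measurable_fun setT f -> (forall xi, `|f xi| <= M) -> tame f.
Proof. by move=> mf fM; split => //; exists M => xi _. Qed.

Lemma tameD f g : tame f -> tame g -> tame (fun xi => f xi + g xi).
Proof.
move=> [mf [M fM]] [mg [N gN]]; split; first exact: measurable_funD.
by exists (M + N) => xi c; rewrite (le_trans (ler_normD _ _))// lerD ?fM ?gN.
Qed.

Lemma tameM f g : tame f -> tame g -> tame (fun xi => f xi * g xi).
Proof.
move=> [mf [M fM]] [mg [N gN]]; split; first exact: measurable_funM.
by exists (M * N) => xi c; rewrite normrM ler_pM ?fM ?gN.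
Qed.

Lemma tame_cst (r : R) : tame (fun=> r).
Proof. by apply: (@bounded_tame _ `|r|). Qed.

Lemma tameN f : tame f -> tame (fun xi => - f xi).
Proof.
by move=> tf; under eq_fun do rewrite -mulN1r; exact: tameM (tame_cst (-1)) tf.
Qed.

Lemma tameB f g : tame f -> tame g -> tame (fun xi => f xi - g xi).
Proof. by move=> tf tg; apply: tameD => //; exact: tameN. Qed.

Lemma tameX f k : tame f -> tame (fun xi => f xi ^+ k).
Proof.
move=> tf; elim: k => [|k IH].
  by under eq_fun do rewrite expr0; exact: tame_cst.
by under eq_fun do rewrite exprS; exact: tameM.
Qed.

Lemma tame_sum (I : Type) (r : seq I) (F : I -> 'rV[R]_n -> R) :
  (forall i, tame (F i)) -> tame (fun xi => \sum_(i <- r) F i xi).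
Proof.
move=> tF; elim: r => [|i r IH].
  by under eq_fun do rewrite big_nil; exact: tame_cst.
by under eq_fun do rewrite big_cons; exact: tameD.
Qed.

Lemma tame_indic (A : set 'rV[R]_n) : measurable A -> tame (\1_A).
Proof.
move=> mA; apply: (@bounded_tame _ 1); first exact: measurable_indic.
by move=> xi; rewrite indicE; case: (_ \in _); rewrite ?normr0 ?normr1.
Qed.

Lemma tame_enorm : tame (@enorm R n).
Proof.
split; first exact: measurable_enorm.
exists (\sum_(i < n) pi) => xi c; rewrite ger0_norm ?enorm_ge0//.
apply: (le_trans (enorm_le_sum xi)); apply: ler_sum => i _.
by rewrite ler_norml; exact: c.
Qed.

Lemma tame_cos f : measurable_fun setT f -> tame (fun xi => cos (f xi)).
Proof.
by move=> mf; apply: (@bounded_tame _ 1) => [|xi]; [exact: measurable_cosf|exact: cos_max].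
Qed.

Lemma tame_tpow s a : tame (tpow s a).
Proof.
apply: (@bounded_tame _ _ (measurable_tpow s a)) => xi.
by rewrite ger0_norm ?tpow_ge0//; exact: tpow_le.
Qed.

Lemma le_cube_integral f g : tame f -> tame g ->
  (forall xi, cube xi -> f xi <= g xi) -> cube_integral f <= cube_integral g.
Proof.
by move=> tf tg fg; apply: le_Rintegral fg;
  [exact: measurable_cube|exact: tame_integrable|exact: tame_integrable].
Qed.

Lemma cube_integral_ge0 f : (forall xi, cube xi -> 0 <= f xi) -> 0 <= cube_integral f.
Proof. by move=> f0; apply: Rintegral_ge0. Qed.

Lemma cube_integralD f g : tame f -> tame g ->
  cube_integral (fun xi => f xi + g xi) = cube_integral f + cube_integral g.
Proof.
by move=> tf tg; apply: RintegralD;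
  [exact: measurable_cube|exact: tame_integrable|exact: tame_integrable].
Qed.

Lemma cube_integralZ r f : tame f ->
  cube_integral (fun xi => r * f xi) = r * cube_integral f.
Proof.
by move=> tf; apply: RintegralZl; [exact: measurable_cube|exact: tame_integrable].
Qed.

Lemma cube_integral_sum (I : eqType) (r : seq I) (F : I -> 'rV[R]_n -> R) :
  (forall i, tame (F i)) ->
  cube_integral (fun xi => \sum_(i <- r) F i xi) = \sum_(i <- r) cube_integral (F i).
Proof.
by move=> tF; apply: Rintegral_sum => [|i]; [exact: measurable_cube|exact: tame_integrable].
Qed.

Lemma cube_integral_EFin f : tame f ->
  (\int[lebesgue_row R n]_(xi in cube) (f xi)%:E = (cube_integral f)%:E)%E.
Proof.
move=> tf; rewrite /cube_integral /Rintegral fineK//.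
by apply: integrable_fin_num; [exact: measurable_cube|exact: tame_integrable].
Qed.

Lemma cube_integral_indic (A : set 'rV[R]_n) f : measurable A -> A `<=` cube -> tame f ->
  (\int[lebesgue_row R n]_(xi in A) (f xi)%:E = (cube_integral (fun xi => \1_A xi * f xi))%:E)%E.
Proof.
move=> mA Ac tf; rewrite -cube_integral_EFin; last by apply: tameM => //; exact: tame_indic.
rewrite -{1}(setIidr Ac) integral_mkcondr; apply: eq_integral => x _.
by rewrite patchE indicE; case: (x \in A); rewrite ?mul1r ?mul0r.
Qed.

End tame_functions.

(** * Shifts and mass distribution of the lattice ball in frequency *)

Section ball_power.
Variables (R : realType) (n : nat).
Implicit Types (L t : R) (h : nat) (i : 'I_n.+1).

Definition bpow L : 'rV[R]_n.+1 -> R := tpow (ball_pts n.+1 L) (fun=> 1).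

Let shiftv h i : 'rV[int]_n.+1 := h%:Z *: delta_mx ord0 i.

Let lattice_shiftv h i : lattice_pt R (shiftv h i) = h%:R *: delta_mx ord0 i.
Proof.
apply/rowP => k; rewrite !mxE; case: (_ && _) => /=.
  by rewrite !mulr1 pmulrn.
by rewrite !mulr0.
Qed.

Let phase_shiftv h i (xi : 'rV[R]_n.+1) : phase xi (shiftv h i) = h%:R * xi ord0 i.
Proof.
rewrite /phase lattice_shiftv dotpZr; congr (_ * _).
rewrite /dotp (bigD1 i)//= mxE !eqxx mulr1 big1 ?addr0// => k ki.
by rewrite mxE (negbTE ki) andbF mulr0.
Qed.

(** This is |exp (i h xi_i) - 1|^2, the factor brought by a shift by h along the axis i. *)
Definition modulus h i (xi : 'rV[R]_n.+1) : R := 2 - 2 * cos (h%:R * xi ord0 i).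

Lemma modulus_ge0 h i xi : 0 <= modulus h i xi.
Proof. by rewrite /modulus; have := cos_le1 (h%:R * xi ord0 i); lra. Qed.

Lemma tame_modulus h i : tame (modulus h i).
Proof.
apply: tameB; first exact: tame_cst.
apply: tameM; first exact: tame_cst.
apply: tame_cos; apply: measurable_funM => //; exact: measurable_coord.
Qed.

Lemma tame_bpow L : tame (bpow L). Proof. exact: tame_tpow. Qed.

Lemma bpow_ge0 L xi : 0 <= bpow L xi. Proof. exact: tpow_ge0. Qed.

Let symdiff L h i (t : seq 'rV[int]_n.+1) : R :=
  \sum_(j <- t) ((j \in map (fun j => j + shiftv h i) (ball_pts n.+1 L))%:R -
                 (j \in ball_pts n.+1 L)%:R) ^+ 2.

Let shift_integral L h i (t : seq 'rV[int]_n.+1) : uniq t ->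
  {subset ball_pts n.+1 L <= t} ->
  {subset map (fun j => j + shiftv h i) (ball_pts n.+1 L) <= t} ->
  cube_integral (fun xi => modulus h i xi * bpow L xi) =
  (2 * pi) ^+ n.+1 * symdiff L h i t.
Proof.
move=> ut st svt; have := @parseval_shift R n.+1 _ _ (shiftv h i)
  (ball_pts_uniq n.+1 L) ut st svt.
rewrite /cube_integral /symdiff => <-; apply: eq_Rintegral => xi _.
by rewrite /modulus phase_shiftv.
Qed.

Let mem_shift L (v j : 'rV[int]_n.+1) :
  (j \in map (fun j => j + v) (ball_pts n.+1 L)) = (enorm (lattice_pt R (j - v)) <= L).
Proof.
rewrite -mem_ball_pts; apply/mapP/idP => [[k kb ->]|jb]; first by rewrite addrK.
by exists (j - v) => //; rewrite subrK.
Qed.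

(** By Parseval the integral counts the symmetric difference of the ball and its shift, a case of
    [count_ball_shift] with y = 0. The 5 comes from 2 L + 3 <= 5 L. *)
Lemma shift_bpow_le L h i : 1 <= L ->
  cube_integral (fun xi => modulus h i xi * bpow L xi) <=
  (2 * pi) ^+ n.+1 * (2 * 5 ^+ n) * (h%:R + 1) * L ^+ n.
Proof.
move=> L1; pose v := shiftv h i; pose s := ball_pts n.+1 L.
pose t := undup (s ++ map (fun j => j + v) s).
rewrite (@shift_integral L h i t) ?undup_uniq//; first last.
- by move=> j js; rewrite mem_undup mem_cat js orbT.
- by move=> j js; rewrite mem_undup mem_cat js.
rewrite -!mulrA ler_wpM2l ?exprn_ge0 ?mulr_ge0 ?pi_ge0//.
have := @count_ball_shift R n L h%:R 0 i (map (fun j => j - v) t)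
  (le_trans ler01 L1) (ler0n _ _) _ _.
rewrite big_map => H.
apply: (@le_trans _ _ (2 * (h%:R + 1) * (2 * L + 3) ^+ n)); last first.
  rewrite [leRHS](_ : _ = 2 * (h%:R + 1) * (5 * L) ^+ n); last by rewrite exprMn; ring.
  rewrite ler_wpM2l ?mulr_ge0 ?addr_ge0// lerXn2r ?nnegrE; lra.
apply: le_trans (H _ _); last 2 first.
- by move=> k; rewrite mxE normr0.
- by rewrite map_inj_uniq ?undup_uniq//; exact: addIr.
rewrite le_eqVlt; apply/orP; left; apply/eqP; apply: eq_bigr => j _.
rewrite mem_shift mem_ball_pts -sqrrN opprB /ball_ind addr0 -lattice_shiftv.
by rewrite -lattice_ptD -/v subrK -sqrrN opprB.
Qed.

(* Count the top h points of every lattice line close enough to the axis. *)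
Lemma shift_bpow_ge L h : (1 <= h)%N -> h%:R <= L / 2 ->
  (2 * pi) ^+ n.+1 / (2 * n.+1%:R) ^+ n * h%:R * L ^+ n <=
  cube_integral (fun xi => modulus h ord0 xi * bpow L xi).
Proof.
move=> h1 hL; pose v := shiftv h ord0; pose s := ball_pts n.+1 L.
have L0 : 0 <= L by have : 0 <= h%:R :> R by []; lra.
(* Bases with coordinates at most m have norm at most L / 2, so the half-chord above them is at
   least L / 2 >= h and its top h points lie above the centre. *)
pose m := Num.Def.trunc (L / (2 * n.+1%:R)).
have d0 : 0 < 2 * n.+1%:R :> R by rewrite mulr_gt0.
have mL : m%:R <= L / (2 * n.+1%:R) by rewrite /m truncn_le// divr_ge0 ?(ltW d0).
have Lm : L / (2 * n.+1%:R) < m.+1%:R by exact: truncnS_gt.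
pose base (r : 'rV[int]_n) : R := enorm (lattice_pt R r).
have base_le r : r \in lbox n m -> base r <= L / 2.
  rewrite mem_lbox => /forallP rm; apply: (le_trans (enorm_le_sum _)).
  apply: (@le_trans _ _ (\sum_(k < n) m%:R)).
    apply: ler_sum => k _; rewrite mxE ler_norml.
    by rewrite [m%:R]pmulrn -mulrNz !ler_int; exact: rm.
  rewrite sumr_const card_ord -[leLHS]mulr_natl.
  apply: (@le_trans _ _ (n.+1%:R * (L / (2 * n.+1%:R)))).
    by apply: ler_pM => //; rewrite ler_nat.
  have e (a : R) : a != 0 -> a * (L / (2 * a)) = L / 2 by move=> a0; field.
  by rewrite e ?pnatr_eq0.
pose rho (r : 'rV[int]_n) : R := Num.sqrt (L ^+ 2 - base r ^+ 2).
pose N r : int := Num.floor (rho r).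
have rho_ge r : r \in lbox n m -> L / 2 <= rho r.
  move=> /base_le br; rewrite -[L / 2]ger0_norm ?divr_ge0// -sqrtr_sqr.
  apply: ler_wsqrtr; have : base r ^+ 2 <= (L / 2) ^+ 2.
    by rewrite ler_pXn2r// nnegrE ?enorm_ge0// divr_ge0.
  rewrite (_ : (L / 2) ^+ 2 = L ^+ 2 / 4); last by field.
  by have := sqr_ge0 L; lra.
pose pt (r : 'rV[int]_n) (q : nat) : 'rV[int]_n.+1 :=
  \row_k oapp (r ord0) (N r - q%:Z) (unlift ord0 k).
have pt0 r q : (pt r q) ord0 ord0 = N r - q%:Z by rewrite mxE unlift_none.
have ptb r q : line_base ord0 (pt r q) = r.
  by apply/rowP => k; rewrite !mxE liftK.
have ptE r q (z : int) : enorm (lattice_pt R (pt r q + z *: delta_mx ord0 ord0)) ^+ 2 =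
    ((N r - q%:Z + z)%:~R) ^+ 2 + base r ^+ 2.
  rewrite (sqr_enorm_line ord0) /base; congr (_ + _).
    by congr (_ ^+ 2); rewrite mxE mxE pt0 !mxE !eqxx mulr1.
  congr (enorm _ ^+ 2); apply/rowP => k; rewrite !mxE liftK.
  by rewrite eq_sym (negbTE (neq_lift _ _)) mulr0 addr0.
have inb r (z : int) : r \in lbox n m -> `|z%:~R| <= rho r ->
    z%:~R ^+ 2 + base r ^+ 2 <= L ^+ 2.
  move=> /base_le br; rewrite -lerBrDr => zr.
  rewrite -[leRHS]sqr_sqrtr -/(rho r).
    by rewrite -real_normK ?num_real// ler_pXn2r// nnegrE ?sqrtr_ge0.
  rewrite subr_ge0 ler_pXn2r// ?nnegrE ?enorm_ge0//; lra.
have inball r q : r \in lbox n m -> q \in iota 0 h -> enorm (lattice_pt R (pt r q)) <= L.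
  move=> rm qh.
  rewrite -(@ler_pXn2r _ 2)// ?nnegrE ?enorm_ge0//.
  rewrite -[pt r q]addr0 -(scale0r (delta_mx ord0 ord0)) ptE addr0; apply: inb => //.
  have Nle : (N r)%:~R <= rho r by apply: floor_le.
  have Nge : rho r < (N r)%:~R + 1 by have /andP[_] := floor_itv (rho r); rewrite mulrzDr.
  have := rho_ge r rm; move: qh; rewrite mem_iota add0n /= => qh.
  have : (q%:R : R) + 1 <= h%:R by rewrite natr1 ler_nat.
  have : 0 <= q%:R :> R by [].
  rewrite mulrzDr mulrNz -pmulrn ler_norml => ? ? ?.
  by apply/andP; split; lra.
pose u := [seq pt r q | r <- lbox n m, q <- iota 0 h].
have uu : uniq u.
  apply: allpairs_uniq; [exact: lbox_uniq|exact: iota_uniq|].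
  move=> [r q] [r' q'] _ _ /= e.
  have e1 : r = r' by rewrite -(ptb r q) e ptb.
  have := congr1 (fun x : 'rV[int]_n.+1 => x ord0 ord0) e; rewrite !pt0 e1.
  by move=> /addrI/oppr_inj [->].
pose t := undup (u ++ s ++ map (fun j => j + v) s).
rewrite (@shift_integral L h ord0 t) ?undup_uniq//; first last.
- by move=> j js; rewrite mem_undup !mem_cat js !orbT.
- by move=> j js; rewrite mem_undup !mem_cat js orbT.
rewrite -!mulrA ler_wpM2l ?exprn_ge0 ?mulr_ge0 ?pi_ge0//.
pose tu := map (fun j => j + v) u.
apply: (@le_trans _ _ (size u)%:R).
  rewrite /u size_allpairs size_iota size_lbox natrM natrX.
  rewrite mulrCA [_^-1 * _]mulrC -expr_div_n [leRHS]mulrC.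
  rewrite ler_wpM2l// lerXn2r ?nnegrE ?divr_ge0 ?(ltW d0)//.
  by rewrite (le_trans (ltW Lm))// ler_nat ltnS -addnn leq_addr.
have utu : uniq tu by rewrite map_inj_uniq//; exact: addIr.
rewrite /symdiff.
have tut : {subset tu <= t}.
  move=> j /mapP[k /allpairsP[[r q]/= [rm qh ->]] ->].
  rewrite mem_undup !mem_cat mem_shift addrK.
  by rewrite inball// !orbT.
rewrite -(size_map (fun j => j + v) u) -/tu -sum1_size natr_sum.
rewrite -(sum_indicator (fun=> 1 : R) utu (undup_uniq _) tut).
rewrite big_mkcond/=; apply: ler_sum => j _; case: ifPn => [|_]; last exact: sqr_ge0.
move=> /mapP[k /allpairsP[[r q]/= [rm qh ->]] ->].
rewrite mem_shift addrK mem_ball_pts.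
rewrite inball//.
(* Raised by h > q, the point has height at least N r + 1 > rho r and leaves the ball. *)
suff -> : (enorm (lattice_pt R (pt r q + v)) <= L) = false by rewrite subr0 expr1n.
apply/negbTE; rewrite -ltNge -(@ltr_pXn2r _ 2)// ?nnegrE ?enorm_ge0//.
rewrite ptE; have Nge : rho r < (N r)%:~R + 1.
  by have /andP[_] := floor_itv (rho r); rewrite mulrzDr.
have r0 : 0 <= rho r by exact: sqrtr_ge0.
move: qh; rewrite mem_iota add0n /= => qh.
have qh' : (q%:R : R) + 1 <= h%:R by rewrite natr1 ler_nat.
rewrite -ltrBlDr -[ltLHS]sqr_sqrtr -/(rho r).
  rewrite ltr_pXn2r ?nnegrE//; rewrite !mulrzDr mulrNz -!pmulrn; lra.
rewrite subr_ge0 ler_pXn2r ?nnegrE ?enorm_ge0//.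
by have := base_le r rm; lra.
Qed.

End ball_power.

Section power_estimates.
Variables (R : realType) (n : nat).
Implicit Types (L t : R).

Definition far t : set 'rV[R]_n.+1 := [set xi | t < enorm xi].

Lemma measurable_far t : measurable (far t).
Proof.
rewrite (_ : far t = @enorm R n.+1 @^-1` `]t, +oo[%classic).
  by apply: measurable_preim => //; exact: measurable_enorm.
by apply/seteqP; split => x /=; rewrite in_itv/= andbT.
Qed.

Let C1 : R := (2 * pi) ^+ n.+1 * (2 * 5 ^+ n).
Let c2 : R := (2 * pi) ^+ n.+1 / (2 * n.+1%:R) ^+ n.

Let C1_gt0 : 0 < C1.
Proof. by rewrite !mulr_gt0 ?exprn_gt0// mulr_gt0// pi_gt0. Qed.

Let c2_gt0 : 0 < c2.
Proof. by rewrite divr_gt0// exprn_gt0// mulr_gt0// ?pi_gt0// ltr0n. Qed.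

Let tame_mb L h (i : 'I_n.+1) : tame (fun xi : 'rV[R]_n.+1 => modulus h i xi * bpow L xi).
Proof. by apply: tameM; [exact: tame_modulus|exact: tame_bpow]. Qed.

(** There are n + 1 axes, each shift costs [C1] times its length plus one, and the H shifts in use
    satisfy H + 1 <= (12 (n + 1) + 2) / t. *)
Definition tail_const : R := n.+1%:R * C1 * (12 * n.+1%:R + 2).

Lemma tail_const_gt0 : 0 < tail_const.
Proof.
apply: mulr_gt0; first by apply: mulr_gt0 => //; rewrite ltr0n.
by apply: ltr_wpDl => //; rewrite mulr_ge0.
Qed.

(* Some coordinate of a far point is large, and the moduli of the first H shifts
   along it average to at least 1. *)
Lemma bpow_tail L t : 1 <= L -> 0 < t <= 1 ->
  cube_integral (fun xi : 'rV[R]_n.+1 => \1_(far t) xi * bpow L xi) <= tail_const * L ^+ n / t.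
Proof.
move=> L1 /andP[t0 t1]; pose N : R := n.+1%:R; have N0 : 0 < N by rewrite ltr0n.
(* A far point has a coordinate of size at least t / N, and this H makes H |xi_i| >= 12, as the
   Dirichlet bound requires. *)
pose H := (Num.Def.trunc (12 * N / t)).+1.
have H12 : 12 * N / t < H%:R by exact: truncnS_gt.
have Hle : H%:R + 1 <= (12 * N + 2) / t.
  have : (Num.Def.trunc (12 * N / t))%:R <= 12 * N / t.
    by rewrite truncn_le// divr_ge0 ?mulr_ge0// ltW.
  have : 1 <= t^-1 by rewrite invf_ge1.
  by rewrite /H -natr1 mulrDl; lra.
have H0 : 0 < H%:R :> R by rewrite ltr0n.
pose D xi : R := \sum_(i < n.+1) \sum_(1 <= h < H.+1) modulus h i xi.
have tD : tame D.
  by apply: tame_sum => i; apply: tame_sum => h; exact: tame_modulus.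
have tfar : tame (\1_(far t)) by apply: tame_indic; exact: measurable_far.
have pointwise xi : cube xi -> H%:R * \1_(far t) xi <= D xi.
  move=> cxi; rewrite indicE; have [|_] := boolP (xi \in far t); last first.
    rewrite mulr0; apply: sumr_ge0 => i _; apply: sumr_ge0 => h _.
    exact: modulus_ge0.
  rewrite inE mulr1 /far/= => txi.
  have [i ti] : exists i, t / N <= `|xi ord0 i|.
    apply/not_existsP => h; move: txi; rewrite ltNge => /negP; apply.
    apply: (le_trans (enorm_le_sum xi)).
    apply: (@le_trans _ _ (\sum_(i < n.+1) t / N)).
      by apply: ler_sum => i _; have /negP := h i; rewrite -ltNge => /ltW.
    by rewrite sumr_const card_ord -[leLHS]mulr_natl mulrC divfK// gt_eqF.
  rewrite /D (bigD1 i)//= -[leLHS]addr0; apply: lerD; last first.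
    by apply: sumr_ge0 => k _; apply: sumr_ge0 => h _; exact: modulus_ge0.
  have xpi : `|xi ord0 i| <= pi by rewrite ler_norml; exact: cxi.
  have : 12 <= H%:R * `|xi ord0 i|.
    apply: (@le_trans _ _ (12 * N / t * (t / N))).
      by rewrite mulrA divfK ?gt_eqF// mulfK// gt_eqF.
    by apply: ler_pM => //; [rewrite divr_ge0 ?mulr_ge0// ltW|rewrite divr_ge0 ?(ltW t0)//|exact: ltW].
  move=> /(sum_one_sub_cos_ge xpi) h.
  rewrite (eq_bigr (fun h => 2 * (1 - cos (h%:R * xi ord0 i)))); last first.
    by move=> k _; rewrite /modulus; ring.
  by rewrite -mulr_sumr mulrC -ler_pdivrMr.
have : H%:R * cube_integral (fun xi : 'rV[R]_n.+1 => \1_(far t) xi * bpow L xi) <=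
    cube_integral (fun xi => D xi * bpow L xi).
  rewrite -cube_integralZ; last by apply: tameM => //; exact: tame_bpow.
  apply: le_cube_integral.
  - by apply: tameM; [exact: tame_cst|apply: tameM => //; exact: tame_bpow].
  - by apply: tameM => //; exact: tame_bpow.
  - by move=> xi cxi; rewrite mulrA ler_wpM2r ?bpow_ge0// pointwise.
have -> : cube_integral (fun xi => D xi * bpow L xi) =
    \sum_(i < n.+1) \sum_(1 <= h < H.+1)
      cube_integral (fun xi : 'rV[R]_n.+1 => modulus h i xi * bpow L xi).
  rewrite (_ : (fun xi => D xi * bpow L xi) =
    (fun xi => \sum_(i < n.+1) \sum_(1 <= h < H.+1) modulus h i xi * bpow L xi)).
    rewrite cube_integral_sum => [|i]; last by apply: tame_sum => h; exact: tame_mb.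
    by apply: eq_bigr => i _; rewrite cube_integral_sum => [//|h]; exact: tame_mb.
  apply/funext => xi; rewrite /D mulr_suml; apply: eq_bigr => i _.
  by rewrite mulr_suml.
move=> h1; have : \sum_(i < n.+1) \sum_(1 <= h < H.+1)
      cube_integral (fun xi : 'rV[R]_n.+1 => modulus h i xi * bpow L xi) <=
    \sum_(i < n.+1) \sum_(1 <= h < H.+1) C1 * (H%:R + 1) * L ^+ n.
  apply: ler_sum => i _; apply: ler_sum_nat => h /andP[_ hH].
  apply: (le_trans (shift_bpow_le h i L1)); rewrite -/C1.
  apply: ler_wpM2r; first by rewrite exprn_ge0// (le_trans _ L1).
  by rewrite ler_wpM2l ?(ltW C1_gt0)// lerD2r ler_nat.
rewrite sumr_const_nat subn1/= sumr_const card_ord => h2.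
have := le_trans h1 h2.
rewrite -mulrnA -[leRHS]mulr_natr natrM => h3.
have {h3} : cube_integral (fun xi : 'rV[R]_n.+1 => \1_(far t) xi * bpow L xi) <= N * (C1 * L ^+ n * (H%:R + 1)).
  rewrite -(ler_pM2l H0); apply: (le_trans h3).
  by rewrite le_eqVlt; apply/orP; left; apply/eqP; rewrite /N; ring.
move=> /le_trans; apply.
rewrite /tail_const -/N.
have -> : N * (C1 * L ^+ n * (H%:R + 1)) = N * C1 * L ^+ n * (H%:R + 1) by ring.
have -> : N * C1 * (12 * N + 2) * L ^+ n / t =
  N * C1 * L ^+ n * ((12 * N + 2) / t) by ring.
apply: ler_wpM2l Hle; apply: mulr_ge0; first by rewrite mulr_ge0// ltW.
by rewrite exprn_ge0// (le_trans _ L1).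
Qed.

Definition quad_const : R := 16 * n.+1%:R * C1.

Definition quad_bpow L t : R :=
  cube_integral (fun xi : 'rV[R]_n.+1 => \1_(pball t) xi * (enorm xi ^+ 2 * bpow L xi)).

Let tame_quad L : tame (fun xi : 'rV[R]_n.+1 => enorm xi ^+ 2 * bpow L xi).
Proof. by apply: tameM; [apply: tameX; exact: tame_enorm|exact: tame_bpow]. Qed.

Let tame_pball t : tame (\1_(pball t) : 'rV[R]_n.+1 -> R).
Proof. by apply: tame_indic; exact: measurable_pball. Qed.

(** Take h about 1 / t. On the ball of radius t the phases h xi_i are at most 1, so the modulus is
    at least (h xi_i)^2 / 4; summed over the axes this is h^2 |xi|^2 / 4, while the shifts cost a
    multiple of h L^n. *)
Lemma quad_bpow_le L t : 1 <= L -> 0 < t <= 1 -> quad_bpow L t <= quad_const * t * L ^+ n.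
Proof.
move=> L1 /andP[t0 t1]; pose N : R := n.+1%:R; have N0 : 0 < N by rewrite ltr0n.
have Ln : 0 <= L ^+ n by rewrite exprn_ge0// (le_trans _ L1).
pose h := Num.Def.trunc t^-1.
have h1 : (1 <= h)%N by rewrite /h truncn_gt0 invf_ge1.
have h1R : 1 <= h%:R :> R by rewrite ler1n.
have ht : h%:R <= t^-1 by rewrite /h truncn_le// invr_ge0 ltW.
have th : t^-1 < h%:R + 1 by rewrite natr1; exact: truncnS_gt.
have pointwise xi : cube xi -> h%:R ^+ 2 / 4 * (\1_(pball t) xi * enorm xi ^+ 2) <=
    \sum_(i < n.+1) modulus h i xi.
  move=> _; rewrite indicE; have [|_] := boolP (xi \in pball t); last first.
    by rewrite mul0r mulr0; apply: sumr_ge0 => i _; exact: modulus_ge0.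
  rewrite inE mul1r => /andP[_ xit]; rewrite sqr_enorm mulr_sumr.
  apply: ler_sum => i _; rewrite /modulus.
  have : `|h%:R * xi ord0 i| <= 1.
    rewrite normrM ger0_norm// -[leRHS](@mulVf _ t) ?gt_eqF//.
    apply: ler_pM => //; apply: le_trans xit; exact: coord_le_enorm.
  move=> /one_sub_cos_ge; rewrite exprMn.
  move: (cos _) (xi ord0 i ^+ 2) (h%:R ^+ 2) => a b c; lra.
have : h%:R ^+ 2 / 4 * quad_bpow L t <=
    cube_integral (fun xi => \sum_(i < n.+1) modulus h i xi * bpow L xi).
  rewrite -cube_integralZ; last exact: tameM.
  apply: le_cube_integral.
  - by apply: tameM; [exact: tame_cst|exact: tameM].
  - by apply: tame_sum => i; exact: tame_mb.
  - move=> xi cxi; rewrite -mulr_suml !mulrA ler_wpM2r ?bpow_ge0//.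
    by have := pointwise xi cxi; rewrite !mulrA.
rewrite cube_integral_sum => [|i]; last exact: tame_mb.
move=> H1; have H2 : \sum_(i < n.+1) cube_integral (fun xi : 'rV[R]_n.+1 => modulus h i xi * bpow L xi) <=
    N * (C1 * (h%:R + 1) * L ^+ n).
  have -> : N * (C1 * (h%:R + 1) * L ^+ n) = \sum_(i < n.+1) C1 * (h%:R + 1) * L ^+ n.
    by rewrite sumr_const card_ord mulr_natl.
  by apply: ler_sum => i _; exact: shift_bpow_le.
have := le_trans H1 H2; rewrite /quad_const -/N.
move: (quad_bpow L t) (L ^+ n) Ln (C1) C1_gt0 => q l l0 c c0 H3.
have hh : h%:R + 1 <= 2 * (h%:R : R) by lra.
have H4 : h%:R ^+ 2 / 4 * q <= N * (c * (2 * h%:R) * l).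
  apply: (le_trans H3); rewrite ler_wpM2l ?(ltW N0)// ler_wpM2r//.
  by rewrite ler_wpM2l// ltW.
have hp : 0 < h%:R :> R by lra.
have H5 : h%:R * q <= 8 * N * c * l.
  rewrite -(ler_pM2l hp) mulrA -expr2.
  have -> : h%:R ^+ 2 * q = 4 * (h%:R ^+ 2 / 4 * q) by field.
  have -> : h%:R * (8 * N * c * l) = 4 * (N * (c * (2 * h%:R) * l)) by ring.
  by rewrite ler_pM2l.
have H6 : 1 <= 2 * t * h%:R.
  have th2 : t^-1 <= 2 * h%:R by lra.
  by have := ler_wpM2l (ltW t0) th2; rewrite mulfV ?gt_eqF//; lra.
have H7 : 0 <= 8 * N * c * l by rewrite !mulr_ge0 ?(ltW N0) ?(ltW c0).
have [q0|q0] := leP q 0.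
  apply: (le_trans q0); rewrite !mulr_ge0 ?(ltW N0) ?(ltW c0) ?(ltW t0)//.
have : q <= 2 * t * h%:R * q by rewrite ler_peMl// ltW.
move=> /le_trans; apply; rewrite -mulrA.
have -> : 16 * N * c * t * l = 2 * t * (8 * N * c * l) by ring.
by rewrite ler_wpM2l// mulr_ge0// ltW.
Qed.

(** Chosen so that for h = [lower_const] / t four times the tail bound is exactly half of c2 h L^n,
    the lower bound for the shift energy. *)
Definition lower_const : R := 8 * tail_const / c2.

Lemma lower_const_gt0 : 0 < lower_const.
Proof. by rewrite divr_gt0// mulr_gt0// tail_const_gt0. Qed.

(* The modulus is at most (h |xi|)^2 on the ball and 4 outside, and for h a large
   multiple of 1/t the tail accounts for at most half of the shift energy. *)
Lemma quad_bpow_ge L t : 1 <= L -> 0 < t <= 1 -> 2 * (lower_const + 1) <= t * L ->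
  c2 / (2 * (lower_const + 1)) * t * L ^+ n <= quad_bpow L t.
Proof.
move=> L1 /andP[t0 t1] tL; have A0 := lower_const_gt0.
have Ln : 0 < L ^+ n by rewrite exprn_gt0// (lt_le_trans _ L1).
pose h := (Num.Def.trunc (lower_const / t)).+1.
have Ah : lower_const / t < h%:R by exact: truncnS_gt.
have hA : h%:R <= (lower_const + 1) / t.
  have : (Num.Def.trunc (lower_const / t))%:R <= lower_const / t.
    by rewrite truncn_le// divr_ge0// ltW.
  have : 1 <= t^-1 by rewrite invf_ge1.
  by rewrite /h -natr1 mulrDl; lra.
(* The hypothesis on t L keeps h in the range where the lower shift estimate holds. *)
have hL : h%:R <= L / 2.
  apply: (le_trans hA); rewrite ler_pdivrMr//; lra.
have := @shift_bpow_ge R n L h isT hL; rewrite -/c2 => H1.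
have tfar : tame (\1_(far t)) by apply: tame_indic; exact: measurable_far.
have tfarb : tame (fun xi : 'rV[R]_n.+1 => \1_(far t) xi * bpow L xi).
  by apply: tameM => //; exact: tame_bpow.
have tq : tame (fun xi : 'rV[R]_n.+1 => \1_(pball t) xi * (enorm xi ^+ 2 * bpow L xi)).
  exact: (tameM (tame_pball t) (tame_quad L)).
have H2 : cube_integral (fun xi : 'rV[R]_n.+1 => modulus h ord0 xi * bpow L xi) <=
    h%:R ^+ 2 * quad_bpow L t + 4 * cube_integral (fun xi : 'rV[R]_n.+1 => \1_(far t) xi * bpow L xi).
  rewrite -!cube_integralZ// -cube_integralD; last 2 first.
  - by apply: tameM => //; exact: tame_cst.
  - by apply: tameM => //; exact: tame_cst.
  apply: le_cube_integral; first exact: tame_mb.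
    apply: tameD; apply: tameM => //; exact: tame_cst.
  move=> xi _; rewrite [leRHS](_ : _ = (h%:R ^+ 2 * (\1_(pball t) xi * enorm xi ^+ 2) +
    4 * \1_(far t) xi) * bpow L xi); last by ring.
  rewrite ler_wpM2r ?bpow_ge0// !indicE.
  have [x0|] := eqVneq (enorm xi) 0.
    rewrite /modulus (enorm_eq0 x0) mxE mulr0 cos0 mulr1 subrr.
    apply: addr_ge0; last exact: mulr_ge0.
    by apply: mulr_ge0; [exact: sqr_ge0|apply: mulr_ge0 => //; exact: sqr_ge0].
  move=> x0; have xp : 0 < enorm xi by rewrite lt_neqAle eq_sym x0 enorm_ge0.
  have [xt|xt] := leP (enorm xi) t.
    have -> : (xi \in pball t) by rewrite inE; apply/andP.
    have -> : (xi \in far t) = false.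
      by apply/negbTE; rewrite notin_setE /far/= => /lt_le_trans/(_ xt); rewrite ltxx.
    rewrite mul1r mulr0 addr0 /modulus.
    have := cos_ge (h%:R * xi ord0 ord0); rewrite exprMn.
    have : h%:R ^+ 2 * xi ord0 ord0 ^+ 2 <= h%:R ^+ 2 * enorm xi ^+ 2.
      apply: ler_wpM2l; first exact: sqr_ge0.
      by apply: norm_le_sqr; rewrite [leRHS]ger0_norm ?enorm_ge0// coord_le_enorm.
    lra.
  have -> : (xi \in far t) by rewrite inE.
  have -> : (xi \in pball t) = false.
    by apply/negbTE; rewrite notin_setE => /andP[_ /(lt_le_trans xt)]; rewrite ltxx.
  by rewrite mul0r mulr0 add0r mulr1 /modulus; have := cos_geN1 (h%:R * xi ord0 ord0); lra.
have H3 := bpow_tail L1 (introT andP (conj t0 t1)).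
have h0 : 0 < h%:R :> R by rewrite ltr0n.
have H4 : 4 * (tail_const * L ^+ n / t) <= c2 * h%:R * L ^+ n / 2.
  have -> : 4 * (tail_const * L ^+ n / t) = c2 * (lower_const / t) * L ^+ n / 2.
    by rewrite /lower_const; field; rewrite !gt_eqF.
  rewrite ler_wpM2r// ler_wpM2r ?(ltW Ln)// ler_wpM2l ?(ltW c2_gt0)//.
  exact: ltW.
have H5 : c2 * h%:R * L ^+ n / 2 <= h%:R ^+ 2 * quad_bpow L t by lra.
have H6 : c2 * L ^+ n / 2 <= h%:R * quad_bpow L t.
  rewrite -(ler_pM2l h0); apply: (le_trans _ (le_trans H5 _)); last by rewrite mulrA -expr2.
  by rewrite le_eqVlt; apply/orP; left; apply/eqP; ring.
have q0 : 0 <= quad_bpow L t.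
  by apply: cube_integral_ge0 => xi _; do 2 apply: mulr_ge0 => //; rewrite ?sqr_ge0 ?bpow_ge0.
have H7 : c2 * L ^+ n / 2 <= (lower_const + 1) / t * quad_bpow L t.
  by apply: (le_trans H6); exact: ler_wpM2r.
have A1 : 0 < lower_const + 1 by lra.
have pA : 0 < t / (lower_const + 1) by rewrite divr_gt0.
have := ler_wpM2l (ltW pA) H7.
have -> : t / (lower_const + 1) * ((lower_const + 1) / t * quad_bpow L t) = quad_bpow L t.
  by field; rewrite !gt_eqF.
apply: le_trans; rewrite le_eqVlt; apply/orP; left; apply/eqP.
by field; rewrite gt_eqF.
Qed.

End power_estimates.

(** * The Fourier transform of the ball *)

Section reflections.
Variables (R : realType) (n : nat).
Implicit Types u x y : 'rV[R]_n.

(* The identity for u = 0, where the quotient is 0. *)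
Definition reflect_row u x : 'rV[R]_n := x - (2 * dotp u x / enorm u ^+ 2) *: u.

Lemma reflect_rowD u : {morph reflect_row u : x y / x + y}.
Proof. by move=> x y; apply/rowP => i; rewrite !mxE dotpDr; ring. Qed.

Lemma dotp_reflect u x y : dotp (reflect_row u x) y = dotp x (reflect_row u y).
Proof.
rewrite dotpC /reflect_row !dotpBr !dotpZr (dotpC y x) (dotpC y u) (dotpC x u).
by ring.
Qed.

Lemma reflect_rowK u : involutive (reflect_row u).
Proof.
move=> x; have [/enorm_eq0 ->|u0] := eqVneq (enorm u) 0.
  by rewrite /reflect_row !scaler0 !subr0.
rewrite {1}/reflect_row (_ : dotp u (reflect_row u x) = - dotp u x).
  by apply/rowP => i; rewrite !mxE; ring.
rewrite /reflect_row dotpBr dotpZr dotpp divfK ?expf_neq0//; ring.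
Qed.

Lemma enorm_reflect u x : enorm (reflect_row u x) = enorm x.
Proof.
apply/eqP; rewrite -(@eqrXn2 _ 2) ?enorm_ge0//.
by rewrite -!dotpp dotp_reflect reflect_rowK.
Qed.

Lemma measurable_reflect u : measurable_fun setT (reflect_row u).
Proof.
apply/measurable_fun_rowP => i.
rewrite (_ : (fun t => _) = (fun x : 'rV[R]_n => x ord0 i +
  (- u ord0 i * 2 / enorm u ^+ 2) * dotp u x)).
  apply: measurable_funD; first exact: measurable_coord.
  apply: measurable_funM => //; exact: measurable_dotp.
by apply/funext => x; rewrite !mxE; ring.
Qed.

(** For x and y of equal norm, the hyperplane orthogonal to x - y bisects them. *)
Lemma reflect_swap x y : enorm x = enorm y -> reflect_row (x - y) x = y.
Proof.
move=> xy; have [/enorm_eq0 h|u0] := eqVneq (enorm (x - y)) 0.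
  by rewrite h /reflect_row scaler0 subr0 -(subrK y x) h add0r.
have -> : reflect_row (x - y) x = x - (x - y); last by rewrite subKr.
rewrite /reflect_row; congr (_ - _).
rewrite (_ : 2 * dotp (x - y) x = enorm (x - y) ^+ 2) ?divff ?scale1r ?expf_neq0//.
by rewrite sqr_enormD enormN -xy dotpC dotpBr dotpNr dotpp; ring.
Qed.

Lemma lebesgue_reflect u (E : set 'rV[R]_n) : measurable E ->
  lebesgue_row R n (reflect_row u @^-1` E) = lebesgue_row R n E.
Proof.
move=> mE; apply: isometry_preimage_measure => //.
- exact: reflect_rowD.
- exact: reflect_rowK.
- exact: measurable_reflect.
- exact: enorm_reflect.
Qed.

End reflections.

Section ball_transform.
Variables (R : realType) (n : nat).
Implicit Types (L : R) (xi eta : 'rV[R]_n).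

(** The cosine integral is the whole Fourier transform, the ball being symmetric. *)
Definition ball_transform L xi : R :=
  (\int[lebesgue_row R n]_(x in eball L) cos (dotp xi x))%R.

Let measurable_cosdotp xi : measurable_fun setT (fun x => cos (dotp xi x)).
Proof. by apply: measurable_cosf; exact: measurable_dotp. Qed.

Lemma eball_integrable L (f : 'rV[R]_n -> R) (M : R) : 0 <= L ->
  measurable_fun setT f -> (forall x, `|f x| <= M) ->
  (lebesgue_row R n).-integrable (eball L) (EFin \o f).
Proof.
move=> L0 mf fM; apply: (bounded_integrable _ _ mf fM); first exact: measurable_eball.
by rewrite ltey_eq lebesgue_eball_fin.
Qed.

Let cos_integrable L xi : 0 <= L ->
  (lebesgue_row R n).-integrable (eball L) (EFin \o (fun x => cos (dotp xi x))).
Proof.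
by move=> L0; apply: (@eball_integrable _ _ 1) => // x; exact: cos_max.
Qed.

Let Rintegral_eball_cst (r L : R) : 0 < L ->
  (\int[lebesgue_row R n]_(x in eball L) (cst r x))%R = r * (unit_ball_volume R n * L ^+ n).
Proof.
move=> L0; rewrite Rintegral_cst; last exact: measurable_eball.
congr (_ * _); have h := @lebesgue_eball R n L L0.
by transitivity (fine (lebesgue_row R n (eball L))); rewrite // h mulrC.
Qed.

(** A reflection exchanges xi and eta while preserving the ball and Lebesgue measure. *)
Lemma ball_transform_radial L xi eta : 0 <= L -> enorm xi = enorm eta ->
  ball_transform L xi = ball_transform L eta.
Proof.
move=> L0 xieta; pose r := reflect_row (xi - eta).
have := @integral_measure_preserving _ _ _ _ _ (lebesgue_row R n) (lebesgue_row R n) r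
  (@measurable_reflect R n (xi - eta)) (@lebesgue_reflect R n (xi - eta)) (eball L)
  (fun x => (cos (dotp xi x))%:E).
have -> : r @^-1` eball L = eball L.
  by apply/seteqP; split => x; rewrite /eball/= enorm_reflect.
have e x : cos (dotp xi (r x)) = cos (dotp eta x).
  by rewrite -(dotp_reflect (xi - eta)) reflect_swap.
move=> h; rewrite /ball_transform /Rintegral -h.
- by congr fine; apply: eq_integral => x _; rewrite e.
- exact: measurable_eball.
- by apply/measurable_EFinP; exact: measurable_cosdotp.
- apply: eq_integrable (cos_integrable eta L0) => //; first exact: measurable_eball.
  by move=> x _; rewrite /= e.
Qed.

Lemma norm_ball_transform_le L xi : 0 < L ->
  `|ball_transform L xi| <= unit_ball_volume R n * L ^+ n.
Proof.
move=> L0; apply: (le_trans (le_normr_Rintegral _ (cos_integrable xi (ltW L0)))).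
  exact: measurable_eball.
apply: (@le_trans _ _ (\int[lebesgue_row R n]_(x in eball L) (cst 1 x))%R).
  apply: le_Rintegral.
  - exact: measurable_eball.
  - by apply: (@eball_integrable _ _ 1) => //; [exact: ltW|exact: measurableT_comp|
      move=> x; rewrite normr_id; exact: cos_max].
  - by apply: (@eball_integrable _ (cst 1) 1 (ltW L0)) => // x; rewrite normr1.
  - by move=> x _; exact: cos_max.
by rewrite Rintegral_eball_cst// mul1r.
Qed.

Lemma ball_transform_ge L xi : 0 < L -> enorm xi <= L^-1 ->
  unit_ball_volume R n / 2 * L ^+ n <= ball_transform L xi.
Proof.
move=> L0 xiL.
apply: (@le_trans _ _ (\int[lebesgue_row R n]_(x in eball L) (cst 2^-1 x))%R).
  by rewrite Rintegral_eball_cst// mulrAC mulrC.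
apply: le_Rintegral.
- exact: measurable_eball.
- exact: (@eball_integrable _ (cst 2^-1) `|2^-1| (ltW L0)).
- exact: cos_integrable (ltW L0).
- move=> x xL; apply: cos_ge_half; apply: (le_trans (norm_dotp_le _ _)).
  rewrite -[leRHS](@mulVf _ L) ?gt_eqF//; apply: ler_pM => //; exact: enorm_ge0.
Qed.

Lemma measurable_pair_dotp :
  measurable_fun setT (fun p : 'rV[R]_n * 'rV[R]_n => dotp p.1 p.2).
Proof.
rewrite /dotp; apply: measurable_sum => i; apply: measurable_funM.
- exact: (measurableT_comp (measurable_coord i) measurable_fst).
- exact: (measurableT_comp (measurable_coord i) measurable_snd).
Qed.

(** Tonelli gives measurability for nonnegative integrands; so 1 + cos is integrated, and the volume
    of [A] is subtracted afterwards. *)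
Lemma measurable_cos_transform (A : set 'rV[R]_n) : measurable A ->
  (lebesgue_row R n A < +oo)%E ->
  measurable_fun setT (fun xi => (\int[lebesgue_row R n]_(x in A) cos (dotp xi x))%R).
Proof.
move=> mA Aoo; pose f (p : 'rV[R]_n * 'rV[R]_n) : \bar R :=
  (\1_A p.2 * (1 + cos (dotp p.1 p.2)))%:E.
have mf : measurable_fun setT f.
  apply/measurable_EFinP; apply: measurable_funM.
    by apply: (measurableT_comp _ measurable_snd); exact: measurable_indic.
  by apply: measurable_funD => //; apply: measurable_cosf; exact: measurable_pair_dotp.
have f0 p : (0 <= f p)%E.
  rewrite lee_fin mulr_ge0//; have := cos_geN1 (dotp p.1 p.2); lra.
have intb (g : 'rV[R]_n -> R) (M : R) : measurable_fun setT g -> (forall x, `|g x| <= M) ->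
  (lebesgue_row R n).-integrable A (EFin \o g) by exact: bounded_integrable.
have i1 : (lebesgue_row R n).-integrable A (EFin \o cst 1).
  by apply: (intb (cst 1) 1) => // x; rewrite normr1.
have ic xi : (lebesgue_row R n).-integrable A (EFin \o (fun x => cos (dotp xi x))).
  by apply: (intb _ 1) => // x; exact: cos_max.
have := measurable_fun_fubini_tonelli_F (m2 := lebesgue_row R n) f mf f0.
set one : R := (\int[lebesgue_row R n]_(x in A) (cst 1 x))%R.
have -> : fubini_F (lebesgue_row R n) f =
    (fun xi => (one + (\int[lebesgue_row R n]_(x in A) cos (dotp xi x))%R)%:E).
  apply/funext => xi; rewrite /fubini_F /f /=.
  transitivity (\int[lebesgue_row R n]_(x in A) (1 + cos (dotp xi x))%:E)%E.
    rewrite [RHS]integral_mkcond; apply: eq_integral => x _.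
    by rewrite patchE indicE; case: (x \in _); rewrite ?mul1r ?mul0r.
  have m1 : measurable_fun setT (fun x : 'rV[R]_n => 1 + cos (dotp xi x)) by exact: measurable_funD.
  have b2 x : `|1 + cos (dotp xi x)| <= 2.
    by rewrite (le_trans (ler_normD _ _))// normr1 lerD2l; exact: cos_max.
  rewrite -[LHS]fineK; last by apply: integrable_fin_num => //; exact: intb m1 b2.
  by congr EFin; rewrite /one -RintegralD.
move=> /measurable_EFinP h.
rewrite (_ : (fun xi => _) =
  (fun xi => (one + (\int[lebesgue_row R n]_(x in A) cos (dotp xi x))%R) - one)).
  exact: measurable_funB.
by apply/funext => xi; ring.
Qed.

Lemma measurable_ball_transform L : 0 <= L -> measurable_fun setT (ball_transform L).
Proof.
move=> L0; apply: measurable_cos_transform; first exact: measurable_eball.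
by rewrite ltey_eq lebesgue_eball_fin.
Qed.

End ball_transform.

(** * Unit cells and the discretization error *)

Section unit_cell.
Variables (R : realType) (n : nat).
Implicit Types (L : R) (x : 'rV[R]_n).

Definition unit_cell : set 'rV[R]_n := [set x | forall i, 0 <= x ord0 i < 1].

Lemma measurable_unit_cell : measurable unit_cell.
Proof.
have -> : unit_cell = \bigcap_(i in [set: 'I_n])
    ((fun x : 'rV[R]_n => x ord0 i) @^-1` `[0, 1[%classic).
  apply/seteqP; split => x /= H i => [_|].
    by rewrite /= in_itv/=; exact: H.
  by have := H i I; rewrite /= in_itv.
apply: fin_bigcap_measurable => // i _; apply: measurable_preim => //.
exact: measurable_coord.
Qed.

Let box (r : R) : set 'rV[R]_n := [set x | forall i,
  (const_mx 0 : 'rV[R]_n) ord0 i <= x ord0 i <= (const_mx r : 'rV[R]_n) ord0 i].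

Let lebesgue_box r : 0 <= r -> lebesgue_row R n (box r) = (r ^+ n)%:E.
Proof.
move=> r0; rewrite lebesgue_row_box => [|i]; last by rewrite !mxE.
congr EFin; under eq_bigr do rewrite !mxE subr0.
by rewrite prodr_const card_ord.
Qed.

Let sub_box1 : unit_cell `<=` box 1.
Proof. by move=> x xc i; rewrite !mxE; have /andP[-> /ltW] := xc i. Qed.

(** Kept as a symbol: the half-open cell lies between closed boxes of sides 1/2 and 1, which gives 0
    < [cell_volume] <= 1. *)
Definition cell_volume : R := fine (lebesgue_row R n unit_cell).

Let cell_le1 : (lebesgue_row R n unit_cell <= 1)%E.
Proof.
have -> : 1%E = lebesgue_row R n (box 1) by rewrite lebesgue_box ?expr1n.
by apply: le_measure; rewrite ?inE//; [exact: measurable_unit_cell|exact: measurable_box].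
Qed.

Lemma lebesgue_unit_cell_fin : (lebesgue_row R n unit_cell < +oo)%E.
Proof. exact: (le_lt_trans cell_le1 (ltry 1)). Qed.

Lemma lebesgue_unit_cell : lebesgue_row R n unit_cell = cell_volume%:E.
Proof. by rewrite fineK// ge0_fin_numE// lebesgue_unit_cell_fin. Qed.

Lemma cell_volume_le1 : cell_volume <= 1.
Proof. by rewrite -lee_fin -lebesgue_unit_cell. Qed.

Lemma cell_volume_gt0 : 0 < cell_volume.
Proof.
rewrite -lte_fin -lebesgue_unit_cell.
apply: (@lt_le_trans _ _ (lebesgue_row R n (box 2^-1))).
  by rewrite lebesgue_box// lte_fin exprn_gt0.
apply: le_measure; rewrite ?inE//; [exact: measurable_box|exact: measurable_unit_cell|].
move=> x xb i; have := xb i; rewrite !mxE => /andP[-> h] /=.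
by apply: (le_lt_trans h); rewrite invf_lt1// ltr1n.
Qed.

Lemma cell_integrable (f : 'rV[R]_n -> R) (M : R) :
  measurable_fun setT f -> (forall x, `|f x| <= M) ->
  (lebesgue_row R n).-integrable unit_cell (EFin \o f).
Proof.
by apply: bounded_integrable; [exact: measurable_unit_cell|exact: lebesgue_unit_cell_fin].
Qed.

(* Integrate (f - m)^2 >= 0, m being the integral of f. *)
Lemma sqr_Rintegral_cell_le (f : 'rV[R]_n -> R) (M : R) :
  measurable_fun setT f -> (forall x, `|f x| <= M) ->
  (\int[lebesgue_row R n]_(x in unit_cell) f x)%R ^+ 2 <=
  (\int[lebesgue_row R n]_(x in unit_cell) (f x ^+ 2))%R.
Proof.
move=> mf fM; set m := (X in X ^+ 2 <= _).
have i1 : (lebesgue_row R n).-integrable unit_cell (EFin \o (fun x => 2 * m * f x)).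
  apply: (@cell_integrable _ (`|2 * m| * M)); first exact: measurable_funM.
  by move=> x; rewrite normrM ler_wpM2l.
have i2 : (lebesgue_row R n).-integrable unit_cell (EFin \o (fun x => f x ^+ 2)).
  apply: (@cell_integrable _ (M ^+ 2)); first exact: measurable_funX.
  by move=> x; rewrite normrX lerXn2r// nnegrE// (le_trans _ (fM x)).
have i3 : (lebesgue_row R n).-integrable unit_cell (EFin \o (fun x => cst (- m ^+ 2) x)).
  by apply: (@cell_integrable _ `|- m ^+ 2|).
have : (\int[lebesgue_row R n]_(x in unit_cell) (2 * m * f x + cst (- m ^+ 2) x))%R <=
    (\int[lebesgue_row R n]_(x in unit_cell) (f x ^+ 2))%R.
  apply: le_Rintegral => //; first exact: measurable_unit_cell.
    apply: (@cell_integrable _ (`|2 * m| * M + `|- m ^+ 2|)).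
      by apply: measurable_funD => //; exact: measurable_funM.
    by move=> x; rewrite (le_trans (ler_normD _ _))// lerD2r normrM ler_wpM2l.
  move=> x _ /=; have := sqr_ge0 (f x - m); rewrite sqrrB.
  by rewrite -[_ *+ 2]mulr_natl; lra.
rewrite RintegralD//; last exact: measurable_unit_cell.
rewrite RintegralZl//; last 2 first.
- exact: measurable_unit_cell.
- exact: cell_integrable fM.
rewrite Rintegral_cst; last exact: measurable_unit_cell.
rewrite -/m -/cell_volume; apply: le_trans.
have := cell_volume_le1; have := sqr_ge0 m; move: cell_volume => v m0 v1.
have : m ^+ 2 * v <= m ^+ 2 by rewrite ler_piMr.
by rewrite mulNr (_ : 2 * m * m = 2 * m ^+ 2) ?expr2 ?mulrA//; lra.
Qed.

Definition floor_row x : 'rV[int]_n := \row_i Num.floor (x ord0 i).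

Lemma unit_cell_sub x (j : 'rV[int]_n) :
  unit_cell (x - lattice_pt R j) <-> j = floor_row x.
Proof.
split=> [h|-> i].
  apply/rowP => i; rewrite mxE; have := h i; rewrite !mxE subr_ge0 ltrBlDr => /andP[h1 h2].
  by apply/esym/floor_def; rewrite h1 /= intrD addrC.
rewrite !mxE subr_ge0 ltrBlDr addrC floor_le.
by have /andP[_] := floor_itv (x ord0 i); rewrite intrD.
Qed.

End unit_cell.

Arguments unit_cell {R n}.

Section cell_count.
Variables (R : realType) (n : nat).
Implicit Types (L : R) (x : 'rV[R]_n.+1).

Lemma sqr_sum_le m (b : 'I_m.+1 -> R) :
  (\sum_i b i) ^+ 2 <= m.+1%:R * \sum_i b i ^+ 2.
Proof.
set s := \sum_i b i; set q := \sum_i b i ^+ 2.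
have m0 : 0 < m.+1%:R :> R by rewrite ltr0n.
have : 0 <= \sum_i (m.+1%:R * b i - s) ^+ 2 by apply: sumr_ge0 => i _; exact: sqr_ge0.
have -> : \sum_i (m.+1%:R * b i - s) ^+ 2 = m.+1%:R * (m.+1%:R * q - s ^+ 2).
  rewrite (eq_bigr (fun i => m.+1%:R ^+ 2 * b i ^+ 2 + (- (2 * m.+1%:R * s)) * b i + s ^+ 2)).
    rewrite !big_split/= -!mulr_sumr -/s -/q sumr_const card_ord -[s *+ _]mulr_natr.
    by move: (m.+1%:R : R) => M; ring.
  by move=> i _; move: (m.+1%:R : R) => M; ring.
by rewrite pmulr_rge0// subr_ge0.
Qed.

(** Nonzero exactly when j and j + x disagree about belonging to the ball; these are the Fourier
    coefficients of the discretization error at the point x of the cell. *)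
Definition cell_diff L x (j : 'rV[int]_n.+1) : R :=
  ball_ind L (lattice_pt R j) - ball_ind L (lattice_pt R j + x).

(** One factor n + 1 comes from Cauchy-Schwarz over the axial steps, the other from their number;
    each step contributes 2 (1 + 1) (2 L + 3)^n <= 4 (5 L)^n. *)
Definition cell_const : R := n.+1%:R ^+ 2 * (4 * 5 ^+ n).

Lemma cell_const_gt0 : 0 < cell_const.
Proof. by rewrite mulr_gt0 ?exprn_gt0// mulr_gt0// exprn_gt0. Qed.

(* The translation by x is split into translations along the axes. *)
Lemma sum_cell_diff_le L x t : 1 <= L -> unit_cell x -> uniq t ->
  \sum_(j <- t) cell_diff L x j ^+ 2 <= cell_const * L ^+ n.
Proof.
move=> L1 cx ut; have L0 : 0 <= L by exact: le_trans L1.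
pose y (k : nat) : 'rV[R]_n.+1 := \row_l (if (l < k)%N then x ord0 l else 0).
have y0 : y 0 = 0 by apply/rowP => l; rewrite !mxE.
have yN : y n.+1 = x by apply/rowP => l; rewrite mxE ltn_ord.
have yS (i : 'I_n.+1) : y i.+1 = y i + x ord0 i *: delta_mx ord0 i.
  apply/rowP => l; rewrite !mxE eqxx/= ltnS leq_eqVlt.
  have [->|li] := eqVneq l i; first by rewrite eqxx ltnn mulr1 add0r.
  by rewrite mulr0 addr0 (_ : (l : nat) == i = false)//; apply/negbTE.
pose b (i : 'I_n.+1) j : R := ball_ind L (lattice_pt R j + y i) -
  ball_ind L (lattice_pt R j + y i + x ord0 i *: delta_mx ord0 i).
have dE j : cell_diff L x j = \sum_i b i j.
  have := telescope_sumr (fun k => ball_ind L (lattice_pt R j + y k)) (leq0n n.+1).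
  rewrite big_mkord y0 yN addr0 => h.
  by rewrite /cell_diff -opprB -h -sumrN; apply: eq_bigr => i _; rewrite opprB yS addrA /b.
apply: (@le_trans _ _ (\sum_(j <- t) n.+1%:R * \sum_i b i j ^+ 2)).
  by apply: ler_sum => j _; rewrite dE sqr_sum_le.
rewrite -mulr_sumr exchange_big/=.
apply: (@le_trans _ _ (n.+1%:R * \sum_(i < n.+1) (4 * (5 * L) ^+ n))).
  rewrite ler_wpM2l//; apply: ler_sum => i _.
  have /andP[x0 x1] := cx i.
  apply: (le_trans (@count_ball_shift R n L (x ord0 i) (y i) i t L0 x0 _ ut)).
    move=> k; rewrite mxE; case: ifP => _; last by rewrite normr0.
    by have /andP[? /ltW ?] := cx k; rewrite ger0_norm.
  apply: ler_pM; [by rewrite mulr_ge0// addr_ge0|by rewrite exprn_ge0// addr_ge0// mulr_ge0| |].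
    by lra.
  by rewrite lerXn2r ?nnegrE//; lra.
rewrite sumr_const card_ord -[X in _ * X]mulr_natl /cell_const exprMn.
by rewrite le_eqVlt; apply/orP; left; apply/eqP; move: (n.+1%:R : R) => M; ring.
Qed.

Lemma ball_indE L : ball_ind L = \1_(eball L) :> ('rV[R]_n.+1 -> R).
Proof.
apply/funext => x; rewrite /ball_ind indicE; congr (_%:R); congr nat_of_bool.
by apply/idP/idP; rewrite inE.
Qed.

Lemma measurable_ball_ind_shift L (v : 'rV[R]_n.+1) :
  measurable_fun setT (fun x => ball_ind L (v + x)).
Proof.
under eq_fun do rewrite addrC ball_indE.
apply: (measurableT_comp _ (measurable_row_shift v)).
by apply: measurable_indic; exact: measurable_eball.
Qed.

Lemma measurable_cell_diff L j : measurable_fun setT (fun x => cell_diff L x j).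
Proof. by apply: measurable_funB => //; exact: measurable_ball_ind_shift. Qed.

Lemma ball_ind_le1 L x : `|ball_ind L x| <= 1.
Proof. by rewrite /ball_ind; case: (enorm x <= L); rewrite ?normr0 ?normr1. Qed.

Lemma norm_cell_diff_le L x j : `|cell_diff L x j| <= 2.
Proof. by rewrite (le_trans (ler_normB _ _))// (_ : 2 = 1 + 1)// lerD ?ball_ind_le1. Qed.

End cell_count.

Section discretization.
Variables (R : realType) (n : nat).
Implicit Types (L : R) (x xi : 'rV[R]_n.+1).

Let mdotp xi (v : 'rV[R]_n.+1) : measurable_fun setT (fun x => cos (dotp xi (v + x))).
Proof.
apply: measurable_cosf; under eq_fun do rewrite addrC.
exact: (measurableT_comp (measurable_dotp xi) (measurable_row_shift v)).
Qed.

Let tile_bound L : seq 'rV[int]_n.+1 := lbox n.+1 (Num.bound L).+1.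

Let floor_tile L x : enorm x <= L -> floor_row x \in tile_bound L.
Proof.
move=> xL; rewrite mem_lbox; apply/forallP => i; rewrite mxE.
have : `|x ord0 i| <= (Num.bound L)%:R.
  rewrite (le_trans (coord_le_enorm x i))// (le_trans xL)//.
  by rewrite (le_trans (ler_norm L))// ltW// unstable.ltr_norm_bound.
rewrite ler_norml => /andP[h1 h2].
have f1 : (Num.floor (x ord0 i))%:~R <= x ord0 i by apply: floor_le.
have f2 : x ord0 i < (Num.floor (x ord0 i))%:~R + 1.
  by have /andP[_] := floor_itv (x ord0 i); rewrite intrD.
by rewrite -!(ler_int R) intrN -!pmulrn -natr1; apply/andP; split; lra.
Qed.

Let tile_sub L : {subset ball_pts n.+1 L <= tile_bound L}.
Proof.
move=> j; rewrite mem_ball_pts => jL; rewrite mem_lbox; apply/forallP => i.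
have : `|lattice_pt R j ord0 i| <= (Num.bound L)%:R.
  rewrite (le_trans (coord_le_enorm _ i))// (le_trans jL)//.
  by rewrite (le_trans (ler_norm L))// ltW// unstable.ltr_norm_bound.
rewrite mxE ler_norml => /andP[h1 h2].
by rewrite -!(ler_int R) intrN -!pmulrn -natr1; apply/andP; split; lra.
Qed.

Let tile_integral L xi (v : 'rV[R]_n.+1) : 0 <= L ->
  (\int[lebesgue_row R n.+1]_(x in eball L) (\1_unit_cell (x - v) * cos (dotp xi x)) =
   \int[lebesgue_row R n.+1]_(x in unit_cell) (ball_ind L (v + x) * cos (dotp xi (v + x))))%R.
Proof.
move=> L0; pose D : set 'rV[R]_n.+1 := (fun y => y + v) @^-1` eball L.
pose h (y : 'rV[R]_n.+1) : R := \1_unit_cell y * cos (dotp xi (v + y)).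
have mD : measurable D.
  by apply: measurable_preim; [exact: measurable_row_shift|exact: measurable_eball].
have mh : measurable_fun setT h.
  by apply: measurable_funM => //; apply: measurable_indic; exact: measurable_unit_cell.
have fD : (fun x => x - v) @^-1` D = eball L.
  by apply/seteqP; split => x; rewrite /D/= subrK.
have hf x : h (x - v) = \1_unit_cell (x - v) * cos (dotp xi x) by rewrite /h [v + _]addrC subrK.
have := @integral_measure_preserving _ _ _ _ _ (lebesgue_row R n.+1) (lebesgue_row R n.+1)
  (fun x => x - v) (measurable_row_shift (- v)) (@lebesgue_row_shift R n.+1 (- v)) D (EFin \o h) mD.
rewrite fD => H; rewrite /Rintegral; congr fine.
transitivity (\int[lebesgue_row R n.+1]_(x in D) (h x)%:E)%E.
  rewrite -H.
  - by apply: eq_integral => x _; rewrite /= hf.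
  - exact/measurable_EFinP.
  - have := @eball_integrable R n.+1 L (h \o (fun x => x - v)) 1 L0.
    apply; first exact: (measurableT_comp mh (measurable_row_shift (- v))).
    move=> x; rewrite /= hf normrM mulr_ile1 ?cos_max// indicE.
    by case: (_ \in _); rewrite ?normr0 ?normr1.
rewrite [LHS]integral_mkcond [RHS]integral_mkcond; apply: eq_integral => x _.
rewrite !patchE /h indicE ball_indE indicE.
have -> : (x \in D) = (v + x \in eball L) by rewrite /D addrC; apply/idP/idP; rewrite !inE.
by case: (x \in unit_cell); case: (_ \in eball L); rewrite ?mul0r ?mul1r.
Qed.

Let bounded_sum (t : seq 'rV[int]_n.+1) (c : 'rV[int]_n.+1 -> R) (f : 'rV[int]_n.+1 -> R) (M : R) :
  (forall j, `|c j| <= M) -> (forall j, `|f j| <= 1) ->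
  `|\sum_(j <- t) c j * f j| <= \sum_(j <- t) M.
Proof.
move=> cM f1; apply: (le_trans (ler_norm_sum _ _ _)); apply: ler_sum => j _.
by rewrite normrM -[leRHS]mulr1 ler_pM.
Qed.

(** The cells tile the space: a point x of the ball lies in the cell at [floor_row x] and in no
    other, so the indicators of the cells sum to 1. *)
Let ball_transform_tiling L xi : 0 <= L -> ball_transform L xi =
  (\int[lebesgue_row R n.+1]_(x in unit_cell) \sum_(j <- tile_bound L)
    (ball_ind L (lattice_pt R j + x) * cos (dotp xi (lattice_pt R j + x))))%R.
Proof.
move=> L0; rewrite Rintegral_sum; first last.
- move=> j; apply: (@cell_integrable _ _ _ 1).
    by apply: measurable_funM => //; exact: measurable_ball_ind_shift.
  by move=> x; rewrite normrM mulr_ile1 ?ball_ind_le1 ?cos_max.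
- exact: measurable_unit_cell.
under eq_bigr do rewrite -tile_integral//.
rewrite -Rintegral_sum; first last.
- move=> j; apply: (@eball_integrable _ _ _ _ 1) => //.
    apply: measurable_funM; last by apply: measurable_cosf; exact: measurable_dotp.
    apply: (measurableT_comp _ (measurable_row_shift (- lattice_pt R j))).
    by apply: measurable_indic; exact: measurable_unit_cell.
  move=> x; rewrite normrM mulr_ile1 ?cos_max// indicE.
  by case: (_ \in _); rewrite ?normr0 ?normr1.
- exact: measurable_eball.
apply: eq_Rintegral => x; rewrite inE => xL; rewrite -mulr_suml.
rewrite (bigD1_seq (floor_row x)) ?lbox_uniq ?floor_tile//=.
rewrite big1 => [|j jx]; last first.
  rewrite indicE; case: (boolP (_ \in _)) => //; rewrite inE => /unit_cell_sub e.
  by rewrite e eqxx in jx.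
by rewrite indicE mem_set ?addr0 ?mul1r//; exact/unit_cell_sub.
Qed.

(** Only the real part of the transform of the cell, which is not symmetric; the imaginary part
    would be multiplied by the sine sum of the ball, which vanishes. *)
Definition cell_transform xi : R :=
  (\int[lebesgue_row R n.+1]_(x in unit_cell) cos (dotp xi x))%R.

Definition ball_tcos L xi : R := tcos (ball_pts n.+1 L) (fun=> 1) xi.

Lemma tsin_ball L xi : tsin (ball_pts n.+1 L) (fun=> 1) xi = 0.
Proof.
suff h : tsin (ball_pts n.+1 L) (fun=> 1) xi = - tsin (ball_pts n.+1 L) (fun=> 1) xi.
  by move: h; set a := tsin _ _ _ => h; lra.
rewrite {1}/tsin (perm_big (map -%R (ball_pts n.+1 L)))/=; last first.
  apply: uniq_perm; [exact: ball_pts_uniq|by rewrite map_inj_uniq ?ball_pts_uniq//; exact: oppr_inj|].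
  move=> j; rewrite -ball_ptsN -[j in RHS]opprK mem_map//; exact: oppr_inj.
rewrite big_map /tsin -sumrN; apply: eq_bigr => j _.
by rewrite phaseN sinN mulrN.
Qed.

Lemma bpowE L xi : bpow L xi = ball_tcos L xi ^+ 2.
Proof. by rewrite /bpow /tpow tsin_ball expr0n addr0. Qed.

Definition disc_error L xi : R := ball_tcos L xi * cell_transform xi - ball_transform L xi.

Let mcell_sum L xi :
  measurable_fun setT (fun x => \sum_(j <- tile_bound L)
    cell_diff L x j * cos (dotp xi (lattice_pt R j + x))).
Proof.
by apply: measurable_sum => j; apply: measurable_funM => //; exact: measurable_cell_diff.
Qed.

(* The ball sum of sines vanishes by symmetry, so multiplying by the transform of
   the cell replaces every lattice point of the ball by a translated cell. *)
Lemma disc_errorE L xi : 0 <= L -> disc_error L xi =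
  (\int[lebesgue_row R n.+1]_(x in unit_cell) \sum_(j <- tile_bound L)
    (cell_diff L x j * cos (dotp xi (lattice_pt R j + x))))%R.
Proof.
move=> L0; rewrite /disc_error ball_transform_tiling//.
have mcell : measurable (unit_cell : set 'rV[R]_n.+1) by exact: measurable_unit_cell.
rewrite -RintegralZl//; last first.
  apply: (@cell_integrable _ _ _ 1); first by apply: measurable_cosf; exact: measurable_dotp.
  by move=> x; exact: cos_max.
rewrite -RintegralB//; first last.
- apply: (@cell_integrable _ _ _ (\sum_(j <- tile_bound L) 1)).
    by apply: measurable_sum => j; apply: measurable_funM => //; exact: measurable_ball_ind_shift.
  by move=> x; apply: bounded_sum => j; [exact: ball_ind_le1|exact: cos_max].
- apply: (@cell_integrable _ _ _ (`|ball_tcos L xi|)).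
    by apply: measurable_funM => //; apply: measurable_cosf; exact: measurable_dotp.
  by move=> x; rewrite normrM ler_piMr// cos_max.
apply: eq_Rintegral => x _.
rewrite [RHS](eq_bigr (fun j => ball_ind L (lattice_pt R j) * cos (dotp xi (lattice_pt R j + x)) -
   ball_ind L (lattice_pt R j + x) * cos (dotp xi (lattice_pt R j + x)))); last first.
  by move=> j _; rewrite /cell_diff mulrBl.
rewrite sumrB; congr (_ - _).
rewrite (eq_bigr (fun j => (j \in ball_pts n.+1 L)%:R * (cos (phase xi j) * cos (dotp xi x) -
   sin (phase xi j) * sin (dotp xi x)))); last first.
  by move=> j _; rewrite dotpDr cosD mem_ball_pts.
rewrite sum_indicatorM; [|exact: ball_pts_uniq|exact: lbox_uniq|exact: tile_sub].
rewrite sumrB -!mulr_suml.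
have := tsin_ball L xi; rewrite /tsin; under eq_bigr do rewrite mul1r.
move=> ->; rewrite mul0r subr0 /ball_tcos /tcos.
by under eq_bigr do rewrite mul1r.
Qed.

(** The left side is the square of the real part of a rotation of [tcos] + i [tsin], hence at most
    the squared modulus. *)
Let cell_sum_le L xi x :
  (\sum_(j <- tile_bound L) cell_diff L x j * cos (dotp xi (lattice_pt R j + x))) ^+ 2 <=
  tpow (tile_bound L) (cell_diff L x) xi.
Proof.
have -> : \sum_(j <- tile_bound L) cell_diff L x j * cos (dotp xi (lattice_pt R j + x)) =
  tcos (tile_bound L) (cell_diff L x) xi * cos (dotp xi x) -
  tsin (tile_bound L) (cell_diff L x) xi * sin (dotp xi x).
  rewrite /tcos /tsin !mulr_suml -sumrB; apply: eq_bigr => j _.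
  by rewrite dotpDr cosD /phase; ring.
rewrite /tpow; have := cos2Dsin2 (dotp xi x).
move: (tcos _ _ _) (tsin _ _ _) (cos _) (sin _) => a b c s cs.
have : 0 <= (a * s + b * c) ^+ 2 by exact: sqr_ge0.
suff -> : (a * s + b * c) ^+ 2 = (a ^+ 2 + b ^+ 2) * (c ^+ 2 + s ^+ 2) - (a * c - b * s) ^+ 2.
  by rewrite cs mulr1 subr_ge0.
by ring.
Qed.

Let tpow_cell_integrable L xi : (lebesgue_row R n.+1).-integrable unit_cell
  (EFin \o (fun x => tpow (tile_bound L) (cell_diff L x) xi)).
Proof.
pose M : R := \sum_(j <- tile_bound L) 2.
apply: (@cell_integrable _ _ _ (M ^+ 2 + M ^+ 2)).
  by apply: measurable_funD; apply: measurable_funX; apply: measurable_sum => j;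
    apply: measurable_funM => //; exact: measurable_cell_diff.
have sqM (a : R) : `|a| <= M -> a ^+ 2 <= M ^+ 2.
  by move=> aM; apply: norm_le_sqr; rewrite (le_trans aM)// ler_norm.
move=> x; rewrite ger0_norm ?tpow_ge0// /tpow lerD//; apply: sqM; apply: bounded_sum => j.
- exact: norm_cell_diff_le.
- exact: cos_max.
- exact: norm_cell_diff_le.
- exact: sin_max.
Qed.

Let sqr_disc_error_le L xi : 0 <= L -> ((disc_error L xi ^+ 2)%:E <=
  \int[lebesgue_row R n.+1]_(x in unit_cell) (tpow (tile_bound L) (cell_diff L x) xi)%:E)%E.
Proof.
move=> L0; rewrite disc_errorE// -[leRHS]fineK; last first.
  by apply: integrable_fin_num; [exact: measurable_unit_cell|exact: tpow_cell_integrable].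
pose M : R := \sum_(j <- tile_bound L) 2.
have bM x : `|\sum_(j <- tile_bound L) cell_diff L x j * cos (dotp xi (lattice_pt R j + x))| <= M.
  by apply: bounded_sum => j; [exact: norm_cell_diff_le|exact: cos_max].
rewrite lee_fin; apply: (le_trans (sqr_Rintegral_cell_le (mcell_sum L xi) bM)).
apply: le_Rintegral.
- exact: measurable_unit_cell.
- apply: (@cell_integrable _ _ _ (M ^+ 2)); first exact: measurable_funX.
  by move=> x; rewrite normrX lerXn2r// nnegrE// (le_trans _ (bM x)).
- exact: tpow_cell_integrable.
- by move=> x _; exact: cell_sum_le.
Qed.

Let cos_cell_integrable xi :
  (lebesgue_row R n.+1).-integrable unit_cell (EFin \o (fun x => cos (dotp xi x))).
Proof.
apply: (@cell_integrable _ _ _ 1); last by move=> x; exact: cos_max.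
by apply: measurable_cosf; exact: measurable_dotp.
Qed.

Lemma norm_cell_transform_le1 xi : `|cell_transform xi| <= 1.
Proof.
apply: (@le_trans _ _ (cell_volume R n.+1)); last exact: cell_volume_le1.
apply: (le_trans (le_normr_Rintegral _ (cos_cell_integrable xi))).
  exact: measurable_unit_cell.
apply: (@le_trans _ _ (\int[lebesgue_row R n.+1]_(x in unit_cell) (cst 1 x))%R).
  apply: le_Rintegral.
  - exact: measurable_unit_cell.
  - apply: (@cell_integrable _ _ _ 1); last by move=> x; rewrite normr_id; exact: cos_max.
    by apply: measurableT_comp => //; apply: measurable_cosf; exact: measurable_dotp.
  - by apply: (@cell_integrable _ _ (cst 1) 1) => // x; rewrite normr1.
  - by move=> x _; exact: cos_max.
by rewrite Rintegral_cst ?mul1r//; exact: measurable_unit_cell.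
Qed.

Lemma tame_cell_transform : tame cell_transform.
Proof.
split; last by exists 1 => xi _; exact: norm_cell_transform_le1.
by apply: measurable_cos_transform; [exact: measurable_unit_cell|exact: lebesgue_unit_cell_fin].
Qed.

Lemma tame_ball_transform L : 0 < L -> tame (ball_transform L : 'rV[R]_n.+1 -> R).
Proof.
move=> L0; split; first exact: measurable_ball_transform (ltW L0).
by eexists => xi _; exact: norm_ball_transform_le.
Qed.

Lemma tame_ball_tcos L : tame (ball_tcos L).
Proof.
split; first exact: measurable_tcos.
exists (\sum_(j <- ball_pts n.+1 L) 1) => xi _.
by apply: bounded_sum => j; [rewrite normr1|exact: cos_max].
Qed.

Lemma tame_disc_error L : 0 < L -> tame (disc_error L).
Proof.
move=> L0; apply: tameB; last exact: tame_ball_transform.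
by apply: tameM; [exact: tame_ball_tcos|exact: tame_cell_transform].
Qed.

(** Tonelli exchanges frequency and cell. For a fixed x of the cell, Parseval turns the frequency
    integral into the number of j that disagree with j + x about the ball, which is O(L^n) uniformly
    in x. *)
Lemma disc_error_L2 L : 1 <= L ->
  cube_integral (fun xi => disc_error L xi ^+ 2) <= (2 * pi) ^+ n.+1 * cell_const R n * L ^+ n.
Proof.
move=> L1; have L0 : 0 < L by exact: lt_le_trans L1.
set C := (X in _ <= X).
have C0 : 0 <= C.
  by rewrite !mulr_ge0 ?exprn_ge0 ?mulr_ge0 ?pi_ge0// ltW// cell_const_gt0.
pose T xi x : R := tpow (tile_bound L) (cell_diff L x) xi.
pose f (p : 'rV[R]_n.+1 * 'rV[R]_n.+1) : \bar R :=
  (\1_cube p.1 * (\1_unit_cell p.2 * T p.1 p.2))%:E.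
have mprod (g h : 'rV[R]_n.+1 -> R) : measurable_fun setT g -> measurable_fun setT h ->
    measurable_fun setT (fun p : 'rV[R]_n.+1 * 'rV[R]_n.+1 => g p.2 * h p.1).
  move=> mg mh; apply: measurable_funM.
    exact: (measurableT_comp mg measurable_snd).
  exact: (measurableT_comp mh measurable_fst).
have mf : measurable_fun setT f.
  apply/measurable_EFinP; apply: measurable_funM.
    apply: (measurableT_comp _ measurable_fst); apply: measurable_indic.
    exact: measurable_cube.
  apply: measurable_funM.
    apply: (measurableT_comp _ measurable_snd); apply: measurable_indic.
    exact: measurable_unit_cell.
  apply: measurable_funD; apply: measurable_funX; apply: measurable_sum => j.
    apply: (mprod (fun x => cell_diff L x j) (fun xi => cos (phase xi j))).
      exact: measurable_cell_diff.
    by apply: measurable_cosf; exact: measurable_phase.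
  apply: (mprod (fun x => cell_diff L x j) (fun xi => sin (phase xi j))).
    exact: measurable_cell_diff.
  by apply: measurable_sinf; exact: measurable_phase.
have f0 p : (0 <= f p)%E by rewrite lee_fin !mulr_ge0// tpow_ge0.
rewrite -lee_fin -cube_integral_EFin; last by apply: tameX; exact: tame_disc_error.
apply: (@le_trans _ _ (\int[lebesgue_row R n.+1]_xi \int[lebesgue_row R n.+1]_x f (xi, x))%E).
  rewrite integral_mkcond; apply: ge0_le_integral => //.
  - move=> xi _; rewrite patchE; case: ifP => // _.
    by rewrite lee_fin sqr_ge0.
  - apply: (iffLR (measurable_restrictT _ _)); first exact: measurable_cube.
    apply/measurable_EFinP; apply: measurable_funTS; apply: measurable_funX.
    by have [] := tame_disc_error L0.
  - exact: (measurable_fun_fubini_tonelli_F (m2 := lebesgue_row R n.+1) f mf f0).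
  move=> xi _; rewrite patchE; case: ifPn => [xc|_]; last exact: integral_ge0.
  apply: (le_trans (sqr_disc_error_le xi (ltW L0))).
  rewrite [leLHS]integral_mkcond le_eqVlt; apply/orP; left; apply/eqP.
  apply: eq_integral => x _; rewrite patchE /f/= !indicE xc mul1r.
  by case: (x \in unit_cell); rewrite ?mul1r ?mul0r.
rewrite (fubini_tonelli (m1 := lebesgue_row R n.+1) (m2 := lebesgue_row R n.+1) f mf f0).
apply: (@le_trans _ _ (\int[lebesgue_row R n.+1]_(x in unit_cell) (cst C%:E x))%E).
  rewrite [leRHS]integral_mkcond; apply: ge0_le_integral => //.
  - by move=> x _; apply: integral_ge0.
  - exact: (measurable_fun_fubini_tonelli_G (m1 := lebesgue_row R n.+1) f mf f0).
  - by apply: (iffLR (measurable_restrictT _ _)); first exact: measurable_unit_cell.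
  move=> x _; rewrite patchE /f/=; case: ifPn => [xc|xc].
    have cx : unit_cell x by rewrite inE in xc.
    apply: (@le_trans _ _ (\int[lebesgue_row R n.+1]_(xi in cube) (T xi x)%:E)%E).
      rewrite [leRHS]integral_mkcond le_eqVlt; apply/orP; left; apply/eqP.
      apply: eq_integral => xi _; rewrite patchE !indicE xc mul1r.
      by case: (xi \in cube); rewrite ?mul1r ?mul0r.
    rewrite cube_integral_EFin; last exact: tame_tpow.
    rewrite lee_fin /cube_integral parseval ?lbox_uniq// /C -mulrA.
    rewrite ler_wpM2l ?exprn_ge0 ?mulr_ge0 ?pi_ge0//.
    by apply: sum_cell_diff_le; rewrite ?lbox_uniq.
  rewrite integral0_eq// => xi _.
  by rewrite [\1_unit_cell x]indicE (negbTE xc) mul0r mulr0.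
rewrite integral_cst; last exact: measurable_unit_cell.
have e := @lebesgue_unit_cell R n.+1.
apply: (@le_trans _ _ (C * cell_volume R n.+1)%:E).
  by rewrite (EFinM C) -e.
by rewrite lee_fin ler_piMr// cell_volume_le1.
Qed.

End discretization.

(** * Transfer between the lattice ball and the transform of the ball *)

Section discretization_transfer.
Variables (R : realType) (n : nat).
Implicit Types (L t : R) (xi : 'rV[R]_n.+1).

Let v := cell_volume R n.+1.
Let v_gt0 : 0 < v. Proof. exact: cell_volume_gt0. Qed.

Let cos_cell_integrable xi :
  (lebesgue_row R n.+1).-integrable unit_cell (EFin \o (fun x => cos (dotp xi x))).
Proof.
apply: (@cell_integrable _ _ _ 1); last by move=> x; exact: cos_max.
by apply: measurable_cosf; exact: measurable_dotp.
Qed.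

(** Points of the cell have norm at most n + 1, so the phase stays within 1 and the cosine above
    1/2. *)
Lemma cell_transform_ge xi : enorm xi <= n.+1%:R^-1 -> v / 2 <= cell_transform xi.
Proof.
move=> xin.
apply: (@le_trans _ _ (\int[lebesgue_row R n.+1]_(x in unit_cell) (cst 2^-1 x))%R).
  by rewrite Rintegral_cst 1?mulrC//; exact: measurable_unit_cell.
apply: le_Rintegral.
- exact: measurable_unit_cell.
- exact: (@cell_integrable _ _ (cst 2^-1) `|2^-1|).
- exact: cos_cell_integrable.
move=> x cx; apply: cos_ge_half; apply: (le_trans (norm_dotp_le _ _)).
rewrite -[leRHS](@mulVf _ n.+1%:R) ?pnatr_eq0//; apply: ler_pM => //; try exact: enorm_ge0.
apply: (le_trans (enorm_le_sum x)).
apply: (@le_trans _ _ (\sum_(i < n.+1) 1)); last by rewrite sumr_const card_ord.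
by apply: ler_sum => i _; have /andP[? /ltW ?] := cx i; rewrite ger0_norm.
Qed.

Lemma sqr_ball_transform_le L xi :
  ball_transform L xi ^+ 2 <= 2 * bpow L xi + 2 * disc_error L xi ^+ 2.
Proof.
rewrite bpowE.
have -> : ball_transform L xi = ball_tcos L xi * cell_transform xi - disc_error L xi.
  by rewrite /disc_error subKr.
have := norm_cell_transform_le1 xi.
move: (ball_tcos L xi) (cell_transform xi) (disc_error L xi) => a s e s1.
have h : a ^+ 2 * s ^+ 2 <= a ^+ 2.
  by rewrite ler_piMr ?sqr_ge0// -(expr1n _ 2); apply: norm_le_sqr; rewrite normr1.
have : 0 <= (a * s + e) ^+ 2 by exact: sqr_ge0.
have -> : (a * s + e) ^+ 2 = 2 * (a ^+ 2 * s ^+ 2) + 2 * e ^+ 2 - (a * s - e) ^+ 2 by ring.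
by move=> ?; lra.
Qed.

(** The factor 8 / v^2 is 2 / (v / 2)^2, since the cell transform is at least v / 2 here. *)
Lemma bpow_le_ball_transform L xi : enorm xi <= n.+1%:R^-1 ->
  bpow L xi <= 8 / v ^+ 2 * (ball_transform L xi ^+ 2 + disc_error L xi ^+ 2).
Proof.
move=> /cell_transform_ge; rewrite bpowE.
have e : ball_transform L xi = ball_tcos L xi * cell_transform xi - disc_error L xi.
  by rewrite /disc_error subKr.
rewrite e; move: (ball_tcos L xi) (cell_transform xi) (disc_error L xi) => a s b vs.
have s2 : v ^+ 2 / 4 <= s ^+ 2.
  have -> : v ^+ 2 / 4 = (v / 2) ^+ 2 by field.
  by rewrite lerXn2r// nnegrE ?(le_trans _ vs)// divr_ge0// ltW.
have : 0 <= (a * s - b - b) ^+ 2 by exact: sqr_ge0.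
have -> : (a * s - b - b) ^+ 2 = 2 * (a * s - b) ^+ 2 + 2 * b ^+ 2 - a ^+ 2 * s ^+ 2 by ring.
rewrite subr_ge0 => h.
have : v ^+ 2 / 4 * a ^+ 2 <= 2 * (a * s - b) ^+ 2 + 2 * b ^+ 2.
  by apply: le_trans h; rewrite mulrC ler_wpM2l// sqr_ge0.
rewrite -ler_pdivlMl ?divr_gt0 ?exprn_gt0// => /le_trans; apply.
rewrite le_eqVlt; apply/orP; left; apply/eqP; field.
by rewrite gt_eqF.
Qed.

Definition error_const : R := (2 * pi) ^+ n.+1 * cell_const R n.

Lemma error_const_gt0 : 0 < error_const.
Proof. by rewrite mulr_gt0 ?cell_const_gt0// exprn_gt0// mulr_gt0// pi_gt0. Qed.

Let tF L : 0 < L -> tame (fun xi => ball_transform L xi ^+ 2).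
Proof. by move=> L0; apply: tameX; exact: tame_ball_transform. Qed.

Let tE L : 0 < L -> tame (fun xi => disc_error L xi ^+ 2).
Proof. by move=> L0; apply: tameX; exact: tame_disc_error. Qed.

Let tpball t : tame (\1_(pball t) : 'rV[R]_n.+1 -> R).
Proof. by apply: tame_indic; exact: measurable_pball. Qed.

Section weighted.
Variables (W : 'rV[R]_n.+1 -> R) (M e : R).
Hypotheses (tW : tame W) (W_ge0 : forall xi, 0 <= W xi)
  (W_le : forall xi, enorm xi <= e -> W xi <= M) (M_ge0 : 0 <= M).

(** Used with two weights: |xi|^2 for the masses over balls, and S for the comparison itself. *)
Definition local_integral (f : 'rV[R]_n.+1 -> R) : R :=
  cube_integral (fun xi => \1_(pball e) xi * (W xi * f xi)).

Let tlocal f : tame f -> tame (fun xi => \1_(pball e) xi * (W xi * f xi)).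
Proof. by move=> tf; apply: tameM => //; exact: tameM. Qed.

Lemma le_local_integral f g : tame f -> tame g ->
  (forall xi, 0 < enorm xi <= e -> f xi <= g xi) -> local_integral f <= local_integral g.
Proof.
move=> tf tg fg; apply: le_cube_integral; [exact: tlocal|exact: tlocal|].
move=> xi _; rewrite indicE; case: (boolP (xi \in pball e)) => [|_]; last by rewrite !mul0r.
by rewrite inE => xe; rewrite !mul1r ler_wpM2l// fg.
Qed.

Lemma local_integralD f g : tame f -> tame g ->
  local_integral (fun xi => f xi + g xi) = local_integral f + local_integral g.
Proof.
move=> tf tg; rewrite /local_integral -cube_integralD; [|exact: tlocal|exact: tlocal].
by apply: eq_Rintegral => xi _; rewrite !mulrDr.
Qed.

Lemma local_integralZ r f : tame f ->
  local_integral (fun xi => r * f xi) = r * local_integral f.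
Proof.
move=> tf; rewrite /local_integral -cube_integralZ; last exact: tlocal.
by apply: eq_Rintegral => xi _; rewrite !(mulrCA r).
Qed.

Lemma local_integral_ge0 f : (forall xi, 0 <= f xi) -> 0 <= local_integral f.
Proof. by move=> f0; apply: cube_integral_ge0 => xi _; rewrite !mulr_ge0. Qed.

Lemma local_integral_error L : 1 <= L ->
  local_integral (fun xi => disc_error L xi ^+ 2) <= M * error_const * L ^+ n.
Proof.
move=> L1; have L0 : 0 < L by exact: lt_le_trans L1.
apply: (@le_trans _ _ (cube_integral (fun xi => M * disc_error L xi ^+ 2))).
  apply: le_cube_integral; [by apply: tlocal; exact: tE|by apply: tameM; [exact: tame_cst|exact: tE]|].
  move=> xi _; rewrite indicE; case: (boolP (xi \in pball e)) => [|_]; last first.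
    by rewrite mul0r mulr_ge0// sqr_ge0.
  by rewrite inE => /andP[_ xe]; rewrite mul1r ler_wpM2r ?sqr_ge0// W_le.
rewrite cube_integralZ; last exact: tE.
by rewrite -mulrA ler_wpM2l// disc_error_L2.
Qed.

Lemma local_ball_transform_le L : 1 <= L ->
  local_integral (fun xi => ball_transform L xi ^+ 2) <=
  2 * local_integral (bpow L) + 2 * (M * error_const) * L ^+ n.
Proof.
move=> L1; have L0 : 0 < L by exact: lt_le_trans L1.
have t2 f : tame f -> tame (fun xi : 'rV[R]_n.+1 => 2 * f xi).
  by move=> tf; apply: tameM => //; exact: tame_cst.
apply: (@le_trans _ _ (local_integral (fun xi => 2 * bpow L xi + 2 * disc_error L xi ^+ 2))).
  apply: le_local_integral; [exact: tF| |by move=> xi _; exact: sqr_ball_transform_le].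
  by apply: tameD; apply: t2; [exact: tame_bpow|exact: tE].
rewrite local_integralD; [|by apply: t2; exact: tame_bpow|by apply: t2; exact: tE].
rewrite !local_integralZ; [|exact: tE|exact: tame_bpow].
by rewrite lerD2l -mulrA ler_pM2l// local_integral_error.
Qed.

Lemma local_bpow_le L : 1 <= L -> e <= n.+1%:R^-1 ->
  local_integral (bpow L) <=
  8 / v ^+ 2 * (local_integral (fun xi => ball_transform L xi ^+ 2) + M * error_const * L ^+ n).
Proof.
move=> L1 en; have L0 : 0 < L by exact: lt_le_trans L1.
have tFE : tame (fun xi => ball_transform L xi ^+ 2 + disc_error L xi ^+ 2).
  by apply: tameD; [exact: tF|exact: tE].
apply: (@le_trans _ _ (local_integral (fun xi => 8 / v ^+ 2 *
    (ball_transform L xi ^+ 2 + disc_error L xi ^+ 2)))).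
  apply: le_local_integral; [exact: tame_bpow|by apply: tameM => //; exact: tame_cst|].
  by move=> xi /andP[_ xe]; apply: bpow_le_ball_transform; exact: le_trans en.
rewrite local_integralZ// local_integralD; [|exact: tF|exact: tE].
rewrite ler_wpM2l ?divr_ge0 ?sqr_ge0// lerD2l.
exact: local_integral_error.
Qed.

End weighted.

Definition quad_ball L t : R :=
  local_integral (fun xi => enorm xi ^+ 2) t (fun xi => ball_transform L xi ^+ 2).

Let quad_bpowE L t : quad_bpow n L t = local_integral (fun xi => enorm xi ^+ 2) t (bpow L).
Proof. by []. Qed.

Let tsq : tame (fun xi : 'rV[R]_n.+1 => enorm xi ^+ 2).
Proof. by apply: tameX; exact: tame_enorm. Qed.

Let sq_le t xi : enorm xi <= t -> enorm xi ^+ 2 <= t ^+ 2.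
Proof. by move=> xt; rewrite lerXn2r ?nnegrE ?enorm_ge0// (le_trans _ xt)// enorm_ge0. Qed.

Let sq_ge0 xi : 0 <= enorm xi ^+ 2. Proof. exact: sqr_ge0. Qed.

(** The weight is at most t^2 on the ball, so the discretization error costs t^2 L^n, at most t L^n
    for t <= 1. *)
Lemma quad_ball_le L t : 1 <= L -> 0 < t <= 1 ->
  quad_ball L t <= (2 * quad_const R n + 2 * error_const) * t * L ^+ n.
Proof.
move=> L1 /andP[t0 t1].
have := local_ball_transform_le tsq sq_ge0 (@sq_le t) (sqr_ge0 t) L1.
move=> /le_trans; apply; rewrite -quad_bpowE.
have h1 := quad_bpow_le n L1 (introT andP (conj t0 t1)).
have Ln : 0 <= L ^+ n by rewrite exprn_ge0// (le_trans _ L1).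
have h2 : t ^+ 2 * (error_const * L ^+ n) <= t * (error_const * L ^+ n).
  apply: ler_wpM2r; first by rewrite mulr_ge0// ltW// error_const_gt0.
  by rewrite expr2 ler_piMr// ltW.
have := lerD (ler_wpM2l (ler0n R 2) h1) (ler_wpM2l (ler0n R 2) h2).
move: (quad_bpow _ _ _) (quad_const _ _) error_const (L ^+ n) => q c d l h.
by rewrite !mulrDl; lra.
Qed.

Let lower_slope : R := (2 * pi) ^+ n.+1 / (2 * n.+1%:R) ^+ n / (2 * (lower_const R n + 1)).

Let lower_slope_gt0 : 0 < lower_slope.
Proof.
rewrite !divr_gt0// ?exprn_gt0// ?mulr_gt0 ?pi_gt0// ?ltr0n//.
by rewrite addr_gt0// lower_const_gt0.
Qed.

Definition quad_slope : R := v ^+ 2 / 16 * lower_slope.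

Lemma quad_slope_gt0 : 0 < quad_slope.
Proof. by rewrite mulr_gt0// divr_gt0// exprn_gt0. Qed.

(** Up to the first bound the cell transform is bounded below. Up to the second, the error t^2 L^n
    takes at most half of the lower bound, the half that was set aside in [quad_slope]. *)
Definition quad_radius : R := Num.min n.+1%:R^-1 (quad_slope / error_const).

Lemma quad_radius_gt0 : 0 < quad_radius.
Proof.
by rewrite lt_min invr_gt0 ltr0n divr_gt0 ?quad_slope_gt0 ?error_const_gt0.
Qed.

Lemma quad_ball_ge L t : 1 <= L -> 0 < t <= quad_radius ->
  2 * (lower_const R n + 1) <= t * L -> quad_slope * t * L ^+ n <= quad_ball L t.
Proof.
move=> L1 /andP[t0 tr] tL.
have [tn te] : t <= n.+1%:R^-1 /\ t <= quad_slope / error_const.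
  by apply/andP; rewrite -le_min.
have t1 : t <= 1 by apply: (le_trans tn); rewrite invf_le1// ler1n.
have h1 := quad_bpow_ge L1 (introT andP (conj t0 t1)) tL.
have := local_bpow_le tsq sq_ge0 (@sq_le t) (sqr_ge0 t) L1 tn.
rewrite -quad_bpowE -/(quad_ball L t) => h2.
have h3 := le_trans h1 h2; rewrite -/lower_slope in h3.
have Ln : 0 <= L ^+ n by rewrite exprn_ge0// (le_trans _ L1).
have v2 : 0 < v ^+ 2 / 8 by rewrite divr_gt0// exprn_gt0.
have := ler_wpM2l (ltW v2) h3.
have -> : v ^+ 2 / 8 * (8 / v ^+ 2 * (quad_ball L t + t ^+ 2 * error_const * L ^+ n)) =
  quad_ball L t + t ^+ 2 * error_const * L ^+ n by field; rewrite gt_eqF.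
have h4 : t ^+ 2 * error_const * L ^+ n <= quad_slope * t * L ^+ n.
  rewrite ler_wpM2r// expr2 -mulrA mulrC ler_wpM2r ?(ltW t0)//.
  by rewrite -ler_pdivlMr ?error_const_gt0.
rewrite (_ : v ^+ 2 / 8 * (lower_slope * t * L ^+ n) = 2 * (quad_slope * t * L ^+ n)).
  by move: h4; move: (quad_slope * t * L ^+ n) (_ * L ^+ n) (quad_ball L t) => a b c; lra.
by rewrite /quad_slope; field.
Qed.

End discretization_transfer.

(** * Comparison with the kernel *)

Section kernel.
Variables (R : realType) (n : nat).
Implicit Types (L t r s : R) (xi : 'rV[R]_n.+1).

Definition kernel L r : R :=
  if r <= L^-1 then L ^+ (2 * n.+1) else L ^+ n / r ^+ n.+2.

Let powL L : L ^+ (2 * n.+1) = L ^+ n * L ^+ n.+2.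
Proof. by rewrite -exprD; congr (_ ^+ _); lia. Qed.

Lemma kernel_small L r : r <= L^-1 -> kernel L r = L ^+ (2 * n.+1).
Proof. by rewrite /kernel => ->. Qed.

(** Together with [kernel_le_div]: the kernel is the smaller of its two branches, which meet at r =
    1 / L. *)
Lemma kernel_le_pow L r : 0 < L -> kernel L r <= L ^+ (2 * n.+1).
Proof.
move=> L0; rewrite /kernel; case: (leP r L^-1) => // Lr.
have r0 : 0 < r by rewrite (lt_trans _ Lr)// invr_gt0.
rewrite powL ler_wpM2l ?exprn_ge0 ?(ltW L0)// -exprVn lerXn2r ?nnegrE ?invr_ge0 ?(ltW r0) ?(ltW L0)//.
by rewrite -[leRHS]invrK lef_pV2 ?posrE ?invr_gt0// ltW.
Qed.

Lemma kernel_le_div L r : 0 < L -> 0 < r -> kernel L r <= L ^+ n / r ^+ n.+2.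
Proof.
move=> L0 r0; rewrite /kernel; case: (leP r L^-1) => // rL.
rewrite powL ler_wpM2l ?exprn_ge0 ?(ltW L0)// -exprVn lerXn2r ?nnegrE ?invr_ge0 ?(ltW r0) ?(ltW L0)//.
by rewrite -[leLHS]invrK lef_pV2 ?posrE ?invr_gt0.
Qed.

Lemma kernel_ge0 L r : 0 < L -> 0 <= kernel L r.
Proof.
move=> L0; rewrite /kernel; case: (leP r L^-1) => [_|Lr]; first by rewrite exprn_ge0// ltW.
by rewrite divr_ge0 ?exprn_ge0// ?(ltW L0)// (le_trans _ (ltW Lr))// invr_ge0 ltW.
Qed.

Lemma kernel_noninc L r s : 0 < L -> 0 < r -> r <= s -> kernel L s <= kernel L r.
Proof.
move=> L0 r0 rs; rewrite {2}/kernel; case: (leP r L^-1) => Lr; first exact: kernel_le_pow.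
have s0 : 0 < s by exact: lt_le_trans rs.
apply: (le_trans (kernel_le_div L0 s0)).
rewrite ler_wpM2l ?exprn_ge0 ?(ltW L0)// lef_pV2 ?posrE ?exprn_gt0//.
by rewrite lerXn2r ?nnegrE ?(ltW r0) ?(ltW s0).
Qed.

Lemma measurable_kernel L : 0 < L -> measurable_fun setT (kernel L).
Proof.
move=> L0; have -> : kernel L =
    (fun r => if r <= L^-1 then L ^+ (2 * n.+1) else L ^+ n * (r ^+ n.+2) `^ (-1)).
  apply/funext => r; rewrite /kernel; case: (leP r L^-1) => // Lr.
  rewrite powR_inv1// exprn_ge0// (le_trans _ (ltW Lr))// invr_ge0 ltW//.
apply: measurable_fun_ifT => //; first exact: measurable_fun_ler.
apply: measurable_funM => //.
apply: (measurableT_comp (measurable_powR (-1))); exact: measurable_funX.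
Qed.

Lemma tame_kernel L : 0 < L -> tame (fun xi : 'rV[R]_n.+1 => kernel L (enorm xi)).
Proof.
move=> L0; apply: (@bounded_tame _ _ _ (L ^+ (2 * n.+1))).
  exact: (measurableT_comp (measurable_kernel L0) (@measurable_enorm R n.+1)).
by move=> xi; rewrite ger0_norm ?kernel_ge0//; exact: kernel_le_pow.
Qed.

Let v := unit_ball_volume R n.+1.
Let v_gt0 : 0 < v. Proof. exact: unit_ball_volume_gt0. Qed.

Let pi_ge1 : 1 <= pi :> R.
Proof. by apply: le_trans (pi_ge2 R); rewrite ler1n. Qed.

Lemma pball_sub_cube t : t <= pi -> (pball t : set 'rV[R]_n.+1) `<=` cube.
Proof.
move=> tpi x /andP[_ xt] i; rewrite -ler_norml.
by rewrite (le_trans (coord_le_enorm x i))// (le_trans xt).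
Qed.

Let tpball t : tame (\1_(pball t) : 'rV[R]_n.+1 -> R).
Proof. by apply: tame_indic; exact: measurable_pball. Qed.

Lemma cube_integral_pball t : 0 < t <= pi ->
  cube_integral (\1_(pball t) : 'rV[R]_n.+1 -> R) = v * t ^+ n.+1.
Proof.
move=> /andP[t0 tpi].
have := @cube_integral_indic R n.+1 _ _ (measurable_pball t) (pball_sub_cube tpi) (@tame_cst R n.+1 1).
rewrite integral_cst; last exact: measurable_pball.
have e : lebesgue_row R n.+1 (pball t) = (t ^+ n.+1 * v)%:E.
  rewrite -(@lebesgue_eball R n.+1 t)// -(lebesgue_row_punctured _ (@measurable_eball R n.+1 t))//.
  by congr (lebesgue_row R n.+1 _); apply/seteqP; split => x;
    rewrite /pball /eball/=; [case/andP|case=> ? ?; apply/andP].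
rewrite mul1e; move=> h; have : ((t ^+ n.+1 * v)%:E = (cube_integral (fun xi => \1_(pball t) xi * 1))%:E)%E.
  by rewrite -e -h.
move=> [] h2; rewrite mulrC h2; apply: eq_Rintegral => xi _.
by rewrite mulr1.
Qed.

Definition quad_kernel L t : R :=
  local_integral (fun xi : 'rV[R]_n.+1 => enorm xi ^+ 2) t (fun xi => kernel L (enorm xi)).

Let tq L t : 0 < L ->
  tame (fun xi : 'rV[R]_n.+1 => \1_(pball t) xi * (enorm xi ^+ 2 * kernel L (enorm xi))).
Proof.
move=> L0; apply: tameM => //; apply: tameM; last exact: tame_kernel.
by apply: tameX; exact: tame_enorm.
Qed.

(* Only the shell between the radii t / 2 and t is kept. *)
Lemma quad_kernel_ge L t : 0 < L -> 0 < t <= 1 ->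
  v / 8 * (t ^+ n.+3 * kernel L t) <= quad_kernel L t.
Proof.
move=> L0 /andP[t0 t1]; have k0 := kernel_ge0 t L0.
pose a : R := t ^+ 2 / 4 * kernel L t.
have a0 : 0 <= a by rewrite mulr_ge0// divr_ge0// sqr_ge0.
apply: (@le_trans _ _ (a * (v * t ^+ n.+1 - v * (t / 2) ^+ n.+1))).
  have h : (t / 2) ^+ n.+1 <= t ^+ n.+1 / 2.
    rewrite expr_div_n ler_wpM2l ?exprn_ge0 ?(ltW t0)// lef_pV2 ?posrE ?exprn_gt0//.
    by rewrite exprS ler_peMr// exprn_ege1// ler1n.
  have : a * (v * t ^+ n.+1 / 2) <= a * (v * t ^+ n.+1 - v * (t / 2) ^+ n.+1).
    rewrite ler_wpM2l//; have := ler_wpM2l (ltW v_gt0) h; rewrite mulrA.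
    by move: (v * t ^+ n.+1) (v * (t / 2) ^+ n.+1) => b c; lra.
  apply: le_trans; rewrite le_eqVlt; apply/orP; left; apply/eqP.
  by rewrite /a !exprS expr0; field.
rewrite -cube_integral_pball ?t0 ?(le_trans t1)//.
rewrite -cube_integral_pball ?divr_gt0//=; last first.
  by rewrite ler_pdivrMr// (le_trans t1)// (le_trans pi_ge1)// ler_peMr ?pi_ge0// ler1n.
rewrite mulrBr -!cube_integralZ// lerBlDr -cube_integralD; last 2 first.
- exact: tq.
- by apply: tameM => //; exact: tame_cst.
apply: le_cube_integral.
- by apply: tameM => //; exact: tame_cst.
- by apply: tameD; [exact: tq|by apply: tameM => //; exact: tame_cst].
move=> xi _; rewrite !indicE; case: (boolP (xi \in pball t)) => xt; last first.
  by rewrite mulr0 mul0r add0r mulr_ge0.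
rewrite inE in xt; case: (boolP (xi \in pball (t / 2))) => xt2.
  by rewrite mul1r mulr1 lerDr mulr_ge0 ?sqr_ge0// kernel_ge0.
have {xt2} xt2 : t / 2 <= enorm xi.
  rewrite leNgt; apply/negP => h; move: xt2; rewrite notin_setE; apply.
  by case/andP: xt => x0 _; apply/andP; split => //; exact: ltW.
case/andP: xt => x0 xt; rewrite mulr1 mul1r mulr0 addr0 /a.
apply: ler_pM => //; first by rewrite divr_ge0// sqr_ge0.
  have -> : t ^+ 2 / 4 = (t / 2) ^+ 2 by field.
  by apply: lerXn2r; rewrite ?nnegrE ?enorm_ge0 ?divr_ge0 ?(ltW t0)//.
exact: kernel_noninc.
Qed.

Let quad_kernel_le_pow L t : 0 < L -> 0 < t <= 1 ->
  quad_kernel L t <= v * (t ^+ n.+3 * L ^+ (2 * n.+1)).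
Proof.
move=> L0 /andP[t0 t1].
have -> : v * (t ^+ n.+3 * L ^+ (2 * n.+1)) = t ^+ 2 * L ^+ (2 * n.+1) * (v * t ^+ n.+1).
  by move: (L ^+ _) => l; rewrite !exprS expr0; ring.
rewrite -cube_integral_pball ?t0 ?(le_trans t1)// -cube_integralZ//.
apply: le_cube_integral; [exact: tq|by apply: tameM => //; exact: tame_cst|].
move=> xi _; rewrite indicE; case: (boolP (xi \in pball t)) => xt; last by rewrite mul0r mulr0.
rewrite inE in xt; case/andP: xt => x0 xt; rewrite mul1r mulr1.
apply: ler_pM; rewrite ?sqr_ge0 ?kernel_ge0 ?kernel_le_pow//.
by rewrite lerXn2r ?nnegrE ?enorm_ge0 ?(ltW t0).
Qed.

(** On the shell between t / 2 and t the weight is at most t^2, the kernel at most L^n / (t /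
    2)^(n+2), and the volume at most v t^(n+1). *)
Let quad_kernel_halve L t : 0 < L -> 0 < t <= 1 ->
  quad_kernel L t <= quad_kernel L (t / 2) + 2 ^+ n.+2 * v * t * L ^+ n.
Proof.
move=> L0 /andP[t0 t1]; have t20 : 0 < t / 2 by rewrite divr_gt0.
pose a : R := t ^+ 2 * (L ^+ n / (t / 2) ^+ n.+2).
have a0 : 0 <= a.
  by rewrite mulr_ge0 ?sqr_ge0// divr_ge0 ?exprn_ge0// ltW.
have -> : 2 ^+ n.+2 * v * t * L ^+ n = a * (v * t ^+ n.+1).
  rewrite /a expr_div_n invf_div; move: (L ^+ n) (2 ^+ n.+2) => l w.
  by rewrite !exprS expr0; field; rewrite expf_neq0 gt_eqF.
rewrite -cube_integral_pball ?t0 ?(le_trans t1)// -cube_integralZ//.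
rewrite -cube_integralD; last 2 first.
- exact: tq.
- by apply: tameM => //; exact: tame_cst.
apply: le_cube_integral; first exact: tq.
  by apply: tameD; [exact: tq|by apply: tameM => //; exact: tame_cst].
move=> xi _; rewrite !indicE; case: (boolP (xi \in pball t)) => xt; last first.
  rewrite mul0r mulr0 addr0; apply: mulr_ge0 => //.
  by apply: mulr_ge0; rewrite ?sqr_ge0 ?kernel_ge0.
rewrite inE in xt; case: (boolP (xi \in pball (t / 2))) => xt2.
  by rewrite !mul1r mulr1 lerDl.
have {xt2} xt2 : t / 2 <= enorm xi.
  rewrite leNgt; apply/negP => h; move: xt2; rewrite notin_setE; apply.
  by case/andP: xt => x0 _; apply/andP; split => //; exact: ltW.
case/andP: xt => x0 xt; rewrite mulr1 mul1r mul0r add0r /a.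
apply: ler_pM; rewrite ?sqr_ge0 ?kernel_ge0//.
  by rewrite lerXn2r ?nnegrE ?enorm_ge0 ?(ltW t0).
apply: (le_trans (kernel_noninc L0 t20 xt2)); exact: kernel_le_div.
Qed.

(** Twice the constant of one shell: the dyadic shells contribute a geometric series of ratio
    1/2. *)
Definition kernel_const : R := 2 ^+ n.+3 * v.

Lemma kernel_const_gt0 : 0 < kernel_const.
Proof. by rewrite mulr_gt0// exprn_gt0. Qed.

(** Dyadic descent: the radius s is halved until s L <= 1, where the plateau of the kernel gives the
    bound directly. *)
Lemma quad_kernel_le_linear L t : 0 < L -> 0 < t <= 1 ->
  quad_kernel L t <= kernel_const * t * L ^+ n.
Proof.
move=> L0 /andP[t0 t1].
have Ln : 0 <= L ^+ n by rewrite exprn_ge0// ltW.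
suff H (k : nat) (s : R) : 0 < s -> s <= 1 -> s * L <= 2 ^+ k ->
    quad_kernel L s <= kernel_const * s * L ^+ n.
  apply: (H (Num.bound (t * L))) => //.
  apply: (@le_trans _ _ (Num.bound (t * L))%:R).
    by rewrite (le_trans (ler_norm _))// ltW// unstable.ltr_norm_bound.
  by rewrite -natrX ler_nat ltnW// ltn_expl.
elim: k s => [|k IH] s s0 s1 sk.
  apply: (le_trans (quad_kernel_le_pow L0 (introT andP (conj s0 s1)))).
  have -> : v * (s ^+ n.+3 * L ^+ (2 * n.+1)) = (s * L) ^+ n.+2 * (v * s * L ^+ n).
    by rewrite powL exprMn [s ^+ n.+3]exprS; move: (s ^+ _) (L ^+ n) (L ^+ n.+2) => x y z; ring.
  have p0 : 0 <= v * s * L ^+ n by rewrite !mulr_ge0// ltW.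
  apply: (@le_trans _ _ (1 * (v * s * L ^+ n))).
    by rewrite ler_wpM2r// exprn_ile1// mulr_ge0// ltW.
  rewrite (_ : kernel_const * s * L ^+ n = 2 ^+ n.+3 * (v * s * L ^+ n)).
    by rewrite ler_wpM2r// exprn_ege1// ler1n.
  by rewrite /kernel_const !mulrA.
apply: (le_trans (quad_kernel_halve L0 (introT andP (conj s0 s1)))).
have s20 : 0 < s / 2 by rewrite divr_gt0.
have s21 : s / 2 <= 1 by lra.
have sk2 : s / 2 * L <= 2 ^+ k.
  by rewrite mulrAC ler_pdivrMr// -exprSr.
apply: (le_trans (lerD (IH _ s20 s21 sk2) (lexx _))).
rewrite le_eqVlt; apply/orP; left; apply/eqP; rewrite /kernel_const.
by move: (L ^+ n) => l; rewrite [2 ^+ n.+3]exprS; field.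
Qed.

Lemma quad_kernel_le L t : 0 < L -> 0 < t <= 1 ->
  quad_kernel L t <= kernel_const * (t ^+ n.+3 * kernel L t).
Proof.
move=> L0 t01; have /andP[t0 t1] := t01; rewrite /kernel; case: (leP t L^-1) => tL.
  apply: (le_trans (quad_kernel_le_pow L0 t01)); rewrite ler_wpM2r//.
    by rewrite mulr_ge0// exprn_ge0// ltW.
  by rewrite ler_peMl ?(ltW v_gt0)// exprn_ege1// ler1n.
apply: (le_trans (quad_kernel_le_linear L0 t01)).
rewrite le_eqVlt; apply/orP; left; apply/eqP.
move: (L ^+ n) kernel_const => l c; rewrite [t ^+ n.+3]exprS; field.
by rewrite ?expf_neq0 ?gt_eqF// (lt_trans _ tL)// invr_gt0.
Qed.

End kernel.

(** * Comparison of the transform of the ball with the kernel *)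

Section kernel_comparison.
Variables (R : realType) (n : nat).
Implicit Types (L t r : R) (xi : 'rV[R]_n.+1).

Let v := unit_ball_volume R n.+1.
Let v_gt0 : 0 < v. Proof. exact: unit_ball_volume_gt0. Qed.

(** The common order of [quad_ball] and [quad_kernel] for small t: t^(n+3) L^(2(n+1)) up to t = 1 /
    L and t L^n beyond. *)
Let mass L t : R := t ^+ n.+3 * kernel n L t.

Let mass_large L t : 0 < L -> L^-1 < t -> mass L t = t * L ^+ n.
Proof.
move=> L0 tL; have t0 : 0 < t by rewrite (lt_trans _ tL)// invr_gt0.
rewrite /mass /kernel leNgt tL/= [t ^+ n.+3]exprS; field.
by rewrite ?expf_neq0 ?gt_eqF.
Qed.

Let mass_le L t : 0 < L -> 0 < t -> mass L t <= t * L ^+ n.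
Proof.
move=> L0 t0; rewrite /mass.
have -> : t * L ^+ n = t ^+ n.+3 * (L ^+ n / t ^+ n.+2).
  by rewrite [t ^+ n.+3]exprS; field; rewrite ?expf_neq0 ?gt_eqF.
by rewrite ler_wpM2l ?exprn_ge0 ?(ltW t0)// kernel_le_div.
Qed.

Let mass_inv L : 0 < L -> mass L L^-1 = L^-1 * L ^+ n.
Proof.
move=> L0; rewrite /mass kernel_small// (_ : 2 * n.+1 = n + n.+2)%N; last by lia.
by rewrite exprVn [L ^+ n.+3]exprS exprD; field; rewrite ?expf_neq0 ?gt_eqF.
Qed.

(** Doubling, which pays for the radius t / 2 on the right of the comparisons. *)
Let mass_halve L t : 0 < L -> 0 < t -> mass L t <= 2 ^+ n.+3 * mass L (t / 2).
Proof.
move=> L0 t0; have t20 : 0 < t / 2 by rewrite divr_gt0.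
have -> : 2 ^+ n.+3 * mass L (t / 2) = t ^+ n.+3 * kernel n L (t / 2).
  rewrite /mass expr_div_n; have : 2 ^+ n.+3 != 0 :> R by rewrite expf_neq0.
  by move: (2 ^+ _) (t ^+ _) (kernel _ _ _) => w p k w0; field.
rewrite ler_wpM2l ?exprn_ge0 ?(ltW t0)//; apply: kernel_noninc => //.
by rewrite ler_pdivrMr// ler_peMr ?(ltW t0)// ler1n.
Qed.

Let mass_ge0 L t : 0 < L -> 0 < t -> 0 <= mass L t.
Proof. by move=> L0 t0; rewrite mulr_ge0 ?exprn_ge0 ?(ltW t0)// kernel_ge0. Qed.

Let tF L : 0 < L -> tame (fun xi : 'rV[R]_n.+1 => ball_transform L xi ^+ 2).
Proof. by move=> L0; apply: tameX; exact: tame_ball_transform. Qed.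

Let tsq : tame (fun xi : 'rV[R]_n.+1 => enorm xi ^+ 2).
Proof. by apply: tameX; exact: tame_enorm. Qed.

Let sq_ge0 xi : 0 <= enorm xi ^+ 2. Proof. exact: sqr_ge0. Qed.

Let pow2 L : L ^+ (2 * n.+1) = (L ^+ n.+1) ^+ 2.
Proof. by rewrite -exprM mulnC. Qed.

Definition ball_upper : R :=
  v ^+ 2 * kernel_const R n + (2 * quad_const R n + 2 * error_const R n).

Let qc_ge0 : 0 <= 2 * quad_const R n + 2 * error_const R n.
Proof.
rewrite addr_ge0// mulr_ge0//; last by rewrite ltW// error_const_gt0.
by rewrite /quad_const !mulr_ge0 ?exprn_ge0 ?mulr_ge0 ?pi_ge0.
Qed.

Lemma ball_upper_gt0 : 0 < ball_upper.
Proof. by rewrite ltr_wpDr// mulr_gt0 ?kernel_const_gt0// exprn_gt0. Qed.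

(** Up to t = 1 / L the trivial bound v L^(n+1) on the transform is of the right order; beyond, the
    shift estimate is. *)
Let quad_ball_le_mass L t : 1 <= L -> 0 < t <= 1 ->
  quad_ball n L t <= ball_upper * mass L t.
Proof.
move=> L1 t01; have /andP[t0 t1] := t01; have L0 : 0 < L by exact: lt_le_trans L1.
have m0 := mass_ge0 L0 t0.
case: (leP t L^-1) => tL; last first.
  apply: (le_trans (quad_ball_le n L1 t01)); rewrite -mulrA -mass_large//.
  by rewrite ler_wpM2r// lerDr mulr_ge0 ?sqr_ge0// ltW// kernel_const_gt0.
apply: (@le_trans _ _ (v ^+ 2 * quad_kernel n L t)).
  rewrite -(local_integralZ t tsq); last exact: tame_kernel.
  apply: le_local_integral => //; [exact: tF|by apply: tameM; [exact: tame_cst|exact: tame_kernel]|].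
  move=> xi /andP[_ xt]; rewrite kernel_small ?(le_trans xt)// pow2 -exprMn.
  apply: norm_le_sqr; rewrite [leRHS]ger0_norm; first exact: norm_ball_transform_le.
  by rewrite mulr_ge0 ?exprn_ge0// ltW.
apply: (@le_trans _ _ (v ^+ 2 * (kernel_const R n * mass L t))).
  by rewrite ler_wpM2l ?sqr_ge0// quad_kernel_le.
by rewrite mulrA ler_wpM2r// lerDl.
Qed.

Let A : R := 2 * (lower_const R n + 1).
Let A_ge1 : 1 <= A. Proof. by rewrite /A; have := lower_const_gt0 R n; lra. Qed.

Definition ball_lower : R := Num.min (quad_slope R n) (v ^+ 3 / 32 / A).

Lemma ball_lower_gt0 : 0 < ball_lower.
Proof.
rewrite lt_min quad_slope_gt0/= !divr_gt0 ?exprn_gt0//.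
exact: lt_le_trans A_ge1.
Qed.

Let quad_ball_ge_small L t : 1 <= L -> 0 < t <= 1 -> t <= L^-1 ->
  v ^+ 3 / 32 * mass L t <= quad_ball n L t.
Proof.
move=> L1 t01 tL; have /andP[t0 t1] := t01; have L0 : 0 < L by exact: lt_le_trans L1.
apply: (@le_trans _ _ (v ^+ 2 / 4 * quad_kernel n L t)).
  have -> : v ^+ 3 / 32 * mass L t = v ^+ 2 / 4 * (v / 8 * mass L t) by field.
  by rewrite ler_wpM2l ?divr_ge0 ?sqr_ge0// quad_kernel_ge.
rewrite -(local_integralZ t tsq); last exact: tame_kernel.
apply: le_local_integral => //; [by apply: tameM; [exact: tame_cst|exact: tame_kernel]|exact: tF|].
move=> xi /andP[_ xt]; rewrite kernel_small ?(le_trans xt)// pow2.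
have -> : v ^+ 2 / 4 * (L ^+ n.+1) ^+ 2 = (v / 2 * L ^+ n.+1) ^+ 2 by field.
have := @ball_transform_ge R n.+1 L xi L0 (le_trans xt tL).
have p0 : 0 <= v / 2 * L ^+ n.+1 by rewrite mulr_ge0 ?divr_ge0 ?exprn_ge0// ltW.
by move=> h; rewrite lerXn2r ?nnegrE// (le_trans p0).
Qed.

Let quad_ball_mono L s t : 0 < L -> s <= t -> quad_ball n L s <= quad_ball n L t.
Proof.
move=> L0 st; apply: le_cube_integral.
- apply: tameM; first by apply: tame_indic; exact: measurable_pball.
  by apply: tameM => //; exact: tF.
- apply: tameM; first by apply: tame_indic; exact: measurable_pball.
  by apply: tameM => //; exact: tF.
move=> xi _; apply: ler_wpM2r; first by rewrite mulr_ge0 ?sqr_ge0.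
rewrite !indicE; case: (boolP (xi \in pball s)) => //; rewrite inE => /(pball_sub st) h.
by rewrite mem_set.
Qed.

(** Three ranges. For t L >= A the shift estimate applies; for t <= 1 / L the transform is at least
    v L^(n+1) / 2. In between, monotonicity from the radius 1 / L loses at most a factor A of the
    mass, whence the division by A in [ball_lower]. *)
Let quad_ball_ge_mass L t : 1 <= L -> 0 < t <= quad_radius R n ->
  ball_lower * mass L t <= quad_ball n L t.
Proof.
move=> L1 tr; have /andP[t0 tq] := tr; have L0 : 0 < L by exact: lt_le_trans L1.
have A0 : 0 < A by exact: lt_le_trans A_ge1.
have t1 : t <= 1.
  apply: (le_trans tq); rewrite ge_min; apply/orP; left.
  by rewrite invf_le1 ?ltr0n// ler1n.
have m0 := mass_ge0 L0 t0.
have [bl1 bl2] : ball_lower <= quad_slope R n /\ ball_lower <= v ^+ 3 / 32 / A.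
  by apply/andP; rewrite -le_min.
have v3 : 0 <= v ^+ 3 / 32 by rewrite divr_ge0// exprn_ge0// ltW.
case: (leP A (t * L)) => tA.
  apply: le_trans (quad_ball_ge L1 tr tA).
  rewrite -mulrA; apply: ler_pM => //; first by rewrite ltW// ball_lower_gt0.
  exact: mass_le.
have blA : ball_lower * A <= v ^+ 3 / 32 by rewrite -ler_pdivlMr.
case: (leP t L^-1) => tL.
  apply: le_trans (quad_ball_ge_small L1 (introT andP (conj t0 t1)) tL).
  rewrite ler_wpM2r// (le_trans bl2)// ler_pdivrMr// ler_peMr//.
apply: le_trans (quad_ball_mono L0 (ltW tL)).
have Li : 0 < L^-1 <= 1 by rewrite invr_gt0 L0 invf_le1.
apply: le_trans (quad_ball_ge_small L1 Li (lexx _)).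
rewrite mass_inv//; apply: (@le_trans _ _ (ball_lower * A * (L^-1 * L ^+ n))); last first.
  by rewrite ler_wpM2r// mulr_ge0 ?invr_ge0 ?exprn_ge0 ?(ltW L0).
rewrite -mulrA ler_wpM2l ?(ltW ball_lower_gt0)// mass_large// mulrA.
rewrite ler_wpM2r ?exprn_ge0 ?(ltW L0)// ler_pdivlMr//; exact: ltW.
Qed.

Lemma quad_ball_le_kernel L t : 1 <= L -> 0 < t <= 1 ->
  quad_ball n L t <= 8 / v * (2 ^+ n.+3 * ball_upper) * quad_kernel n L (t / 2).
Proof.
move=> L1 t01; have /andP[t0 t1] := t01; have L0 : 0 < L by exact: lt_le_trans L1.
have t2 : 0 < t / 2 <= 1 by rewrite divr_gt0//=; lra.
apply: (le_trans (quad_ball_le_mass L1 t01)).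
apply: (@le_trans _ _ (ball_upper * (2 ^+ n.+3 * mass L (t / 2)))).
  by rewrite ler_wpM2l ?(ltW ball_upper_gt0)// mass_halve.
have h := quad_kernel_ge n L0 t2; rewrite -/(mass _ _) -/v in h.
have c0 : 0 <= 8 / v * (2 ^+ n.+3 * ball_upper).
  by rewrite mulr_ge0 ?divr_ge0 ?(ltW v_gt0)// mulr_ge0 ?exprn_ge0// ltW// ball_upper_gt0.
apply: le_trans (ler_wpM2l c0 h).
rewrite le_eqVlt; apply/orP; left; apply/eqP.
by move: (mass _ _) ball_upper (2 ^+ _) => m b w; field; rewrite gt_eqF.
Qed.

Lemma quad_kernel_le_ball L t : 1 <= L -> 0 < t <= 1 -> t <= quad_radius R n ->
  quad_kernel n L t <= ball_lower^-1 * (2 ^+ n.+3 * kernel_const R n) * quad_ball n L (t / 2).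
Proof.
move=> L1 t01 tq; have /andP[t0 t1] := t01; have L0 : 0 < L by exact: lt_le_trans L1.
have t2 : 0 < t / 2 <= quad_radius R n by rewrite divr_gt0//=; lra.
apply: (le_trans (quad_kernel_le n L0 t01)); rewrite -/(mass L t).
apply: (@le_trans _ _ (kernel_const R n * (2 ^+ n.+3 * mass L (t / 2)))).
  by rewrite ler_wpM2l ?(ltW (kernel_const_gt0 R n))// mass_halve.
have c0 : 0 <= ball_lower^-1 * (2 ^+ n.+3 * kernel_const R n).
  by rewrite mulr_ge0 ?invr_ge0 ?(ltW ball_lower_gt0)// mulr_ge0 ?exprn_ge0// ltW// kernel_const_gt0.
apply: le_trans (ler_wpM2l c0 (quad_ball_ge_mass L1 t2)).
have := ball_lower_gt0; rewrite le_eqVlt => b0; apply/orP; left; apply/eqP; move: b0.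
by move: (mass _ _) (kernel_const R n) (2 ^+ _) ball_lower => m k w b b0; field; rewrite gt_eqF.
Qed.

Section regular.
Variable S : 'rV[R]_n.+1 -> R.
Hypotheses (mS : measurable_fun setT S) (S0 : forall x, 0 <= S x) (tS : tame S)
  (S_reg : regular_at_origin S).

(** The squared transform along the first axis; by radiality it gives the squared transform
    everywhere as a function of the norm. *)
Let profile L r : R := ball_transform L (r *: delta_mx ord0 ord0 : 'rV[R]_n.+1) ^+ 2.

Let profileE L xi : 0 < L -> profile L (enorm xi) = ball_transform L xi ^+ 2.
Proof.
move=> L0; rewrite /profile; congr (_ ^+ 2); apply: ball_transform_radial; first exact: ltW.
rewrite enormZ ger0_norm ?enorm_ge0//.
suff -> : enorm (delta_mx ord0 ord0 : 'rV[R]_n.+1) = 1 by rewrite mulr1.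
apply/eqP; rewrite -(@eqrXn2 _ 2) ?enorm_ge0// expr1n -dotpp /dotp.
rewrite (bigD1 ord0)//= mxE !eqxx mulr1 big1 ?addr0// => i i0.
by rewrite mxE (negbTE i0) andbF mulr0.
Qed.

Let measurable_profile L : 0 < L -> measurable_fun setT (profile L).
Proof.
move=> L0; apply: measurable_funX.
apply: (measurableT_comp (measurable_ball_transform (ltW L0))).
apply/measurable_fun_rowP => i.
rewrite (_ : (fun t => _) = (fun t : R => t * (delta_mx ord0 ord0 : 'rV[R]_n.+1) ord0 i)).
  exact: measurable_funM.
by apply/funext => r; rewrite mxE.
Qed.

Let local_integralE (W : 'rV[R]_n.+1 -> R) e f : tame W -> tame f -> e <= pi ->
  (\int[lebesgue_row R n.+1]_(x in pball e) (W x * f x)%:E = (local_integral W e f)%:E)%E.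
Proof.
move=> tW tf epi; apply: cube_integral_indic; [exact: measurable_pball|exact: pball_sub_cube|].
exact: tameM.
Qed.

Let combine (C c c' b b' g l : R) : 0 <= C -> 0 <= c' -> 0 <= b' -> 0 <= g -> 0 <= l ->
  C * (c * g + b * l) <= C * (c + c') * g + C * (b + b') * l.
Proof.
move=> C0 c0 b0 g0 l0; rewrite -!mulrA -mulrDr ler_wpM2l//.
by apply: lerD; rewrite ler_wpM2r// lerDl.
Qed.

(** [regular_radial_compare] in both directions, fed with the masses over balls. The mass over the
    largest ball is O(L^n) and becomes the additive term; the constants of the two directions are
    added so that one pair serves both. *)
Lemma local_radial_compare : exists e a b : R,
  [/\ 0 < e, e <= 1, e <= n.+1%:R^-1, 0 < a & 0 < b] /\
  forall L, 1 <= L ->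
    local_integral S e (fun xi => ball_transform L xi ^+ 2) <=
      a * local_integral S e (fun xi => kernel n L (enorm xi)) + b * L ^+ n /\
    local_integral S e (fun xi => kernel n L (enorm xi)) <=
      a * local_integral S e (fun xi => ball_transform L xi ^+ 2) + b * L ^+ n.
Proof.
have [eps [C [eps0 C0 H]]] := regular_radial_compare (isT : (0 < n.+1)%N) mS S0 S_reg.
pose e := Num.min eps (quad_radius R n).
have e0 : 0 < e by rewrite lt_min eps0 quad_radius_gt0.
have eeps : e <= eps by rewrite ge_min lexx.
have eq : e <= quad_radius R n by rewrite ge_min lexx orbT.
have en : e <= n.+1%:R^-1 by rewrite (le_trans eq)// ge_min lexx.
have e1 : e <= 1 by rewrite (le_trans en)// invf_le1 ?ltr0n// ler1n.
have epi : e <= pi by rewrite (le_trans e1)// (le_trans _ (pi_ge2 R))// ler1n.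
pose c1 := 8 / v * (2 ^+ n.+3 * ball_upper).
pose c2 := ball_lower^-1 * (2 ^+ n.+3 * kernel_const R n).
have c10 : 0 < c1.
  by rewrite mulr_gt0 ?divr_gt0// mulr_gt0 ?exprn_gt0// ball_upper_gt0.
have c20 : 0 < c2.
  by rewrite mulr_gt0 ?invr_gt0 ?ball_lower_gt0// mulr_gt0 ?exprn_gt0// kernel_const_gt0.
pose b1 := 2 * quad_const R n + 2 * error_const R n; pose b2 := kernel_const R n.
have b20 : 0 < b2 by exact: kernel_const_gt0.
have b10 : 0 <= b1 by exact: qc_ge0.
exists e, (C * (c1 + c2)), (C * (b1 + b2)); split.
  by split; rewrite // mulr_gt0//; [rewrite addr_gt0|rewrite ltr_wpDl].
move=> L L1; have L0 : 0 < L by exact: lt_le_trans L1.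
have Ln : 0 <= L ^+ n by rewrite exprn_ge0// ltW.
have tk : tame (fun xi : 'rV[R]_n.+1 => kernel n L (enorm xi)) by exact: tame_kernel.
have tf := tF L0.
have pE : (fun xi => profile L (enorm xi)) = (fun xi => ball_transform L xi ^+ 2).
  by apply/funext => xi; rewrite profileE.
have k0 r : 0 <= kernel n L r by exact: kernel_ge0.
have p0 r : 0 <= profile L r by exact: sqr_ge0.
have tp : tame (fun xi => profile L (enorm xi)) by rewrite pE.
have sF t : t <= pi -> (\int[lebesgue_row R n.+1]_(x in pball t)
    (enorm x ^+ 2 * profile L (enorm x))%:E = (quad_ball n L t)%:E)%E.
  by move=> tpi; rewrite (local_integralE tsq tp tpi) pE.
have sk t : t <= pi -> (\int[lebesgue_row R n.+1]_(x in pball t)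
    (enorm x ^+ 2 * kernel n L (enorm x))%:E = (quad_kernel n L t)%:E)%E.
  exact: local_integralE tsq tk.
have g0 : 0 <= local_integral S e (fun xi => kernel n L (enorm xi)).
  by apply: local_integral_ge0 => // xi; exact: kernel_ge0.
have f0 : 0 <= local_integral S e (fun xi => ball_transform L xi ^+ 2).
  by apply: local_integral_ge0 => // xi; exact: sqr_ge0.
have half t : t <= e -> 0 < t -> t / 2 <= pi by move=> ? ?; lra.
split.
- have := H e c1 (b1 * L ^+ n) (profile L) (kernel n L) e0 eeps (measurable_profile L0)
    (measurable_kernel n L0) p0 k0 (ltW c10) (mulr_ge0 b10 Ln).
  rewrite !local_integralE// pE => h.
  have : local_integral S e (fun xi => ball_transform L xi ^+ 2) <=
      C * (c1 * local_integral S e (fun xi => kernel n L (enorm xi)) + b1 * L ^+ n).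
    rewrite -lee_fin !EFinM EFinD !EFinM -EFinM; apply: h.
      move=> t t0 te; have t1 := le_trans te e1.
      rewrite sF ?(le_trans te)// sk ?half// -EFinM lee_fin.
      by apply: quad_ball_le_kernel => //; rewrite t0.
    rewrite lee_fin; apply: (le_trans (quad_ball_le n L1 _)); first by rewrite e0.
    by rewrite -/b1 ler_wpM2r// ler_piMr.
  by move=> /le_trans; apply; apply: combine; rewrite ?(ltW C0) ?(ltW c20) ?(ltW b20).
- have := H e c2 (b2 * L ^+ n) (kernel n L) (profile L) e0 eeps
    (measurable_kernel n L0) (measurable_profile L0) k0 p0 (ltW c20) (mulr_ge0 (ltW b20) Ln).
  rewrite !local_integralE// pE => h.
  have : local_integral S e (fun xi => kernel n L (enorm xi)) <=
      C * (c2 * local_integral S e (fun xi => ball_transform L xi ^+ 2) + b2 * L ^+ n).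
    rewrite -lee_fin !EFinM EFinD !EFinM -EFinM; apply: h.
      move=> t t0 te; have t1 := le_trans te e1.
      rewrite sk ?(le_trans te)// sF ?half// -EFinM lee_fin.
      by apply: quad_kernel_le_ball; rewrite ?t0// (le_trans te).
    rewrite lee_fin; apply: (le_trans (quad_kernel_le_linear n L0 _)); first by rewrite e0.
    by rewrite -/b2 ler_wpM2r// ler_piMr// ltW.
  move=> /le_trans; apply; rewrite [c1 + c2]addrC [b1 + b2]addrC.
  by apply: combine; rewrite ?(ltW C0) ?(ltW c10).
Qed.

End regular.

End kernel_comparison.

(** * Lower bound on the variance *)

(* A point p of the ball is a top point if p + e0 is not in the ball.  The tails
   (the coordinates other than the first) of the points below are close to
   s * w, with w_i = (M + 3) (2 M + 1)^i, where the sphere is so steep that a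
   nonzero shift of the tail by at most M moves the height by more than M + 1.
   Then no other top or bottom point lies within distance M of p. *)
Section top_points.
Variables (R : realType) (n : nat).

(** Uniqueness of balanced expansions in base 2 M + 1: a lowest digit of size at most M that is a
    multiple of 2 M + 1 is zero. *)
Lemma balanced_digits (M m : nat) (k : 'I_m -> int) :
  (forall i, - M%:Z <= k i <= M%:Z) ->
  \sum_(i < m) k i * ((2 * M).+1 ^ i)%N%:Z = 0 -> forall i, k i = 0.
Proof.
elim: m k => [k _ _ []//|m IH k kM]; rewrite big_ord_recl expn0 mulr1 => e.
have e1 : \sum_(i < m) k (lift ord0 i) * ((2 * M).+1 ^ lift ord0 i)%N%:Z =
    (2 * M).+1%:Z * \sum_(i < m) k (lift ord0 i) * ((2 * M).+1 ^ i)%N%:Z.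
  rewrite mulr_sumr; apply: eq_bigr => i _.
  by rewrite mulrCA /= /bump leq0n add1n expnS PoszM.
move: e; rewrite e1; set z := \sum_(i < m) _ => e.
have [k1 k2] := andP (kM ord0).
have z0 : z = 0 by nia.
have k00 : k ord0 = 0 by move: e; rewrite z0 mulr0 addr0.
move=> i; have [j ->|->//] := unliftP ord0 i.
by apply: (IH (fun i => k (lift ord0 i))) => // a; exact: kM.
Qed.

Let e0 : 'rV[int]_n.+1 := delta_mx ord0 ord0.
Let nsq (x : 'rV[int]_n.+1) : R := enorm (lattice_pt R x) ^+ 2.

Let nsqE x : nsq x = (x ord0 ord0)%:~R ^+ 2 + \sum_(i < n) (x ord0 (lift ord0 i))%:~R ^+ 2.
Proof.
by rewrite /nsq sqr_enorm big_ord_recl mxE; congr (_ + _); apply: eq_bigr => i _; rewrite mxE.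
Qed.

Let nsq_le (L : R) x : 0 <= L -> (enorm (lattice_pt R x) <= L) = (nsq x <= L ^+ 2).
Proof. by move=> L0; rewrite /nsq ler_pXn2r// nnegrE enorm_ge0. Qed.

Let nsqD x y : nsq (x + y) = nsq x + 2 * ((x ord0 ord0)%:~R * (y ord0 ord0)%:~R +
  \sum_(i < n) (x ord0 (lift ord0 i))%:~R * (y ord0 (lift ord0 i))%:~R) + nsq y.
Proof.
rewrite /nsq lattice_ptD sqr_enormD /dotp big_ord_recl !mxE; congr (_ + 2 * (_ + _) + _).
by apply: eq_bigr => i _; rewrite !mxE.
Qed.

Variable M : nat.

Let w (i : 'I_n) : R := M.+3%:R * ((2 * M).+1 ^ i)%:R.

Let w_ge0 i : 0 <= w i. Proof. by rewrite mulr_ge0. Qed.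

(** The sum of the k_i (2 M + 1)^i is a nonzero integer, and w carries the further factor M + 3. *)
Let w_dot (k : 'I_n -> int) : (forall i, - M%:Z <= k i <= M%:Z) ->
  (exists i, k i != 0) ->
  M.+3%:R <= \sum_i w i * (k i)%:~R \/ \sum_i w i * (k i)%:~R <= - M.+3%:R.
Proof.
move=> kM [i0 ki0]; pose z : int := \sum_(i < n) k i * ((2 * M).+1 ^ i)%N%:Z.
have -> : \sum_i w i * (k i)%:~R = M.+3%:R * z%:~R.
  rewrite /z rmorph_sum mulr_sumr; apply: eq_bigr => i _.
  by rewrite rmorphM/= -pmulrn /w -mulrA [_ * (k i)%:~R]mulrC.
have z0 : z != 0.
  by apply/eqP => /(balanced_digits kM)/(_ i0) h; rewrite h eqxx in ki0.
have [z1|z1] : 1 <= z \/ z <= -1 by lia.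
- left; rewrite ler_peMr//.
  by rewrite -[1]/(1%:~R) ler_int.
- right; rewrite -mulrN1 ler_wpM2l//.
  by rewrite -[-1]/((-1)%:~R) ler_int.
Qed.

Let W2 : R := \sum_i w i ^+ 2.
(** Normalization: with s = L / [root], the point of height s over the tail s w lies on the sphere
    of radius L. *)
Let root : R := Num.sqrt (1 + W2).

Let W2_ge0 : 0 <= W2. Proof. by apply: sumr_ge0 => i _; exact: sqr_ge0. Qed.

Let root_gt0 : 0 < root.
Proof. by rewrite sqrtr_gt0 ltr_pwDl. Qed.

(** The tails will fill a cube of side delta s at s w. This delta is small enough for the three
    bounds [delta_le1], [delta_nM] and [delta_w], which control the products and the squares of the
    tails. *)
Let delta : R := (2 * (n%:R * M%:R + 2 * \sum_i w i + n%:R + 1))^-1.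

Let sw_ge0 : 0 <= \sum_i w i. Proof. exact: sumr_ge0. Qed.

Let delta_den : 0 < 2 * (n%:R * M%:R + 2 * \sum_i w i + n%:R + 1).
Proof.
have := sw_ge0; have : 0 <= n%:R * M%:R :> R by rewrite mulr_ge0.
have : 0 <= n%:R :> R by []. lra.
Qed.

Let delta_gt0 : 0 < delta. Proof. by rewrite invr_gt0. Qed.

Let deltaM (a : R) : a <= 2 * (n%:R * M%:R + 2 * \sum_i w i + n%:R + 1) -> delta * a <= 1.
Proof. by move=> h; rewrite mulrC ler_pdivrMr// mul1r. Qed.

Let delta_le1 : delta <= 1.
Proof.
rewrite -[leLHS]mulr1; apply: deltaM.
have := sw_ge0; have : 0 <= n%:R * M%:R :> R by rewrite mulr_ge0.
have : 0 <= n%:R :> R by []. lra.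
Qed.

Let delta_nM : delta * (n%:R * M%:R) <= 1.
Proof.
apply: deltaM; have := sw_ge0; have : 0 <= n%:R * M%:R :> R by rewrite mulr_ge0.
have : 0 <= n%:R :> R by []. lra.
Qed.

Let delta_w : delta * (2 * \sum_i w i + n%:R) <= 2^-1.
Proof.
suff : delta * (2 * (2 * \sum_i w i + n%:R)) <= 1 by lra.
apply: deltaM; have := sw_ge0; have : 0 <= n%:R * M%:R :> R by rewrite mulr_ge0.
have : 0 <= n%:R :> R by []. lra.
Qed.

Section scale.
Variable L : R.
Let s : R := L / root.
(** All of these hold for large L: [sM] raises the top points above the height M + 1, [sN] makes the
    squared length of a shift in the window at most s, and [sd] leaves room for at least one
    tail. *)
Hypotheses (s1 : 1 <= s) (sM : 2 * M%:R + 4 <= s) (sN : n.+1%:R * M.+1%:R ^+ 2 <= s)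
  (sd : 1 <= delta * s).

Let L_gt0 : 0 < L.
Proof. by move: s1; rewrite /s => h; rewrite -(divfK (lt0r_neq0 root_gt0) L) mulr_gt0//; lra. Qed.

Let sqrL : L ^+ 2 = s ^+ 2 * (1 + W2).
Proof.
rewrite /s expr_div_n -[1 + W2]sqr_sqrtr; last by rewrite addr_ge0.
by rewrite divfK// expf_neq0// gt_eqF.
Qed.

Let s0 : 0 <= s. Proof. by have := s1; lra. Qed.

(** The squares exceed s^2 W2 by at most s^2 / 2, so that a height of order s remains above every
    tail. *)
Let tail_sq_le (tail : 'I_n -> R) : (forall i, s * w i <= tail i <= s * w i + delta * s) ->
  \sum_i tail i ^+ 2 <= s ^+ 2 * (W2 + 2^-1).
Proof.
move=> p_tail; apply: (@le_trans _ _ (\sum_i s ^+ 2 * (w i ^+ 2 + delta * (2 * w i + 1)))).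
  apply: ler_sum => i _; have /andP[h1 h2] := p_tail i.
  apply: (@le_trans _ _ ((s * w i + delta * s) ^+ 2)).
    have sw : 0 <= s * w i by rewrite mulr_ge0.
    apply: lerXn2r; rewrite ?nnegrE//; first exact: le_trans h1.
    by rewrite addr_ge0// mulr_ge0// ltW.
  have -> : (s * w i + delta * s) ^+ 2 = s ^+ 2 * (w i ^+ 2 + delta * (2 * w i + delta)) by ring.
  by rewrite ler_wpM2l ?sqr_ge0// lerD2l ler_wpM2l ?(ltW delta_gt0)// lerD2l.
rewrite -mulr_sumr ler_wpM2l ?sqr_ge0// big_split/= lerD2l -mulr_sumr big_split/=.
by rewrite -mulr_sumr sumr_const card_ord.
Qed.

Section point.
Variable p : 'rV[int]_n.+1.
Let tail (i : 'I_n) : R := (p ord0 (lift ord0 i))%:~R.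
Let p0 : R := (p ord0 ord0)%:~R.
Hypotheses (p_tail : forall i, s * w i <= tail i <= s * w i + delta * s)
  (p_in : nsq p <= L ^+ 2) (p_top : L ^+ 2 < (p0 + 1) ^+ 2 + \sum_i tail i ^+ 2)
  (p0_ge0 : 0 <= p0).

Let tail_sq_ge : s ^+ 2 * W2 <= \sum_i tail i ^+ 2.
Proof.
rewrite mulr_sumr; apply: ler_sum => i _; rewrite -exprMn.
have /andP[h _] := p_tail i.
have sw : 0 <= s * w i by rewrite mulr_ge0.
by apply: lerXn2r; rewrite ?nnegrE//; exact: le_trans h.
Qed.

Let p0_le : p0 <= s.
Proof.
rewrite -(@ler_pXn2r _ 2)// ?nnegrE//.
by have := p_in; rewrite nsqE sqrL -/p0 => h; have := tail_sq_ge; rewrite /tail; lra.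
Qed.

Let p0_ge : M%:R + 1 <= p0.
Proof.
have h : (s / 2) ^+ 2 < (p0 + 1) ^+ 2.
  have -> : (s / 2) ^+ 2 = s ^+ 2 / 4 by field.
  have := p_top; rewrite sqrL; have := tail_sq_le p_tail; have : 0 < s ^+ 2 by rewrite exprn_gt0//; have := s1; lra.
  by lra.
have : s / 2 < p0 + 1.
  have q1 : 0 <= s / 2 by rewrite divr_ge0.
  have q2 : 0 <= p0 + 1 by rewrite addr_ge0.
  by rewrite -(@ltr_pXn2r _ 2)// ?nnegrE.
by have := sM; lra.
Qed.

Let nsq_shift k : nsq (p + k) = nsq p + 2 * (p0 * (k ord0 ord0)%:~R +
  \sum_i tail i * (k ord0 (lift ord0 i))%:~R) + nsq k.
Proof. exact: nsqD. Qed.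

Let nsq_p_gt : L ^+ 2 - 2 * p0 - 1 < nsq p.
Proof. by have := p_top; rewrite nsqE sqrrD -/p0 /tail; lra. Qed.

(** Replacing the tail by s w costs at most n (delta s) M <= s. *)
Let tail_dot k : (forall i, `|k i| <= M%:R) ->
  `|\sum_i tail i * k i - s * \sum_i w i * k i| <= s.
Proof.
move=> kM; rewrite mulr_sumr -sumrB; apply: (le_trans (ler_norm_sum _ _ _)).
apply: (@le_trans _ _ (\sum_(i < n) delta * s * M%:R)).
  apply: ler_sum => i _; rewrite mulrA -mulrBl normrM.
  have /andP[h1 h2] := p_tail i; apply: ler_pM => //.
  by rewrite ger0_norm; lra.
rewrite sumr_const card_ord -[leLHS]mulr_natl.
have -> : n%:R * (delta * s * M%:R) = delta * (n%:R * M%:R) * s by ring.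
by rewrite ler_piMl.
Qed.

Let above (r x y : R) : r * M.+3%:R <= r * y -> - r <= x - r * y -> r * (M%:R + 2) <= x.
Proof. by rewrite -!natr1 !mulrDr !mulr1; move: (r * _) (r * y) => a b; lra. Qed.

Let below (r x y : R) : r * y <= r * - M.+3%:R -> x - r * y <= r -> x <= - (r * (M%:R + 2)).
Proof. by rewrite -!natr1 mulrN !mulrDr !mulr1; move: (r * _) (r * y) => a b; lra. Qed.

(** The digits give s (M + 3), and replacing the tail by s w takes away at most s. *)
Let slanted (k : 'rV[int]_n.+1) : (forall i : 'I_n, - M%:Z <= k ord0 (lift ord0 i) <= M%:Z) ->
  (exists i : 'I_n, k ord0 (lift ord0 i) != 0) ->
  s * (M%:R + 2) <= \sum_i tail i * (k ord0 (lift ord0 i))%:~R \/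
  \sum_i tail i * (k ord0 (lift ord0 i))%:~R <= - (s * (M%:R + 2)).
Proof.
move=> kM ex.
have kM' i : `|(k ord0 (lift ord0 i))%:~R : R| <= M%:R.
  by rewrite ler_norml [M%:R]pmulrn -mulrNz !ler_int; exact: kM.
have := tail_dot kM'; rewrite ler_norml => /andP[h1 h2].
have [h|h] := w_dot kM ex; have {}h := ler_wpM2l s0 h.
- by left; exact: above h1.
- by right; exact: below h2.
Qed.

(** A nonzero tail of k moves the squared norm by at least 2 s (M + 2). An opposing vertical move
    and |k|^2 <= s cannot offset this, so the sign of the product with the tail decides membership.
    The vertical range reaches M + 1 in order to cover both k and e0 + k. *)
Let slanted_mem (k : 'rV[int]_n.+1) : (forall i : 'I_n, - M%:Z <= k ord0 (lift ord0 i) <= M%:Z) ->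
  (exists i : 'I_n, k ord0 (lift ord0 i) != 0) ->
  - M%:Z <= k ord0 ord0 <= M.+1%:Z ->
  nsq (p + k) <= L ^+ 2 <->
  \sum_i tail i * (k ord0 (lift ord0 i))%:~R < 0.
Proof.
move=> kM ex /andP[k1 k2].
have {k1} k1 : - M%:R <= (k ord0 ord0)%:~R :> R by rewrite [M%:R]pmulrn -mulrNz ler_int.
have {k2} k2 : (k ord0 ord0)%:~R <= M%:R + 1 :> R by rewrite natr1 [_%:R]pmulrn ler_int.
have M0 : 0 <= M%:R :> R by [].
have sM0 : 0 <= s * M%:R by rewrite mulr_ge0.
have b1 : - (s * M%:R) <= p0 * (k ord0 ord0)%:~R.
  apply: (@le_trans _ _ (p0 * - M%:R)); last by rewrite ler_wpM2l.
  by rewrite mulrN lerN2 ler_wpM2r.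
have b2 : p0 * (k ord0 ord0)%:~R <= s * (M%:R + 1).
  apply: (@le_trans _ _ (p0 * (M%:R + 1))); first by rewrite ler_wpM2l.
  by rewrite ler_wpM2r// addr_ge0.
have nk : nsq k <= s.
  apply: le_trans sN; rewrite nsqE mulr_natl mulrS; apply: lerD.
    by apply: norm_le_sqr; rewrite [leRHS]ger0_norm// ler_norml -natr1; apply/andP; split; lra.
  apply: (@le_trans _ _ (\sum_(i < n) M.+1%:R ^+ 2)); last by rewrite sumr_const card_ord.
  apply: ler_sum => i _; apply: norm_le_sqr; rewrite [leRHS]ger0_norm//.
  rewrite ler_norml [_%:R]pmulrn -mulrNz !ler_int.
  by have := kM i; move: (k _ _) => z; clear; lia.
rewrite nsq_shift; have [h|h] := slanted kM ex; split => H.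
- exfalso; have := nsq_p_gt; have : 0 <= nsq k by exact: sqr_ge0.
  have := p0_le; have := s1; move: h H b1; move: (\sum_i _) => a; lra.
- by exfalso; have := s1; move: h H; move: (\sum_i _) => a; lra.
- by apply: (le_lt_trans h); rewrite oppr_lt0 mulr_gt0 ?ltr_wpDl//; have := s1; lra.
- by have := p_in; have := s1; move: h H b2; move: (\sum_i _) => a; lra.
Qed.

Let enorm_shift_mem k : (enorm (lattice_pt R (p + k)) <= L) = (nsq (p + k) <= L ^+ 2).
Proof. by rewrite nsq_le// ltW. Qed.

Lemma top_point_in : enorm (lattice_pt R p) <= L.
Proof. by rewrite nsq_le// ltW. Qed.

Let e0E : e0 ord0 ord0 = 1. Proof. by rewrite /e0 mxE !eqxx. Qed.

Let e0_tail (i : 'I_n) : e0 ord0 (lift ord0 i) = 0.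
Proof. by rewrite /e0 mxE eq_sym (negbTE (neq_lift _ _)) andbF. Qed.

Let nsq_vertical (k : 'rV[int]_n.+1) : (forall i : 'I_n, k ord0 (lift ord0 i) = 0) ->
  nsq (p + k) = (p0 + (k ord0 ord0)%:~R) ^+ 2 + \sum_i tail i ^+ 2.
Proof.
move=> k0; rewrite nsqE !mxE intrD -/p0; congr (_ + _).
by apply: eq_bigr => i _; rewrite !mxE k0 addr0.
Qed.

Lemma top_point_out : L < enorm (lattice_pt R (p + e0)).
Proof.
rewrite ltNge enorm_shift_mem -ltNge nsq_vertical ?e0E//.
Qed.

(** Within the window the vertical line leaves the ball only above p; its lower end is out of reach
    because p0 >= M + 1. *)
Let vertical_mem (k : 'rV[int]_n.+1) : (forall i : 'I_n, k ord0 (lift ord0 i) = 0) ->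
  - M%:Z <= k ord0 ord0 -> (nsq (p + k) <= L ^+ 2) = (k ord0 ord0 <= 0).
Proof.
move=> kt k1; have {k1} : - M%:R <= (k ord0 ord0)%:~R :> R by rewrite [M%:R]pmulrn -mulrNz ler_int.
have := p0_ge; rewrite nsq_vertical//; case: (lerP (k ord0 ord0) 0) => k0 pM kM.
  apply: le_trans p_in; rewrite nsqE -/p0 lerD2r; apply: norm_le_sqr.
  have {}k0 : (k ord0 ord0)%:~R <= 0 :> R by rewrite -[0]/(0%:~R) ler_int.
  by rewrite [leRHS]ger0_norm// ler_norml; apply/andP; split; lra.
apply/negbTE; rewrite -ltNge; apply: (lt_le_trans p_top); rewrite lerD2r.
have {}k0 : 1 <= (k ord0 ord0)%:~R :> R by rewrite -[1]/(1%:~R) ler_int.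
apply: lerXn2r; rewrite ?nnegrE; [exact: addr_ge0| |by rewrite lerD2l].
by apply: addr_ge0 => //; exact: le_trans k0.
Qed.

(** The shifts k and e0 + k have the same tail. If it is nonzero, it decides membership for both; if
    it is zero, the height z of k is a nonzero integer, and z <= 0 and 1 + z <= 0 are equivalent. *)
Lemma top_point_window k : k \in lbox n.+1 M -> k != 0 ->
  (enorm (lattice_pt R (p + k)) <= L) = (enorm (lattice_pt R (p + e0 + k)) <= L).
Proof.
rewrite mem_lbox => /forallP kM k0; rewrite -addrA !enorm_shift_mem.
have ek0 : (e0 + k) ord0 ord0 = 1 + k ord0 ord0 by rewrite mxE e0E.
have ekt (i : 'I_n) : (e0 + k) ord0 (lift ord0 i) = k ord0 (lift ord0 i).
  by rewrite mxE e0_tail add0r.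
have kMt (i : 'I_n) : - M%:Z <= k ord0 (lift ord0 i) <= M%:Z by exact: kM.
have kM0 : - M%:Z <= k ord0 ord0 <= M%:Z by exact: kM.
case: (pselect (exists i : 'I_n, k ord0 (lift ord0 i) != 0)) => [ex|nex].
  have h1 : - M%:Z <= k ord0 ord0 <= M.+1%:Z by move: kM0; move: (k _ _) => z; clear; lia.
  have h2 : - M%:Z <= (e0 + k) ord0 ord0 <= M.+1%:Z.
    by rewrite ek0; move: kM0; move: (k _ _) => z; clear; lia.
  have m1 := slanted_mem kMt ex h1.
  have m2 : nsq (p + (e0 + k)) <= L ^+ 2 <->
      \sum_i tail i * ((e0 + k) ord0 (lift ord0 i))%:~R < 0.
    apply: slanted_mem => // [i|]; first by rewrite ekt.
    by case: ex => i h; exists i; rewrite ekt.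
  have e : \sum_i tail i * ((e0 + k) ord0 (lift ord0 i))%:~R =
      \sum_i tail i * (k ord0 (lift ord0 i))%:~R by apply: eq_bigr => i _; rewrite ekt.
  by rewrite e in m2; apply/idP/idP => h; [apply/m2/m1|apply/m1/m2].
have kt (i : 'I_n) : k ord0 (lift ord0 i) = 0.
  by apply/eqP/negPn/negP => h; apply: nex; exists i.
have k00 : k ord0 ord0 != 0.
  apply: contra k0 => /eqP h; apply/eqP/rowP => i; rewrite mxE.
  by have [j ->|->//] := unliftP ord0 i; rewrite kt.
have [kl _] := andP kM0.
have ekt0 (i : 'I_n) : (e0 + k) ord0 (lift ord0 i) = 0 by rewrite ekt.
have ekl : - M%:Z <= (e0 + k) ord0 ord0.
  by rewrite ek0; move: kl; move: (k _ _) => z; clear; lia.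
rewrite (vertical_mem kt kl) (vertical_mem ekt0 ekl) ek0.
by move: k00; move: (k _ _) => z; clear; lia.
Qed.

End point.

Let tails := Num.Def.trunc (delta * s).

(** The first integer above s w_i; adding at most [tails] - 1 to it stays below s w_i + delta s. *)
Let base (i : 'I_n) : int := Num.floor (s * w i) + 1.

Let height (q : {ffun 'I_n -> 'I_tails}) : R :=
  Num.sqrt (L ^+ 2 - \sum_i (base i + (q i : nat)%:Z)%:~R ^+ 2).

Let top (q : {ffun 'I_n -> 'I_tails}) : 'rV[int]_n.+1 :=
  \row_k oapp (fun i => base i + (q i : nat)%:Z) (Num.floor (height q)) (unlift ord0 k).

Let top0 q : top q ord0 ord0 = Num.floor (height q).
Proof. by rewrite mxE unlift_none. Qed.

Let topt q (i : 'I_n) : top q ord0 (lift ord0 i) = base i + (q i : nat)%:Z.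
Proof. by rewrite mxE liftK. Qed.

Let top_inj : injective top.
Proof.
move=> q q' e; apply/ffunP => i; apply/val_inj => /=.
have := congr1 (fun x : 'rV[int]_n.+1 => x ord0 (lift ord0 i)) e.
by rewrite !topt => /addrI [].
Qed.

Let top_tail q i : s * w i <= (top q ord0 (lift ord0 i))%:~R <= s * w i + delta * s.
Proof.
rewrite topt !intrD -pmulrn.
have f1 : (Num.floor (s * w i))%:~R <= s * w i by apply: floor_le.
have f2 : s * w i < (Num.floor (s * w i))%:~R + 1.
  by have /andP[_] := floor_itv (s * w i); rewrite intrD.
have q0 : 0 <= (q i : nat)%:R :> R by [].
have q1 : (q i : nat)%:R + 1 <= delta * s.
  apply: (@le_trans _ _ tails%:R); first by rewrite natr1 ler_nat.
  by rewrite truncn_le// mulr_ge0// ltW.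
by apply/andP; split; lra.
Qed.

Let gap_ge0 (q : {ffun 'I_n -> 'I_tails}) : 0 <= L ^+ 2 - \sum_i (base i + (q i : nat)%:Z)%:~R ^+ 2.
Proof.
have := tail_sq_le (top_tail q).
rewrite (eq_bigr (fun i => (base i + (q i : nat)%:Z)%:~R ^+ 2)); last first.
  by move=> i _; rewrite topt.
move=> h; rewrite subr_ge0 (le_trans h)// sqrL ler_wpM2l ?sqr_ge0//; lra.
Qed.

Let top_in q : nsq (top q) <= L ^+ 2.
Proof.
rewrite nsqE top0 (eq_bigr (fun i => (base i + (q i : nat)%:Z)%:~R ^+ 2)); last first.
  by move=> i _; rewrite topt.
rewrite -lerBrDr -[leRHS]sqr_sqrtr ?gap_ge0// -/(height q).
have h0 : 0 <= height q by exact: sqrtr_ge0.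
apply: lerXn2r; rewrite ?nnegrE//; last by apply: floor_le.
by rewrite -[0]/(0%:~R) ler_int floor_ge0.
Qed.

Let top_top q : L ^+ 2 < ((top q ord0 ord0)%:~R + 1) ^+ 2 +
  \sum_i (top q ord0 (lift ord0 i))%:~R ^+ 2.
Proof.
rewrite top0 (eq_bigr (fun i => (base i + (q i : nat)%:Z)%:~R ^+ 2)); last first.
  by move=> i _; rewrite topt.
rewrite -ltrBlDr -[ltLHS]sqr_sqrtr ?gap_ge0// -/(height q).
have h0 : 0 <= height q by exact: sqrtr_ge0.
have h1 : height q < (Num.floor (height q))%:~R + 1.
  by have /andP[_] := floor_itv (height q); rewrite intrD.
by rewrite ltr_pXn2r ?nnegrE// (le_trans h0)// ltW.
Qed.

Let top_ge0 q : 0 <= (top q ord0 ord0)%:~R :> R.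
Proof. by rewrite top0 -[0]/(0%:~R) ler_int floor_ge0 sqrtr_ge0. Qed.

Lemma top_points_at_scale : exists2 U : seq 'rV[int]_n.+1,
  uniq U /\ (delta * s / 2) ^+ n <= (size U)%:R &
  {in U, forall p, [/\ enorm (lattice_pt R p) <= L, L < enorm (lattice_pt R (p + e0)) &
    forall k, k \in lbox n.+1 M -> k != 0 ->
      (enorm (lattice_pt R (p + k)) <= L) = (enorm (lattice_pt R (p + e0 + k)) <= L)]}.
Proof.
exists (map top (enum {ffun 'I_n -> 'I_tails})).
  split; first by rewrite map_inj_uniq ?enum_uniq//; exact: top_inj.
  rewrite size_map -cardE card_ffun !card_ord natrX lerXn2r ?nnegrE ?divr_ge0//.
    by rewrite mulr_ge0// ltW.
  have t1 : delta * s < tails.+1%:R by exact: truncnS_gt.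
  have : 1 <= tails%:R :> R by rewrite ler1n truncn_gt0.
  by move: t1; rewrite -natr1; lra.
move=> p /mapP[q _ ->]; split.
- by apply: top_point_in; exact: top_in.
- by apply: top_point_out; [exact: top_top].
- by move=> k kM k0; apply: top_point_window => //; exact: top_tail.
Qed.

End scale.

Lemma top_points : exists c L0 : R, [/\ 0 < c, 1 <= L0 & forall L, L0 <= L ->
  exists2 U : seq 'rV[int]_n.+1, uniq U /\ c * L ^+ n <= (size U)%:R &
  {in U, forall p, [/\ enorm (lattice_pt R p) <= L, L < enorm (lattice_pt R (p + e0)) &
    forall k, k \in lbox n.+1 M -> k != 0 ->
      (enorm (lattice_pt R (p + k)) <= L) = (enorm (lattice_pt R (p + e0 + k)) <= L)]}].
Proof.
pose B : R := 1 + (2 * M%:R + 4) + n.+1%:R * M.+1%:R ^+ 2 + delta^-1.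
have M0 : 0 <= M%:R :> R by [].
have N0 : 0 <= n.+1%:R * M.+1%:R ^+ 2 :> R by rewrite mulr_ge0// sqr_ge0.
have d0 : 0 <= delta^-1 by rewrite invr_ge0 ltW.
exists ((delta / (2 * root)) ^+ n), (1 + root * B); split.
- by rewrite exprn_gt0// divr_gt0// mulr_gt0.
- by rewrite lerDl mulr_ge0 ?(ltW root_gt0)// /B; lra.
move=> L LB; have sB : B <= L / root.
  by rewrite ler_pdivlMr// mulrC; lra.
have [||||U U1 U2] := @top_points_at_scale L.
- by move: sB; rewrite /B; lra.
- by move: sB; rewrite /B; lra.
- by move: sB; rewrite /B; lra.
- rewrite -[leLHS](@mulfV _ delta) ?gt_eqF// ler_pM2l//.
  by move: sB; rewrite /B; lra.
exists U => //; split; first by case: U1.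
case: U1 => _; apply: le_trans; rewrite -exprMn le_eqVlt; apply/orP; left; apply/eqP.
by congr (_ ^+ _); field; rewrite gt_eqF.
Qed.

End top_points.

(** * Cauchy-Schwarz for the ball against differences at its top *)

Section variance_lower_bound.
Variables (R : realType) (n : nat) (K : 'rV[int]_n.+1 -> R).
Hypothesis K_l1 : summable [set: 'rV[int]_n.+1] (fun j => (K j)%:E).
Hypotheses (K_even : forall j, K (- j) = K j) (K_0 : K 0 = 1).
Hypothesis K_psd : forall s (a : 'rV[int]_n.+1 -> R),
    0 <= \sum_(i <- s) \sum_(j <- s) a i * a j * K (i - j).

Let e0 : 'rV[int]_n.+1 := delta_mx ord0 ord0.

Lemma seq_sub_lbox (s : seq 'rV[int]_n.+1) : exists M, {subset s <= lbox n.+1 M}.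
Proof.
elim: s => [|j s [M sM]]; first by exists 0%N.
pose A := (\sum_i `|j ord0 i|)%N.
exists (maxn M A) => k; rewrite inE mem_lbox => /predU1P[->|ks]; apply/forallP => i.
  have : (`|j ord0 i| <= maxn M A)%N.
    by rewrite (leq_trans _ (leq_maxr _ _))// /A (bigD1 i)//= leq_addr.
  by move: (maxn _ _) (j _ _) => a b; lia.
have := sM k ks; rewrite mem_lbox => /forallP/(_ i).
by have := leq_maxl M A; move: (maxn _ _) (k _ _) => a b; lia.
Qed.

(** Schur's test: |b_i b_j| <= (b_i^2 + b_j^2) / 2, and the rows and columns of |K (i - j)| sum to
    at most [l1_norm K]. *)
Lemma cov_form_le_l1 s (b : 'rV[int]_n.+1 -> R) : uniq s ->
  cov_form K s b b <= l1_norm K * \sum_(j <- s) b j ^+ 2.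
Proof.
move=> us; have rows i : \sum_(j <- s) `|K (i - j)| <= l1_norm K.
  rewrite -(big_map (fun j => i - j) xpredT (fun k => `|K k|)).
  by apply: sum_norm_le_l1 => //; rewrite map_inj_uniq// => x y /addrI/oppr_inj.
have cols j : \sum_(i <- s) `|K (i - j)| <= l1_norm K.
  rewrite -(big_map (fun i => i - j) xpredT (fun k => `|K k|)).
  by apply: sum_norm_le_l1 => //; rewrite map_inj_uniq// => x y /addIr.
apply: (@le_trans _ _ (\sum_(i <- s) \sum_(j <- s)
    (b i ^+ 2 / 2 * `|K (i - j)| + b j ^+ 2 / 2 * `|K (i - j)|))).
  apply: ler_sum => i _; apply: ler_sum => j _.
  apply: (le_trans (ler_norm _)); rewrite -mulrDl normrM ler_wpM2r//.
  rewrite ler_norml; have := sqr_ge0 (b i - b j); have := sqr_ge0 (b i + b j).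
  have -> : (b i - b j) ^+ 2 = b i ^+ 2 + b j ^+ 2 - 2 * (b i * b j) by ring.
  have -> : (b i + b j) ^+ 2 = b i ^+ 2 + b j ^+ 2 + 2 * (b i * b j) by ring.
  by move: (b i * b j) (b i ^+ 2) (b j ^+ 2) => x y z ? ?; apply/andP; split; lra.
under eq_bigr do rewrite big_split/=.
rewrite big_split/= [X in _ + X]exchange_big/=.
have h : \sum_(i <- s) b i ^+ 2 / 2 * l1_norm K = l1_norm K * (\sum_(j <- s) b j ^+ 2) / 2.
  by rewrite -mulr_suml -mulr_suml; ring.
have -> : l1_norm K * \sum_(j <- s) b j ^+ 2 =
    \sum_(i <- s) b i ^+ 2 / 2 * l1_norm K + \sum_(i <- s) b i ^+ 2 / 2 * l1_norm K.
  by rewrite h; field.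
by apply: lerD; apply: ler_sum => i _; rewrite -mulr_sumr ler_wpM2l// divr_ge0// sqr_ge0.
Qed.

Section at_scale.
Variables (L : R) (M : nat) (s0 : seq 'rV[int]_n.+1).
Hypotheses (s0M : {subset s0 <= lbox n.+1 M})
  (s0_tail : forall t, uniq t -> {in t, forall j, j \notin s0} -> \sum_(j <- t) `|K j| <= 2^-1).

Let B := ball_pts n.+1 L.

Let mem_shift (p k : 'rV[int]_n.+1) : (k \in map (fun i => i - p) B) = (enorm (lattice_pt R (p + k)) <= L).
Proof.
rewrite -mem_ball_pts; apply/mapP/idP => [[i iB ->]|h]; first by rewrite addrC subrK.
by exists (p + k) => //; rewrite addrC addKr.
Qed.

Let uniq_shift (p : 'rV[int]_n.+1) : uniq (map (fun i => i - p) B).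
Proof. by rewrite map_inj_uniq ?ball_pts_uniq//; exact: addIr. Qed.

(** Seen from p and from p + e0, the ball agrees on [s0] except possibly at 0, where K 0 = 1 is
    gained. Off [s0] the differences of indicators are at most 1 in absolute value, and |K| sums to
    at most 1/2. *)
Lemma cov_ball_top_point p : enorm (lattice_pt R p) <= L ->
  L < enorm (lattice_pt R (p + e0)) ->
  (forall k, k \in lbox n.+1 M -> k != 0 ->
    (enorm (lattice_pt R (p + k)) <= L) = (enorm (lattice_pt R (p + e0 + k)) <= L)) ->
  2^-1 <= \sum_(i <- B) (K (i - p) - K (i - (p + e0))).
Proof.
move=> pL peL pk; pose W := undup (map (fun i => i - p) B ++ map (fun i => i - (p + e0)) B).
have uW : uniq W by exact: undup_uniq.
have W0 : 0 \in W by rewrite mem_undup mem_cat mem_shift addr0 pL.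
rewrite sumrB -(big_map (fun i => i - p) xpredT K) -(big_map (fun i => i - (p + e0)) xpredT K).
rewrite -(@sum_indicatorM R n.+1 _ W) ?uniq_shift//; last first.
  by move=> j jB; rewrite mem_undup mem_cat jB.
rewrite -(@sum_indicatorM R n.+1 (map (fun i => i - (p + e0)) B) W) ?uniq_shift//; last first.
  by move=> j jB; rewrite mem_undup mem_cat jB orbT.
rewrite -sumrB (bigD1_seq 0)//= !mem_shift !addr0 pL [_ <= L]leNgt peL/= K_0 mul1r mul0r subr0.
suff h : `|\sum_(i <- W | i != 0) ((i \in map (fun i => i - p) B)%:R * K i -
    (i \in map (fun i => i - (p + e0)) B)%:R * K i)| <= 2^-1.
  by move: h; rewrite ler_norml => /andP[+ _]; move: (\sum_(_ <- _ | _) _) => x; lra.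
apply: (le_trans (ler_norm_sum _ _ _)).
apply: (@le_trans _ _ (\sum_(i <- [seq k <- W | k \notin s0]) `|K i|)); last first.
  apply: s0_tail; first exact: filter_uniq.
  by move=> j; rewrite mem_filter => /andP[].
rewrite big_filter big_mkcond [leRHS]big_mkcond/=; apply: ler_sum => k _.
case: ifP => [k0|_]; last by case: ifP.
rewrite !mem_shift; case: ifPn => [_|]; last first.
  by move=> /negPn/s0M h; rewrite pk// subrr normr0.
rewrite -mulrBl normrM ler_piMl//.
by case: (_ <= L); case: (_ <= L); rewrite ?subrr ?subr0 ?sub0r ?normrN ?normr1 ?normr0.
Qed.

Let arith (u V q y l : R) : 0 <= u -> u / 2 <= q -> q ^+ 2 <= V * y -> y <= l * (2 * u) ->
  0 <= V -> 0 <= l -> u <= 8 * l * V.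
Proof.
move=> u0 uq qV yl V0 l0; have [->|un0] := eqVneq u 0; first by rewrite !mulr_ge0.
have u1 : 0 < u by rewrite lt_neqAle eq_sym un0.
have h : (u / 2) ^+ 2 <= V * (l * (2 * u)).
  apply: le_trans (ler_wpM2l V0 yl); apply: le_trans qV.
  have u2 : 0 <= u / 2 by rewrite divr_ge0.
  by apply: lerXn2r; rewrite ?nnegrE// (le_trans u2).
rewrite -(ler_pM2r u1).
have -> : u * u = 4 * (u / 2) ^+ 2 by field.
have -> : 8 * l * V * u = 4 * (V * (l * (2 * u))) by ring.
by rewrite ler_wpM2l.
Qed.

Let sum_one (X : seq 'rV[int]_n.+1) : \sum_(j <- X) 1 = (size X)%:R :> R.
Proof. by rewrite -sum1_size natr_sum. Qed.

Variable U : seq 'rV[int]_n.+1.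
Hypotheses (uU : uniq U)
  (topU : {in U, forall p, [/\ enorm (lattice_pt R p) <= L, L < enorm (lattice_pt R (p + e0)) &
    forall k, k \in lbox n.+1 M -> k != 0 ->
      (enorm (lattice_pt R (p + k)) <= L) = (enorm (lattice_pt R (p + e0 + k)) <= L)]}).

(** Let u be the size of [U], l the norm [l1_norm K] and V the double sum over the ball. Against 1_U
    - 1_U' the covariance of the ball is at least u / 2, and the form of 1_U - 1_U' is at most 2 l
    u; Cauchy-Schwarz gives u^2 / 4 <= 2 l u V. *)
Lemma cov_ball_top_points :
  (size U)%:R <= 8 * l1_norm K * \sum_(i <- B) \sum_(j <- B) K (i - j).
Proof.
pose U' := map (fun p => p + e0) U.
have uU' : uniq U' by rewrite map_inj_uniq//; exact: addIr.
pose s := undup (B ++ U ++ U').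
have us : uniq s by exact: undup_uniq.
have Bs : {subset B <= s} by move=> j jB; rewrite mem_undup !mem_cat jB.
have Us : {subset U <= s} by move=> j jU; rewrite mem_undup !mem_cat jU orbT.
have U's : {subset U' <= s} by move=> j jU; rewrite mem_undup !mem_cat jU !orbT.
have uB : uniq B by exact: ball_pts_uniq.
pose a (j : 'rV[int]_n.+1) : R := (j \in B)%:R.
pose b (j : 'rV[int]_n.+1) : R := (j \in U)%:R - (j \in U')%:R.
have aa : cov_form K s a a = \sum_(i <- B) \sum_(j <- B) K (i - j).
  rewrite -(sum_indicatorM _ uB us Bs); apply: eq_bigr => i _.
  by rewrite -(sum_indicatorM _ uB us Bs) mulr_sumr; apply: eq_bigr => j _; rewrite mulrA.
have ab : cov_form K s a b = \sum_(p <- U) \sum_(i <- B) (K (i - p) - K (i - (p + e0))).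
  rewrite exchange_big/= -(sum_indicatorM _ uB us Bs); apply: eq_bigr => i _.
  rewrite sumrB -(big_map (fun p => p + e0) xpredT (fun q => K (i - q))) -/U'.
  rewrite -(sum_indicatorM _ uU us Us) -(sum_indicatorM _ uU' us U's) -sumrB mulr_sumr.
  by apply: eq_bigr => j _; rewrite /b -mulrA mulrBl.
have bb : cov_form K s b b <= l1_norm K * (2 * (size U)%:R).
  apply: (le_trans (cov_form_le_l1 b us)); rewrite ler_wpM2l ?l1_norm_ge0//.
  apply: (@le_trans _ _ (\sum_(j <- s) ((j \in U)%:R * 1 + (j \in U')%:R * 1))).
    apply: ler_sum => j _; rewrite /b; case: (j \in U); case: (j \in U') => /=; lra.
  rewrite big_split/= (sum_indicatorM _ uU us Us) (sum_indicatorM _ uU' us U's).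
  by rewrite !sum_one size_map; lra.
have abge : (size U)%:R / 2 <= cov_form K s a b.
  rewrite ab -sum1_size natr_sum mulr_suml big_seq [leRHS]big_seq.
  apply: ler_sum => p pU; rewrite mul1r.
  by have [h1 h2 h3] := topU pU; exact: cov_ball_top_point.
have cs := cov_form_cauchy_schwarz K_even K_psd s a b.
have V0 : 0 <= cov_form K s a a by exact: K_psd.
rewrite aa in cs V0; move: (\sum_(i <- B) _) cs V0 => V cs V0.
have u0 : 0 <= (size U)%:R :> R by [].
by apply: arith u0 abge cs bb V0 _; exact: l1_norm_ge0.
Qed.

End at_scale.

Lemma cov_ball_ge : exists c L0 : R, [/\ 0 < c, 1 <= L0 & forall L, L0 <= L ->
  c * L ^+ n <= \sum_(i <- ball_pts n.+1 L) \sum_(j <- ball_pts n.+1 L) K (i - j)].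
Proof.
have [s0 us0 s0_tail] := l1_tail K_l1 (ltac:(by rewrite invr_gt0) : 0 < 2^-1 :> R).
have [M s0M] := seq_sub_lbox s0.
have [c [L0 [c0 L01 H]]] := top_points R n M.
have l1 : 0 < l1_norm K.
  have := sum_norm_le_l1 K_l1 (isT : uniq [:: (0 : 'rV[int]_n.+1)]).
  by rewrite big_seq1 K_0 normr1; exact: lt_le_trans.
exists (c / (8 * l1_norm K)), L0; split => //; first by rewrite divr_gt0// mulr_gt0.
move=> L LL0; have [U [uU cU] topU] := H L LL0.
have h := le_trans cU (cov_ball_top_points s0M s0_tail uU topU).
by rewrite mulrAC ler_pdivrMr ?mulr_gt0// mulrC mulrC [leRHS]mulrC.
Qed.

End variance_lower_bound.

(** * Conclusion *)

Section theta.
Variables (R : realType) (n : nat) (K : 'rV[int]_n.+1 -> R).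
Hypothesis K_l1 : summable [set: 'rV[int]_n.+1] (fun j => (K j)%:E).
Hypotheses (K_even : forall j, K (- j) = K j) (K_0 : K 0 = 1).
Hypothesis K_psd : forall s (a : 'rV[int]_n.+1 -> R),
    0 <= \sum_(i <- s) \sum_(j <- s) a i * a j * K (i - j).

Let S := structure_function K.
Let M := l1_norm K.

Hypothesis S_reg : regular_at_origin S.

Let mS : measurable_fun setT S. Proof. exact: measurable_structure_function. Qed.

Let S0 xi : 0 <= S xi. Proof. exact: structure_function_ge0. Qed.

Let SM xi : S xi <= M.
Proof. by rewrite -[leLHS]ger0_norm ?S0//; exact: norm_structure_function_le. Qed.

Let tS : tame S.
Proof.
by apply: (@bounded_tame _ _ _ M) => // xi; exact: norm_structure_function_le.
Qed.

Let M0 : 0 <= M. Proof. exact: l1_norm_ge0. Qed.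

Definition ball_cov (L : R) : R :=
  \sum_(i <- ball_pts n.+1 L) \sum_(j <- ball_pts n.+1 L) K (i - j).

Let power L : R := cube_integral (fun xi => S xi * bpow L xi).

Let powerE L : power L = (2 * pi) ^+ n.+1 * ball_cov L.
Proof.
rewrite /power /cube_integral /bpow (integral_weight_tpow mS (norm_structure_function_le K_l1)).
rewrite mulr_sumr; apply: eq_bigr => i _; rewrite mulr_sumr; apply: eq_bigr => j _.
by rewrite !mul1r fourier_structure_function.
Qed.

(** The normalization K 0 = 1 fixes the total mass of S. It bounds the far part of the kernel
    integral from above and the whole of it from below. *)
Let mean : cube_integral S = (2 * pi) ^+ n.+1.
Proof.
have := fourier_structure_function K_l1 K_even 0; rewrite K_0 mulr1 => <-.
apply: eq_Rintegral => xi _.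
by rewrite /phase lattice_pt0 dotp0 cos0 mulr1.
Qed.

Definition theta_integral (L : R) : R :=
  cube_integral (fun xi => structure_function K xi * kernel n L (enorm xi)).

Let tSk L : 0 < L -> tame (fun xi => S xi * kernel n L (enorm xi)).
Proof. by move=> L0; apply: tameM => //; exact: tame_kernel. Qed.

Let tSb L : tame (fun xi => S xi * bpow L xi).
Proof. by apply: tameM => //; exact: tame_bpow. Qed.

Let tpball t : tame (\1_(pball t) : 'rV[R]_n.+1 -> R).
Proof. by apply: tame_indic; exact: measurable_pball. Qed.

Let tfar t : tame (\1_(far t) : 'rV[R]_n.+1 -> R).
Proof. by apply: tame_indic; exact: measurable_far. Qed.

Let measurable_zero : measurable [set (0 : 'rV[R]_n.+1)].
Proof.
rewrite -punctured_space; apply: measurableC.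
rewrite (_ : [set x | _] = @enorm R n.+1 @^-1` `]0, +oo[%classic).
  by apply: measurable_preim => //; exact: measurable_enorm.
by apply/seteqP; split => x /=; rewrite in_itv/= andbT.
Qed.

Let cube_integral_zero (f : 'rV[R]_n.+1 -> R) : tame f ->
  cube_integral (fun xi => \1_[set 0] xi * f xi) = 0.
Proof.
move=> tf; have m0 := measurable_zero.
have s0 : [set (0 : 'rV[R]_n.+1)] `<=` cube.
  by move=> _ -> i; rewrite mxE oppr_le0 pi_ge0.
apply: EFin_inj; rewrite -(cube_integral_indic m0 s0 tf).
apply: null_set_integral => //; last exact: lebesgue_row0.
by apply/measurable_EFinP; apply: measurable_funTS; case: tf.
Qed.

(** [pball] omits the origin, which is split off as a null set. *)
Let split_integral e (f : 'rV[R]_n.+1 -> R) : 0 < e -> tame f ->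
  cube_integral f = cube_integral (fun xi => \1_(pball e) xi * f xi) +
    cube_integral (fun xi => \1_(far e) xi * f xi).
Proof.
move=> e0 tf; have tp : tame (fun xi => \1_(pball e) xi * f xi) by exact: tameM.
have tr : tame (fun xi => \1_(far e) xi * f xi) by exact: tameM.
have tz : tame (fun xi => \1_[set 0] xi * f xi).
  by apply: tameM => //; apply: tame_indic.
rewrite -[RHS]add0r -(cube_integral_zero tf) -cube_integralD// -cube_integralD//; last exact: tameD.
apply: eq_Rintegral => xi _; rewrite !indicE.
have [x0|x0] := eqVneq (enorm xi) 0.
  have -> : (xi \in [set 0]) by rewrite inE; exact: enorm_eq0.
  have -> : (xi \in pball e) = false.
    by apply/negbTE; rewrite notin_setE /pball/= x0 ltxx.
  have -> : (xi \in far e) = false.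
    by apply/negbTE; rewrite notin_setE /far/= x0 => /(lt_trans e0); rewrite ltxx.
  by rewrite !mul0r mul1r !addr0.
have -> : (xi \in [set 0]) = false.
  by apply/negbTE; rewrite notin_setE => h; move: x0; rewrite h enorm0 eqxx.
have xp : 0 < enorm xi by rewrite lt_neqAle eq_sym x0 enorm_ge0.
have [xe|xe] := leP (enorm xi) e.
  have -> : (xi \in pball e) by rewrite inE; apply/andP.
  have -> : (xi \in far e) = false.
    by apply/negbTE; rewrite notin_setE /far/= => /lt_le_trans/(_ xe); rewrite ltxx.
  by rewrite !mul0r mul1r addr0 add0r.
have -> : (xi \in far e) by rewrite inE.
have -> : (xi \in pball e) = false.
  by apply/negbTE; rewrite notin_setE => /andP[_ /(lt_le_trans xe)]; rewrite ltxx.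
by rewrite !mul0r mul1r !add0r.
Qed.

Let coef_ge0 (k a b E T D : R) : 0 <= k -> 0 <= a -> 0 <= b -> 0 <= E -> 0 <= T -> 0 <= D ->
  0 <= k * a + 2 * a /\ 0 <= k * (b + E) + T + (2 * a * E + b + D).
Proof. by move=> *; split; rewrite !(addr_ge0, mulr_ge0). Qed.

(** Here P, G and F are the integrals of S near the origin against the power of the lattice ball,
    the kernel and the squared transform; Pf and Gf are the parts of the first two far from the
    origin, and l is L^n. *)
Let combine (k a b E T D l F P Pf G Gf : R) : 0 <= k -> 0 <= a -> 0 <= b -> 0 <= E ->
  0 <= T -> 0 <= D -> 0 <= l -> 0 <= Pf -> 0 <= Gf -> 0 <= P -> 0 <= G ->
  F <= a * G + b * l -> G <= a * F + b * l -> F <= 2 * P + 2 * E * l ->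
  P <= k * (F + E * l) -> Pf <= T * l -> Gf <= D * l ->
  P + Pf <= (k * a + 2 * a) * (G + Gf) + (k * (b + E) + T + (2 * a * E + b + D)) * l /\
  G + Gf <= (k * a + 2 * a) * (P + Pf) + (k * (b + E) + T + (2 * a * E + b + D)) * l.
Proof.
move=> k0 a0 b0 E0 T0 D0 l0 Pf0 Gf0 P0 G0 h1 h2 h3 h4 h5 h6.
have n1 : 0 <= k * a * Gf + 2 * a * (G + Gf) + (2 * a * E + b + D) * l.
  by rewrite !(addr_ge0, mulr_ge0).
have n2 : 0 <= k * a * (P + Pf) + 2 * a * Pf + (k * (b + E) + T) * l.
  by rewrite !(addr_ge0, mulr_ge0).
have h1' := ler_wpM2l k0 h1; have h3' := ler_wpM2l a0 h3.
by split; lra.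
Qed.

(** The far parts are O(L^n): for the power by its tail estimate and S <= M, for the kernel by its
    decay and the total mass of S. The near parts go through the transform of the ball. *)
Let power_theta : exists a b : R, [/\ 0 <= a, 0 <= b & forall L, 1 <= L ->
  power L <= a * theta_integral L + b * L ^+ n /\
  theta_integral L <= a * power L + b * L ^+ n].
Proof.
have [e [a [b [[e0 e1 en a0 b0] H]]]] := local_radial_compare mS S0 tS S_reg.
pose Ec := M * error_const R n; pose k8 : R := 8 / cell_volume R n.+1 ^+ 2.
have Ec0 : 0 <= Ec by rewrite mulr_ge0// ltW// error_const_gt0.
have k80 : 0 <= k8 by rewrite divr_ge0// sqr_ge0.
pose T := M * tail_const R n / e; pose D := (2 * pi) ^+ n.+1 / e ^+ n.+2.
have T0 : 0 <= T by rewrite divr_ge0 ?(ltW e0)// mulr_ge0// ltW// tail_const_gt0.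
have D0 : 0 <= D by rewrite divr_ge0 ?exprn_ge0 ?(ltW e0)// mulr_ge0// pi_ge0.
exists (k8 * a + 2 * a), (k8 * (b + Ec) + T + (2 * a * Ec + b + D)).
have [a0' b0'] := (ltW a0, ltW b0).
have [ca cb] := coef_ge0 k80 a0' b0' Ec0 T0 D0; split => //.
move=> L L1; have L0 : 0 < L by exact: lt_le_trans L1.
have l0 : 0 <= L ^+ n by rewrite exprn_ge0// ltW.
have [h1 h2] := H L L1.
have SMe xi : enorm xi <= e -> S xi <= M by [].
have h3 := local_ball_transform_le tS S0 SMe M0 L1.
have h4 := local_bpow_le tS S0 SMe M0 L1 en.
have far_bpow : cube_integral (fun xi => \1_(far e) xi * (S xi * bpow L xi)) <= T * L ^+ n.
  apply: (@le_trans _ _ (M * cube_integral (fun xi => \1_(far e) xi * bpow L xi))).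
    rewrite -cube_integralZ; last by apply: tameM => //; exact: tame_bpow.
    apply: le_cube_integral; first exact: tameM.
      by apply: tameM; [exact: tame_cst|apply: tameM => //; exact: tame_bpow].
    by move=> xi _; rewrite mulrCA ler_wpM2r// mulr_ge0// bpow_ge0.
  have h := bpow_tail n L1 (introT andP (conj e0 e1)).
  apply: (le_trans (ler_wpM2l M0 h)); rewrite le_eqVlt; apply/orP; left; apply/eqP.
  by rewrite /T; field; rewrite gt_eqF.
have far_kernel : cube_integral (fun xi => \1_(far e) xi * (S xi * kernel n L (enorm xi))) <= D * L ^+ n.
  have -> : D * L ^+ n = L ^+ n / e ^+ n.+2 * cube_integral S by rewrite mean /D; ring.
  rewrite -cube_integralZ//; apply: le_cube_integral.
  - by apply: tameM => //; exact: tSk.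
  - by apply: tameM => //; exact: tame_cst.
  move=> xi _; rewrite indicE; case: (boolP (xi \in far e)) => xe; last first.
    by rewrite mul0r mulr_ge0// divr_ge0 ?exprn_ge0 ?(ltW e0) ?(ltW L0).
  rewrite inE in xe; have x0 : 0 < enorm xi by exact: lt_trans xe.
  rewrite mul1r mulrC ler_wpM2r// (le_trans (kernel_le_div n L0 x0))//.
  rewrite ler_wpM2l// lef_pV2 ?posrE ?exprn_gt0//.
  by apply: lerXn2r; rewrite ?nnegrE ?(ltW e0) ?(ltW x0) ?(ltW xe).
have fb0 : 0 <= cube_integral (fun xi => \1_(far e) xi * (S xi * bpow L xi)).
  by apply: cube_integral_ge0 => xi _; rewrite !mulr_ge0// bpow_ge0.
have fk0 : 0 <= cube_integral (fun xi => \1_(far e) xi * (S xi * kernel n L (enorm xi))).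
  by apply: cube_integral_ge0 => xi _; rewrite !mulr_ge0// kernel_ge0.
have P0 : 0 <= local_integral S e (bpow L).
  by apply: local_integral_ge0 => // xi; exact: bpow_ge0.
have G0 : 0 <= local_integral S e (fun xi => kernel n L (enorm xi)).
  by apply: local_integral_ge0 => // xi; exact: kernel_ge0.
rewrite /power (split_integral e0 (tSb L)) /theta_integral (split_integral e0 (tSk L0)).
rewrite -!/(local_integral S e _) -/k8 -/Ec in h1 h2 h3 h4 *.
exact: (combine (F := local_integral S e (fun xi => ball_transform L xi ^+ 2))).
Qed.

Lemma theta_integral_ge : exists c, 0 < c /\ forall L, 1 <= L -> c * L ^+ n <= theta_integral L.
Proof.
(* An upper bound for the Euclidean norm on the cube, where the nonincreasing kernel is then at
   least its value at [D]. *)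
pose D : R := n.+1%:R * pi.
have D1 : 1 <= D.
  rewrite /D -[leLHS]mulr1; apply: ler_pM => //; first by rewrite ler1n.
  by rewrite (le_trans _ (pi_ge2 R))// ler1n.
have D0 : 0 < D by exact: lt_le_trans D1.
exists ((2 * pi) ^+ n.+1 / D ^+ n.+2); split.
  by rewrite divr_gt0 ?exprn_gt0// mulr_gt0// pi_gt0.
move=> L L1; have L0 : 0 < L by exact: lt_le_trans L1.
rewrite -mean mulrAC -mulrA mulrC -cube_integralZ//.
apply: le_cube_integral; [by apply: tameM => //; exact: tame_cst|exact: tSk|].
move=> xi cxi; rewrite mulrC ler_wpM2l//.
have xD : enorm xi <= D.
  apply: (le_trans (enorm_le_sum xi)).
  apply: (@le_trans _ _ (\sum_(i < n.+1) pi)); last by rewrite sumr_const card_ord -mulr_natl.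
  by apply: ler_sum => i _; rewrite ler_norml; exact: cxi.
apply: (@le_trans _ _ (kernel n L D)).
  rewrite /kernel; case: (leP D L^-1) => // DL.
  rewrite (_ : 2 * n.+1 = n + n.+2)%N ?exprD; last by lia.
  rewrite ler_wpM2l ?exprn_ge0 ?(ltW L0)// (@le_trans _ _ 1)//.
    by rewrite invf_le1 ?exprn_gt0// exprn_ege1.
  by rewrite exprn_ege1.
have [x0|x0] := eqVneq (enorm xi) 0.
  by rewrite x0 (@kernel_small _ _ L 0) ?invr_ge0 ?(ltW L0)// kernel_le_pow.
by apply: kernel_noninc => //; rewrite lt_neqAle eq_sym x0 enorm_ge0.
Qed.

(** Both quantities dominate a multiple of L^n, so each additive term is absorbed into the quantity
    that it is added to. The summand 1 in the constants only makes them positive. *)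
Lemma ball_cov_theta : exists c1 c2 L0 : R, [/\ 0 < c1, 0 < c2, 0 < L0 &
  forall L, L0 < L -> c1 * theta_integral L <= ball_cov L <= c2 * theta_integral L].
Proof.
have [a [b [a0 b0 H]]] := power_theta.
have [c [c0 Hc]] := theta_integral_ge.
have [c' [L0 [c'0 L01 Hc']]] := cov_ball_ge K_l1 K_even K_0 K_psd.
pose q : R := (2 * pi) ^+ n.+1; have q0 : 0 < q by rewrite exprn_gt0// mulr_gt0// pi_gt0.
have u1 : 0 < a * q + b / c' + 1.
  apply: ltr_wpDl => //; apply: addr_ge0; first by apply: mulr_ge0 => //; exact: ltW.
  by apply: divr_ge0 => //; exact: ltW.
have u2 : 0 < a + b / c + 1 by rewrite ltr_wpDl// addr_ge0// divr_ge0// ltW.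
exists (a * q + b / c' + 1)^-1, ((a + b / c + 1) / q), L0; split.
- by rewrite invr_gt0.
- by rewrite divr_gt0.
- exact: lt_le_trans L01.
move=> L L0L; have L1 : 1 <= L by exact: le_trans (ltW L0L).
have l0 : 0 <= L ^+ n by rewrite exprn_ge0// (le_trans _ L1).
have [] := H L L1; rewrite powerE -/q.
have h1 := Hc L L1; have h2 := Hc' L (ltW L0L); rewrite -/(ball_cov L) in h2.
have {h1} h1 : L ^+ n <= theta_integral L / c by rewrite ler_pdivlMr// mulrC.
have {h2} h2 : L ^+ n <= ball_cov L / c' by rewrite ler_pdivlMr// mulrC.
move: h1 h2; move: (theta_integral L) (ball_cov L) => t v h1 h2 h3 h4.
have t0 : 0 <= t.
  by have := le_trans l0 h1; rewrite pmulr_lge0// invr_gt0.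
have v0 : 0 <= v.
  by have := le_trans l0 h2; rewrite pmulr_lge0// invr_gt0.
have {}h1 := ler_wpM2l b0 h1; have {}h2 := ler_wpM2l b0 h2.
apply/andP; split.
- rewrite mulrC ler_pdivrMr//; move: h2; rewrite (mulrCA b) => h2.
  have -> : v * (a * q + b / c' + 1) = a * (q * v) + v * (b / c') + v by ring.
  by lra.
- rewrite mulrAC ler_pdivlMr//; move: h1; rewrite (mulrCA b) => h1.
  have -> : (a + b / c + 1) * t = a * t + t * (b / c) + t by ring.
  by rewrite mulrC; lra.
Qed.

End theta.

Lemma theta_integralE (R : realType) n (K : 'rV[int]_n.+1 -> R) (L : R) : 0 < L ->
  summable [set: 'rV[int]_n.+1] (fun j => (K j)%:E) ->
  ((L ^+ (2 * n.+1))%:E *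
     \int[lebesgue_row R n.+1]_(xi in cube `&` [set xi | (enorm xi <= 1 / L)%R])
       (structure_function K xi)%:E +
   (L ^+ (n.+1 - 1))%:E *
     \int[lebesgue_row R n.+1]_(xi in cube `&` [set xi | (1 / L < enorm xi)%R])
       (structure_function K xi / enorm xi ^+ (n.+1 + 1))%:E =
   (theta_integral K L)%:E)%E.
Proof.
move=> L0 K_l1; set S := structure_function K.
have mS : measurable_fun setT S by exact: measurable_structure_function.
have tS : tame S.
  apply: (@bounded_tame _ _ _ (l1_norm K)) => // xi; exact: norm_structure_function_le.
have tk : tame (fun xi => S xi * kernel n L (enorm xi)).
  by apply: tameM => //; exact: tame_kernel.
rewrite subn1 addn1 div1r /=.
have near_ball : cube `&` [set xi : 'rV[R]_n.+1 | enorm xi <= L^-1] = cube `&` eball L^-1 by [].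
have m1 : measurable (cube `&` [set xi : 'rV[R]_n.+1 | enorm xi <= L^-1]).
  by apply: measurableI; [exact: measurable_cube|exact: measurable_eball].
have m2 : measurable (cube `&` [set xi : 'rV[R]_n.+1 | L^-1 < enorm xi]).
  by apply: measurableI; [exact: measurable_cube|exact: measurable_far].
have Ln : L ^+ n != 0 by rewrite expf_neq0// gt_eqF.
have t2 : tame (fun xi => (L ^+ n)^-1 * (S xi * kernel n L (enorm xi))).
  by apply: tameM => //; exact: tame_cst.
rewrite (cube_integral_indic m1 (@subIsetl _ _ _) tS).
(* S / |xi|^(n+2) may be unbounded near the origin; on the far region it equals L^-n S times the
   kernel, which is bounded on the whole cube. *)
rewrite (eq_integral (fun xi => ((L ^+ n)^-1 * (S xi * kernel n L (enorm xi)))%:E)); last first.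
  move=> xi; rewrite inE => -[_ Lxi]; congr EFin.
  rewrite /kernel leNgt Lxi/=; field.
  rewrite Ln/= expf_neq0// gt_eqF// (lt_trans _ Lxi)// invr_gt0//.
rewrite (cube_integral_indic m2 (@subIsetl _ _ _) t2) -!EFinM -EFinD; congr EFin.
have i1 := tame_indic m1; have i2 := tame_indic m2.
rewrite -!cube_integralZ; [|exact: tameM|exact: tameM].
rewrite -cube_integralD; last 2 first.
- by apply: tameM; [exact: tame_cst|exact: tameM].
- by apply: tameM; [exact: tame_cst|exact: tameM].
apply: eq_Rintegral => xi; rewrite inE => cxi; rewrite !indicE /kernel.
have [xL|xL] := leP (enorm xi) L^-1.
  rewrite mem_set//= memNset ?mul1r ?mul0r ?mulr0 ?addr0 1?mulrC//.
  by case=> _ /=; rewrite ltNge xL.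
rewrite memNset; last by case=> _ /=; rewrite leNgt xL.
by rewrite mem_set// mul0r mulr0 add0r mul1r mulVKf.
Qed.

Theorem theorem1 (R : realType) (d : nat) (d_ge1 : (1 <= d)%N)
    (disp : measure_display) (Omega : measurableType disp)
    (P : probability Omega R) (X : 'rV[int]_d -> {RV P >-> R})
    (K : 'rV[int]_d -> R)
    (X_mean0 : forall i, ('E_P[X i] = 0)%E)
    (X_var1 : forall i, variance P (X i) = 1%E)
    (X_invariant : translation_invariant X)
    (X_cov : forall i j, ('E_P[X i \* X j] = (K (i - j)%R)%:E)%E)
    (K_l1 : summable [set: 'rV[int]_d] (fun j => (K j)%:E))
    (S_regular : regular_at_origin (structure_function K))
    (S_bounded : exists M : R,
      forall xi, cube xi -> `|structure_function K xi| <= M) :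
  let S := structure_function K in
  exists2 c : R, 0 < c &
    is_Theta
      (fun L => variance P (Q (eball L) X))
      (fun L =>
        (L ^+ (2 * d))%:E *
          \int[lebesgue_row R d]_(xi in cube `&` [set xi | (enorm xi <= c / L)%R])
            (S xi)%:E
        + (L ^+ (d - 1))%:E *
          \int[lebesgue_row R d]_(xi in cube `&` [set xi | (c / L < enorm xi)%R])
            (S xi / enorm xi ^+ (d + 1))%:E)%E.
Proof.
(* With c = 1 the domains are separated at the radius 1 / L, where the two branches of the kernel
   meet. *)
move=> S; exists 1 => //; rewrite /S {S}.
case: d d_ge1 X K X_mean0 X_var1 X_invariant X_cov K_l1 S_regular S_bounded => // n _
  X K X_mean0 X_var1 _ X_cov K_l1 S_regular _.
have K_even := cov_even X_cov.
have K_0 := cov_0 X_mean0 X_cov (X_var1 0).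
have K_psd := cov_psd X_cov.
have [c1 [c2 [L0 [c10 c20 L00 H]]]] := ball_cov_theta K_l1 K_even K_0 K_psd S_regular.
exists c1, c2, L0; split => // L L0L.
rewrite theta_integralE//; last exact: lt_trans L0L.
rewrite (variance_Q X_mean0 X_cov (ball_pts_uniq n.+1 L)); last first.
  by move=> i; rewrite mem_ball_pts.
by rewrite -!EFinM !lee_fin; exact: H.
Qed.
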